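(* Let $V:\mathbb{R}^n\to[0,\infty)$ be continuous with $V(x)\to\infty$ as $\|x\|\to\infty$, let $\lambda\in\mathbb{R}$, and let $u:\mathbb{R}^n\to\mathbb{R}$ be an ($L^2$) eigenfunction, i.e. a solution of $$-\tfrac12\Delta u+Vu=\lambda u\qquad\text{in }\mathbb{R}^n .$$ Let $E=\{y\in\mathbb{R}^n: V(y)\le\lambda\}$ and let $\rho_\lambda(E,\cdot)$ be the Agmon distance to $E$. Suppose that for some $\varepsilon>0$ and some constant $c_\varepsilon$, $$|u(y)|\le c_\varepsilon\exp\bigl(-(1-\varepsilon)\,\rho_\lambda(E,y)\bigr)\qquad\text{for all }y\in\mathbb{R}^n\setminus E .$$ Then for every $x\in\mathbb{R}^n\setminus E$ and every $\alpha>\rho_\lambda(E,x)$, $$|u(x)|\le c_\varepsilon e^{-(1-\varepsilon)\alpha}+\omega_x^{(\Omega_\alpha)}(\partial E)\cdot\|u\|_{L^\infty(\mathbb{R}^n)},$$ where $\Omega_\alpha=\{y\in\mathbb{R}^n\setminus E:\rho_\lambda(E,y)\le\alpha\}$ and $\omega_x^{(\Omega_\alpha)}(\partial E)$ is the harmonic measure of $\partial E$ in $\Omega_\alpha$ with pole $x$.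
   Context: For $x,y\in\mathbb{R}^n$ the Agmon distance is $$\rho_\lambda(x,y)=\inf_\gamma\int_0^1\max\bigl(\sqrt2\,\sqrt{V(\gamma(t))-\lambda},\,0\bigr)\,|\dot\gamma(t)|\,dt,$$ where $\gamma:[0,1]\to\mathbb{R}^n$ ranges over all (piecewise $C^1$) paths with $\gamma(0)=x$, $\gamma(1)=y$, and the integrand is understood to be $0$ where $V(\gamma(t))\le\lambda$. The Agmon distance to the allowed region $E$ is $\rho_\lambda(E,x)=\inf_{y\in E}\rho_\lambda(x,y)$. The set $\mathbb{R}^n\setminus E=\{V>\lambda\}$ is called the forbidden region. The harmonic measure $\omega_x^{(\Omega_\alpha)}(\partial E)$ is the probability that standard Brownian motion in $\mathbb{R}^n$ started at $x$ first exits $\Omega_\alpha$ by hitting $\partial E$, i.e. that its first hitting point on $\partial\Omega_\alpha$ lies in $\partial E$. The boundary $\partial\Omega_\alpha$ consists of a subset of $\partial E$ and of points $y$ with $\rho_\lambda(E,y)=\alpha$. *)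

(* Defs.v *)
From HB Require Import structures.
From mathcomp Require Import all_boot all_order all_algebra.
From mathcomp Require Import all_classical all_reals all_analysis.

Set Implicit Arguments.
Unset Strict Implicit.
Unset Printing Implicit Defensive.

Import Order.TTheory GRing.Theory Num.Theory.
Import numFieldNormedType.Exports.

Local Open Scope classical_set_scope.
Local Open Scope ring_scope.

(* The library norm `|x| on 'rV[R]_n is the sup norm; it induces the usual
   topology, but lengths of curves need the Euclidean norm. *)
Definition enorm (R : realType) (n : nat) (x : 'rV[R]_n) : R :=
  Num.sqrt (\sum_(i < n) x ord0 i ^+ 2).

Definition boundary (T : topologicalType) (A : set T) : set T :=
  closure A `\` interior A.

(* Lebesgue measure on R^n, as the n-fold product of the one-dimensional
   Lebesgue measure. The library puts the product sigma-algebra on n-tuples and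
   the topology on row vectors, so the measure lives on tuples and functions on
   'rV[R]_n are pulled back along [tuple_row]. *)

Definition tcons (R : realType) (n : nat)
    (p : measurableTypeR R * n.-tuple (measurableTypeR R)) :
  n.+1.-tuple (measurableTypeR R) := [tuple of p.1 :: p.2].

Lemma measurable_tcons (R : realType) (n : nat) :
  measurable_fun [set: measurableTypeR R * n.-tuple (measurableTypeR R)]
    (@tcons R n).
Proof. exact: measurable_cons measurable_fst measurable_snd. Qed.

Section lebesgue_cons.
Variables (R : realType) (n : nat).
Variable mu : {sigma_finite_measure set (n.-tuple (measurableTypeR R)) -> \bar R}.

Definition lebesgue_cons :
    set (n.+1.-tuple (measurableTypeR R)) -> \bar R :=
  pushforward (lebesgue_measure \x mu)%E (@tcons R n).

Let lebesgue_cons0 : lebesgue_cons set0 = 0%E.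
Proof. by rewrite /lebesgue_cons /pushforward preimage_set0 measure0. Qed.

Let lebesgue_cons_ge0 A : (0 <= lebesgue_cons A)%E.
Proof. by rewrite /lebesgue_cons /pushforward; exact: measure_ge0. Qed.

Let lebesgue_cons_sigma_additive : semi_sigma_additive lebesgue_cons.
Proof.
have mK A : measurable A -> measurable (@tcons R n @^-1` A).
  by move=> mA; rewrite -[X in measurable X]setTI; exact: measurable_tcons.
move=> F mF tF mUF; rewrite /lebesgue_cons /pushforward preimage_bigcup.
apply: measure_semi_sigma_additive => [k||]; first exact: mK.
- apply/trivIsetP => i j _ _ ij; rewrite -preimage_setI.
  by move/trivIsetP : tF => /(_ _ _ _ _ ij) ->//; rewrite preimage_set0.
- by rewrite -preimage_bigcup; exact: mK.
Qed.

HB.instance Definition _ := isMeasure.Build _ _ _ lebesgue_cons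
  lebesgue_cons0 lebesgue_cons_ge0 lebesgue_cons_sigma_additive.

Let lebesgue_cons_sigma_finite : sigma_finite setT lebesgue_cons.
Proof.
pose g (t : n.+1.-tuple (measurableTypeR R)) :
    measurableTypeR R * n.-tuple (measurableTypeR R) :=
  (thead t, [tuple of behead t]).
have gK p : g (tcons p) = p.
  by case: p => a t; rewrite /g /tcons theadE; congr pair; exact: val_inj.
have mg : measurable_fun setT g.
  apply: measurable_fun_pair; last exact: measurable_behead.
  exact: measurable_tnth.
have /sigma_finiteP[F [FT ndF Foo]] := sigma_finiteT (@lebesgue_measure R).
have /sigma_finiteP[G [GT ndG Goo]] := sigma_finiteT mu.
exists (fun k => g @^-1` (F k `*` G k)).
  rewrite -preimage_bigcup (_ : \bigcup_k _ = setT) ?preimage_setT//.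
  apply/seteqP; split=> // -[a t] _.
  have [i _ Fi] : (\bigcup_k F k) a by rewrite -FT.
  have [j _ Gj] : (\bigcup_k G k) t by rewrite -GT.
  exists (maxn i j) => //; split => /=.
    by move: Fi; exact/subsetPset/ndF/leq_maxl.
  by move: Gj; exact/subsetPset/ndG/leq_maxr.
move=> k; have [mF Fk] := Foo k; have [mG Gk] := Goo k; split.
  by rewrite -[X in measurable X]setTI; apply: mg => //; exact: measurableX.
rewrite /lebesgue_cons /pushforward -comp_preimage.
rewrite (_ : g \o _ = id); last by apply/funext => p; exact: gK.
by rewrite preimage_id product_measure1E// lte_mul_pinfty// ge0_fin_numE.
Qed.

HB.instance Definition _ := Measure_isSigmaFinite.Build _ _ _ lebesgue_cons
  lebesgue_cons_sigma_finite.

End lebesgue_cons.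

Fixpoint lebesgue_n (R : realType) (n : nat) :
    {sigma_finite_measure set (n.-tuple (measurableTypeR R)) -> \bar R} :=
  match n with
  | 0 => dirac ([tuple] : 0.-tuple (measurableTypeR R))
  | m.+1 => lebesgue_cons (lebesgue_n R m)
  end.

Definition tuple_row (R : realType) (n : nat)
  (t : n.-tuple (measurableTypeR R)) : 'rV[R]_n := \row_i tnth t i.

Definition pderiv (R : realType) (n : nat) (i : 'I_n)
    (f : 'rV[R]_n -> R) : 'rV[R]_n -> R :=
  fun x => 'D_(delta_mx ord0 i) f x.

Definition laplacian (R : realType) (n : nat) (f : 'rV[R]_n -> R) :
    'rV[R]_n -> R :=
  fun x => \sum_(i < n) pderiv i (pderiv i f) x.

(* Partial derivatives of every order exist and are continuous. *)
Definition smooth (R : realType) (n : nat) (f : 'rV[R]_n -> R) : Prop :=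
  forall s : seq 'I_n, let g := foldr (@pderiv R n) f s in
    continuous g /\ forall x i, derivable g x (delta_mx ord0 i).

Definition test_function (R : realType) (n : nat) (phi : 'rV[R]_n -> R) : Prop :=
  smooth phi /\
  exists2 K : set 'rV[R]_n, compact K & forall x, ~ K x -> phi x = 0.

(* V is only continuous, so an eigenfunction need not be C^2 and the equation is
   meant in the sense of distributions. Eigenfunctions are identified with their
   continuous representative, which exists by elliptic regularity. *)
Definition eigenfunction (R : realType) (n : nat) (V : 'rV[R]_n -> R)
    (lambda : R) (u : 'rV[R]_n -> R) : Prop :=
  [/\ continuous u,
      exists x, u x != 0,
      ('N[lebesgue_n R n]_(2%:E)[EFin \o u \o @tuple_row R n] < +oo)%E &
      forall phi, test_function phi ->
        \int[lebesgue_n R n]_t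
          (let x := tuple_row t in
           u x * (- 2^-1 * laplacian phi x + V x * phi x)) =
        lambda * \int[lebesgue_n R n]_t
          (u (tuple_row t) * phi (tuple_row t))].

Definition sup_norm (R : realType) (n : nat) (u : 'rV[R]_n -> R) : \bar R :=
  'N[lebesgue_n R n]_(+oo)%E[EFin \o u \o @tuple_row R n]%E.

Definition C1_curve (R : realType) (n : nat) (g : R -> 'rV[R]_n) : Prop :=
  (forall t, derivable g t 1) /\ continuous (derive1 g).

(* [0, 1] is cut at 0 < s_1 < ... < s_k = 1, and on each closed piece the curve
   is C^1 up to the endpoints (i.e. extends to a C^1 curve on R). Consecutive
   pieces share an endpoint, so the curve is continuous on [0, 1]. *)
Definition piecewise_C1 (R : realType) (n : nat) (gamma : R -> 'rV[R]_n) : Prop :=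
  exists s : seq R, [/\ path <%R 0 s, last 0 s = 1 &
    forall i, (i < size s)%N -> exists2 g : R -> 'rV[R]_n, C1_curve g &
      {in `[nth 0 (0 :: s) i, nth 0 (0 :: s) i.+1], gamma =1 g}].

(* [Num.sqrt] is 0 on negative reals. *)
Definition agmon_length (R : realType) (n : nat) (V : 'rV[R]_n -> R)
    (lambda : R) (gamma : R -> 'rV[R]_n) : \bar R :=
  (\int[lebesgue_measure]_(t in `[0%R, 1%R])
     (Num.max (Num.sqrt 2 * Num.sqrt (V (gamma t) - lambda)) 0
      * enorm (derive1 gamma t))%:E)%E.

Definition agmon (R : realType) (n : nat) (V : 'rV[R]_n -> R) (lambda : R)
    (x y : 'rV[R]_n) : \bar R :=
  ereal_inf [set agmon_length V lambda gamma | gamma in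
    [set gamma | [/\ piecewise_C1 gamma, gamma 0 = x & gamma 1 = y]]].

Definition allowed (R : realType) (n : nat) (V : 'rV[R]_n -> R) (lambda : R) :
  set 'rV[R]_n := [set y | V y <= lambda].

(* Equal to +oo when the allowed region is empty. *)
Definition agmon_allowed (R : realType) (n : nat) (V : 'rV[R]_n -> R)
    (lambda : R) (x : 'rV[R]_n) : \bar R :=
  ereal_inf [set agmon V lambda x y | y in allowed V lambda].

Definition Omega (R : realType) (n : nat) (V : 'rV[R]_n -> R)
    (lambda alpha : R) : set 'rV[R]_n :=
  [set y | ~ allowed V lambda y /\ (agmon_allowed V lambda y <= alpha%:E)%E].

(* Taking some A i to be setT yields the product rule for every subfamily. *)
Definition mutually_independent d (T : measurableType d) (R : realType)
    (P : probability T R) (I : finType) (X : I -> T -> R) : Prop :=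
  forall A : I -> set (measurableTypeR R), (forall i, measurable (A i)) ->
    P (\bigcap_i (X i @^-1` A i)) = (\prod_(i : I) P (X i @^-1` A i))%E.

(* Standard Brownian motion in R^n started at x. The time index ranges over R;
   only times t >= 0 are constrained. [normal_prob m s] has standard deviation
   s. The increments are independent jointly in time and coordinate. *)
Definition brownian_motion d (T : measurableType d) (R : realType)
    (P : probability T R) (n : nat) (x : 'rV[R]_n) (B : R -> T -> 'rV[R]_n) :
    Prop :=
  [/\ forall w, B 0 w = x,
      forall w, {within `[0, +oo[, continuous (B ^~ w)},
      forall t i, 0 <= t ->
        measurable_fun [set: T] (fun w => B t w ord0 i : measurableTypeR R),
      forall s t i, 0 <= s -> s < t ->
        forall A : set (measurableTypeR R), measurable A ->
        P ((fun w => B t w ord0 i - B s w ord0 i) @^-1` A) =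
        normal_prob 0 (Num.sqrt (t - s)) A &
      forall (k : nat) (tau : nat -> R),
        0 <= tau 0%N -> (forall j, (j < k)%N -> tau j < tau j.+1) ->
        mutually_independent P (fun (ji : 'I_k * 'I_n) (w : T) =>
          B (tau ji.1.+1) w ord0 ji.2 - B (tau ji.1) w ord0 ji.2)].

(* The path w of B hits D, and its first hitting point of D lies in F. *)
Definition first_hit_in d (T : measurableType d) (R : realType) (n : nat)
    (B : R -> T -> 'rV[R]_n) (D F : set 'rV[R]_n) : set T :=
  [set w | exists t, [/\ 0 <= t, D (B t w),
    forall s, 0 <= s -> s < t -> ~ D (B s w) & F (B t w)]].

(* Harmonic measure of F in W, with pole at the starting point of the Brownian
   motion B. *)
Definition harmonic_measure d (T : measurableType d) (R : realType)
    (P : probability T R) (n : nat) (B : R -> T -> 'rV[R]_n)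
    (W F : set 'rV[R]_n) : \bar R :=
  P (first_hit_in B (boundary W) F).

(* Main.v *)
Require Import Defs.
From HB Require Import structures.
From mathcomp Require Import all_boot all_order all_algebra.
From mathcomp Require Import all_classical all_reals all_analysis.
From mathcomp Require Import measurable_realfun.
From mathcomp Require Import ring lra.

Set Implicit Arguments.
Unset Strict Implicit.
Unset Printing Implicit Defensive.

Import Order.TTheory GRing.Theory Num.Theory.
Import numFieldNormedType.Exports.

Local Open Scope classical_set_scope.
Local Open Scope ring_scope.

(** Where [V > lambda] the equation reads [laplacian u = 2 (V - lambda) u], so a
    positive [u] is subharmonic there and [u (B t)] is a submartingale. Up to
    replacing [u] by [- u], let [u x > 0]. The Brownian motion is run from [x]
    until it leaves the part of [Omega] where [u > eta], a bounded set because
    [V] is coercive ([agmon_sublevel_bounded]). Either [u = eta] at the exit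
    point, or the exit point is on the boundary of [Omega]. In the second case it
    may lie where [V > lambda]; then the decay hypothesis gives
    [`|u| <= c e^{-(1 - eps) alpha}] by continuity of [u] ([boundary_decay]).
    Otherwise the path has just met the boundary of [Omega] for the first time,
    at a point of the boundary of the allowed region ([exit_allowed]): this has
    the harmonic measure as probability, and [`|u|] is at most its supremum there.
    Taking means and letting [eta] tend to 0 gives the bound.

    The submartingale property is obtained without stochastic integration. Since
    [u] is merely continuous and solves the equation in the weak sense, it is
    replaced by its convolution [f] with a product of one-dimensional bumps, which
    is within [eta] of [u] on a ball and has a nonnegative Laplacian where the
    equation makes [u] subharmonic ([subharmonic_approx_exists]). Along each
    coordinate, [f (y + s e_i) - f y] is expanded to second order, with [sinh s]
    and [cosh s - 1] in the roles of [s] and [s^2 / 2] ([coord_expansion]): for a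
    centred Gaussian [s] both means are read off from [E e^{ts} = e^{t^2 h / 2}],
    the first one vanishing and the second one being positive. So the mean of [f]
    decreases in one time step [h] by at most a cubic error [O(h^{3/2})], and along
    [1 / h] steps, stopped when the region is left, by [O(h^{1/2})]
    ([stopped_value_ge]).

    Two limits turn the grid walk into the path: the mesh tends to 0 for a fixed
    level [theta] of the function cutting out the region ([grid_limit]), then
    [theta] tends to 0 ([level_limit]); probabilities follow by the reverse Fatou
    inequality ([prob_lim_sup]). Walks that stay in the bounded region for a long
    time are negligible, a Gaussian of large variance having a small density
    ([brownian_slab]). These steps are put together in [brownian_max]. *)

(** * Gaussian exponential moments *)

Section normal_mgf.
Variable R : realType.
Local Notation mu := (@lebesgue_measure R).
Import HBNNSimple.

(** By monotone convergence along simple functions. *)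
Lemma integral_normal_prob (m s : R) (f : measurableTypeR R -> \bar R) :
  measurable_fun setT f -> (forall x, 0 <= f x)%E ->
  (\int[normal_prob m s]_x f x = \int[mu]_x (f x * (normal_pdf m s x)%:E))%E.
Proof.
move=> mf f0.
have mpdf : measurable_fun setT (fun x : measurableTypeR R => (normal_pdf m s x)%:E).
  by apply/measurable_EFinP; exact: measurable_normal_pdf.
have pdf0 x : (0 <= (normal_pdf m s x)%:E)%E by rewrite lee_fin normal_pdf_ge0.
pose g := nnsfun_approx measurableT mf.
have gf (x : measurableTypeR R) : (fun k => (g k x)%:E) @ \oo --> f x by apply: cvg_nnsfun_approx.
have ndg (x : measurableTypeR R) : nondecreasing_seq (fun k => (g k x)%:E).
  move=> a b ab; rewrite lee_fin.
  by have /lefP := nd_nnsfun_approx measurableT mf ab; exact.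
have gE k : (\int[normal_prob m s]_x (g k x)%:E =
             \int[mu]_x ((g k x)%:E * (normal_pdf m s x)%:E))%E.
  rewrite integralT_nnsfun sintegralE.
  under [RHS]eq_integral => x _.
    rewrite fimfunE -fsumEFin// ge0_mule_fsuml; last first.
      by move=> r; rewrite EFinM; exact: nnfun_muleindic_ge0.
    over.
  rewrite ge0_integral_fsum//=; first last.
  - move=> r x _; rewrite mule_ge0//.
    by rewrite EFinM; exact: nnfun_muleindic_ge0.
  - move=> r; apply: emeasurable_funM => //.
    by apply/measurable_EFinP; apply: measurable_funM => //; exact: measurable_indic.
  apply: eq_fsbigr => r rg.
  under eq_integral do rewrite EFinM -muleA.
  rewrite ge0_integralZl//; first last.
  - by move: rg; rewrite inE => -[x _ <-]; rewrite lee_fin.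
  - by move=> x _; rewrite mule_ge0.
  - by apply: emeasurable_funM => //; apply/measurable_EFinP; exact: measurable_indic.
  congr (_ * _)%E.
  transitivity (\int[mu]_(x in g k @^-1` [set r]) (normal_pdf m s x)%:E)%E => //.
  rewrite [LHS]integral_mkcond; apply: eq_integral => x _.
  by rewrite patchE indicE; case: ifPn => //= _; rewrite ?mul1e ?mul0e.
transitivity (limn (fun k => \int[normal_prob m s]_x (g k x)%:E))%E.
  rewrite -monotone_convergence//.
  - by apply: eq_integral => x _; apply/esym/cvg_lim => //; exact: gf.
  - by move=> k; apply/measurable_EFinP.
  - by move=> k x _; rewrite lee_fin.
transitivity (limn (fun k => \int[mu]_x ((g k x)%:E * (normal_pdf m s x)%:E)))%E.
  by congr (limn _); apply/funext => k; rewrite gE.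
rewrite -monotone_convergence//.
- apply: eq_integral => x _; apply/cvg_lim => //; apply: cvgeZr => //; exact: gf.
- by move=> k; apply: emeasurable_funM => //; apply/measurable_EFinP.
- by move=> k x _; rewrite mule_ge0// lee_fin.
- by move=> x _ a b ab; rewrite lee_wpmul2r//; exact: ndg.
Qed.

(** Completing the square turns [e^{tx}] times the centred density of variance
    [s^2] into [e^{t^2 s^2 / 2}] times the density of mean [t s^2]. *)
Lemma normal_mgf (s t : R) : s != 0 ->
  (\int[normal_prob 0 s]_x (expR (t * x))%:E =
   (expR (t ^+ 2 * s ^+ 2 / 2))%:E)%E.
Proof.
move=> s0; rewrite integral_normal_prob//; last first.
  by apply/measurable_EFinP; apply: measurableT_comp => //; exact: measurable_funM.
have E (x : R) : expR (t * x) * normal_pdf 0 s x =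
    expR (t ^+ 2 * s ^+ 2 / 2) * normal_pdf (t * s ^+ 2) s x.
  rewrite !normal_pdfE// mulrCA [RHS]mulrCA; congr (_ * _).
  rewrite /normal_fun -!expRD; congr expR.
  by field.
under eq_integral do rewrite -EFinM E EFinM.
rewrite ge0_integralZl//=; last first.
- by move=> x _; rewrite lee_fin normal_pdf_ge0.
- by apply/measurable_EFinP; exact: measurable_normal_pdf.
by rewrite integral_normal_pdf mule1.
Qed.

End normal_mgf.

(** * Integrals of products of independent variables *)

Section independent_product.
Context d (T : measurableType d) (R : realType) (P : probability T R).
Context d1 (T1 : measurableType d1).
Variables (Y : T -> T1) (X : T -> R).
Hypothesis mY : measurable_fun setT Y.
Hypothesis mX : measurable_fun setT (X : T -> measurableTypeR R).
Hypothesis indep : forall A (B : set (measurableTypeR R)),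
  measurable A -> measurable B ->
  P (Y @^-1` A `&` X @^-1` B) = (P (Y @^-1` A) * P (X @^-1` B))%E.

Let X' : T -> measurableTypeR R := X.
HB.instance Definition _ := isMeasurableFun.Build _ _ _ _ Y mY.
HB.instance Definition _ := isMeasurableFun.Build _ _ _ _ X' mX.

Let YX (w : T) : T1 * measurableTypeR R := (Y w, X' w).
Let mYX : measurable_fun setT YX.
Proof. exact: measurable_fun_pair. Qed.
HB.instance Definition _ := isMeasurableFun.Build _ _ _ _ YX mYX.

(** The joint law is the product of the laws, as it agrees with it on rectangles;
    then Tonelli's theorem applies. *)
Lemma ge0_integral_indep (f : T1 -> \bar R) (g : measurableTypeR R -> \bar R) :
  measurable_fun setT f -> measurable_fun setT g ->
  (forall y, 0 <= f y)%E -> (forall y, 0 <= g y)%E ->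
  (\int[P]_w (f (Y w) * g (X w)) = \int[P]_w f (Y w) * \int[P]_w g (X w))%E.
Proof.
move=> mf mg f0 g0.
pose F (z : T1 * measurableTypeR R) := (f z.1 * g z.2)%E.
have mF : measurable_fun setT F.
  by apply: emeasurable_funM; apply: measurableT_comp.
have F0 z : (0 <= F z)%E by rewrite mule_ge0.
transitivity (\int[distribution P YX]_z F z)%E.
  by rewrite ge0_integral_distribution.
transitivity (\int[distribution P Y \x distribution P X']_z F z)%E.
  apply: eq_measure_integral => //= A mA _; symmetry.
  apply: product_measure_unique => // B C mB mC.
rewrite fubini_tonelli1//.
under eq_integral => y _.
  rewrite /fubini_F /F /= ge0_integralZl//; over.
rewrite ge0_integralZr//.
- by rewrite !ge0_integral_distribution.
- exact: integral_ge0.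
Qed.

(** Shifting [f] by its bound reduces the signed case to the nonnegative one. *)
Lemma integral_indep (f : T1 -> R) (g : measurableTypeR R -> R) (M : R) :
  measurable_fun setT f -> measurable_fun setT g ->
  (forall y, `|f y| <= M) -> (forall y, 0 <= g y) ->
  P.-integrable setT (EFin \o g \o X) ->
  \int[P]_w (f (Y w) * g (X w)) = (\int[P]_w f (Y w)) * \int[P]_w g (X w).
Proof.
move=> mf mg fM g0 ig.
have mfY : measurable_fun setT (f \o Y) by exact: measurableT_comp.
have mgX : measurable_fun setT (g \o X') by exact: measurableT_comp.
have intf : P.-integrable setT (EFin \o f \o Y).
  apply: (@le_integrable _ _ _ P _ measurableT _ (cst M%:E)) => //.
  - exact/measurable_EFinP.
  - move=> w _ /=; rewrite lee_fin.
    by rewrite [leRHS]ger0_norm// (le_trans _ (fM (Y w))).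
  - exact: finite_measure_integrable_cst.
have M0 : 0 <= M.
  by apply: le_trans (fM (Y point)).
have intfg : P.-integrable setT (EFin \o (fun w => f (Y w) * g (X w))).
  apply: (@le_integrable _ _ _ P _ measurableT _ (fun w => (M%:E * (g (X w))%:E)%E)) => //.
  - by apply/measurable_EFinP; exact: measurable_funM.
  - move=> w _ /=; rewrite lee_fin !normrM ler_pM//.
    by rewrite [leRHS]ger0_norm.
  - exact: integrableZl.
have := @ge0_integral_indep (fun y => (f y + M)%:E) (EFin \o g).
have mfM : measurable_fun setT (fun y => (f y + M)%:E).
  by apply/measurable_EFinP; exact: measurable_funD.
have mg' : measurable_fun setT (EFin \o g) by exact/measurable_EFinP.
move=> /(_ mfM mg').
have fM0 y : (0 <= (f y + M)%:E)%E.
  by have := fM y; rewrite lee_fin ler_norml; lra.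
have g0' y : (0 <= (EFin \o g) y)%E by rewrite /= lee_fin.
move=> /(_ fM0 g0').
under eq_integral do rewrite -EFinM mulrDl EFinD.
have iMg : P.-integrable setT (fun w => (M * g (X w))%:E).
  exact: (@integrableZl _ _ _ P _ measurableT _ _ ig).
rewrite integralD//.
under [in RHS]eq_integral do rewrite EFinD.
rewrite integralD//; last exact: finite_measure_integrable_cst.
under [X in (_ + X)%E]eq_integral do rewrite EFinM.
have icst : (\int[P]__ M%:E = M%:E)%E.
  by rewrite integral_cst//= [X in (_ * X)%E](probability_setT P) mule1.
rewrite icst integralZl//.
rewrite -(fineK (integrable_fin_num measurableT intfg)).
rewrite -(fineK (integrable_fin_num measurableT ig)).
rewrite -(fineK (integrable_fin_num measurableT intf)).
move=> [] /=; rewrite mulrDl => /addIr.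
exact.
Qed.

End independent_product.

Section other_coordinates.
Context d (T : measurableType d) (R : realType) (P : probability T R).
Context (J : finType) (X : J -> T -> R) (a : J).
Hypothesis mX : forall i, measurable_fun setT (X i : T -> measurableTypeR R).
Hypothesis indepX : mutually_independent P X.

(** A pi-system, so that the independence of [X a] from its members extends to
    the sigma-algebra of all the other variables. *)
Definition other_cylinder : set (set T) :=
  [set S | exists A : J -> set (measurableTypeR R),
     [/\ forall i, measurable (A i), A a = setT & S = \bigcap_i (X i @^-1` A i)]].

Let mXV i (A : set (measurableTypeR R)) : measurable A -> measurable (X i @^-1` A).
Proof. by move=> mA; rewrite -[X in measurable X]setTI; exact: mX. Qed.

Let measurable_cylinder : other_cylinder `<=` measurable.
Proof.
move=> _ [A [mA _ ->]]; apply: fin_bigcap_measurable => // i _.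
exact: mXV.
Qed.

Lemma other_cylinder_indep (A : set T) (B : set (measurableTypeR R)) :
  <<s other_cylinder >> A -> measurable B ->
  P (A `&` X a @^-1` B) = (P A * P (X a @^-1` B))%E.
Proof.
move=> sA mB.
have mXB := mXV a mB.
have PXB : P (X a @^-1` B) \is a fin_num by rewrite fin_num_measure.
pose c : {nonneg R} := NngNum (fine_ge0 (measure_ge0 P (X a @^-1` B))).
have cylT : other_cylinder setT.
  by exists (fun=> setT); split => //; rewrite bigcapT.
transitivity (mrestr P mXB A); first by [].
transitivity (mscale c P A); last by rewrite /mscale/= fineK// muleC.
apply: (@g_sigma_algebra_measure_unique _ R T other_cylinder measurable_cylinder
  (fun=> setT) _ _ (mrestr P mXB) (mscale c P)) => //.
- by rewrite bigcup_const//; exists 0%N.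
- move=> _ _ [A1 [mA1 A1a ->]] [A2 [mA2 A2a ->]].
  exists (fun i => A1 i `&` A2 i); split.
  + by move=> i; exact: measurableI.
  + by rewrite A1a A2a setTI.
  + by rewrite -bigcapI; apply: eq_bigcapr => i _; rewrite preimage_setI.
- move=> _ [A1 [mA1 A1a ->]].
  transitivity (P (\bigcap_i (X i @^-1` A1 i) `&` X a @^-1` B)) => //.
  transitivity ((fine (P (X a @^-1` B)))%:E * P (\bigcap_i (X i @^-1` A1 i)))%E => //.
  rewrite fineK// muleC.
  have -> : \bigcap_i (X i @^-1` A1 i) `&` X a @^-1` B =
      \bigcap_i (X i @^-1` (if i == a then B else A1 i)).
    apply/seteqP; split=> [w [wA wB] i _|w wA].
      by case: eqP => [->//|_]; exact: wA.
    split; last by have := wA a I; rewrite eqxx.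
    move=> i _; have := wA i I; case: eqP => [-> _|//].
    by rewrite A1a.
  have mA2 i : measurable (if i == a then B else A1 i) by case: ifP.
  rewrite (indepX mA2) (indepX mA1).
  rewrite (bigD1 a)//= [in RHS](bigD1 a)//= eqxx A1a preimage_setT probability_setT mul1e muleC.
  by congr (_ * _)%E; apply: eq_bigr => i /negbTE ->.
- move=> _; rewrite -[X in (X < _)%E]/(P (setT `&` X a @^-1` B)) setTI.
  by rewrite ltey_eq PXB.
Qed.

Local Notation T1 := (g_sigma_algebraType other_cylinder).

Lemma measurable_other i : i != a ->
  measurable_fun [set: T1] (X i : T1 -> measurableTypeR R).
Proof.
move=> ia _ B mB; rewrite setTI.
apply: sub_sigma_algebra; exists (fun j => if j == i then B else setT); split.
- by move=> j; case: ifP.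
- by rewrite eq_sym (negbTE ia).
- apply/seteqP; split=> [w wB j _ /=|w /(_ i I)]; last by rewrite eqxx.
  by case: eqP => [->|].
Qed.

Lemma integral_mul_indep (f : T1 -> R) (g : measurableTypeR R -> R) (M : R) :
  measurable_fun setT f -> measurable_fun setT g ->
  (forall y, `|f y| <= M) -> (forall y, 0 <= g y) ->
  P.-integrable setT (EFin \o g \o X a) ->
  \int[P]_w (f w * g (X a w)) = (\int[P]_w f w) * \int[P]_w g (X a w).
Proof.
move=> mf mg fM g0 ig.
apply: (@integral_indep _ _ _ P _ T1 id (X a)) fM g0 ig => //.
  move=> _ B mB; rewrite setTI preimage_id.
  suff : <<s other_cylinder >> `<=` @measurable _ T by apply.
  apply: smallest_sub => //; exact: sigma_algebra_measurable.
by move=> A B mA mB; rewrite preimage_id; exact: other_cylinder_indep.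
Qed.

End other_coordinates.

(** * Row vectors: norms and measurability *)

Section row_vectors.
Variables (R : realType) (n : nat).
Implicit Types x y : 'rV[R]_n.

Lemma coord_le_norm x i : `|x ord0 i| <= `|x|.
Proof.
by rewrite [leRHS]/Num.norm /= mx_normrE; apply/bigmax_geP; right => /=; exists (ord0, i).
Qed.

Lemma norm_le_coord x (e : R) : 0 <= e -> (forall i, `|x ord0 i| <= e) -> `|x| <= e.
Proof.
move=> e0 xe; rewrite [leLHS]/Num.norm /= mx_normrE.
by apply/bigmax_leP; split => // -[j i] _ /=; rewrite ord1.
Qed.

Lemma norm_lt_coord x (e : R) : 0 < e -> (forall i, `|x ord0 i| < e) -> `|x| < e.
Proof.
move=> e0 xe; rewrite [ltLHS]/Num.norm /= mx_normrE.
by apply/bigmax_ltP; split => // -[j i] _ /=; rewrite ord1.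
Qed.

(** An open set is the union of the countably many boxes of rational centre and
    size inside it, so measurability of the coordinates is enough. *)
Lemma measurable_preimage_open d (T : measurableType d) (Y : T -> 'rV[R]_n)
    (U : set 'rV[R]_n) :
  (forall i, measurable_fun setT (fun w => Y w ord0 i : measurableTypeR R)) ->
  open U -> measurable (Y @^-1` U).
Proof.
move=> mY oU.
pose box (qk : 'rV[rat]_n * nat) : set 'rV[R]_n :=
  [set y | forall i, `|y ord0 i - ratr (qk.1 ord0 i)| < qk.2.+1%:R^-1].
pose F qk := [set w | box qk (Y w) /\ box qk `<=` U].
have -> : Y @^-1` U = \bigcup_qk F qk.
  apply/seteqP; split=> [w /= Uw|w [qk _ [bw bU]]]; last exact: bU.
  have /nbhs_ballP[e /= e0 eU] := oU _ Uw.
  have e20 : 0 < e / 2 by rewrite divr_gt0.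
  have [k] := ltr_add_invr e20.
  rewrite add0r => ke.
  have qP i : exists q : rat, `|Y w ord0 i - ratr q| < k.+1%:R^-1.
    have [|q] := @rat_in_itvoo _ (Y w ord0 i) (Y w ord0 i + k.+1%:R^-1).
      by rewrite ltrDl.
    rewrite in_itv/= => /andP[h1 h2]; exists q.
    have k0 : 0 < k.+1%:R^-1 :> R by [].
    move: h1 h2 k0; move: (k.+1%:R^-1 : R) (ratr q : R) => z r h1 h2 k0.
    by rewrite ltr_norml; apply/andP; split; lra.
  pose q : 'rV[rat]_n := \row_i xchoose (qP i).
  exists (q, k) => //; split => [i|y yb].
    by rewrite mxE; exact: (xchooseP (qP i)).
  apply: eU; rewrite -ball_normE /=; apply: norm_lt_coord => // i; rewrite !mxE.
  have := yb i; have := xchooseP (qP i); rewrite /= mxE; move: ke.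
  move: (ratr (xchoose (qP i)) : R) => a; move: (k.+1%:R^-1 : R) => z ke.
  rewrite !ltr_norml => /andP[? ?] /andP[? ?].
  by apply/andP; split; lra.
apply: countable_bigcupT_measurable; first exact: countableP.
move=> qk; have [bU|nbU] := pselect (box qk `<=` U); last first.
  rewrite (_ : F qk = set0)//; apply/seteqP; split => // w [_]; exact: nbU.
rewrite (_ : F qk = \bigcap_(i in [set: 'I_n])
  ((fun w => Y w ord0 i) @^-1` [set r | `|r - ratr (qk.1 ord0 i)| < qk.2.+1%:R^-1])).
  apply: fin_bigcap_measurable => // i _.
  rewrite -[X in measurable X]setTI; apply: mY => //.
  rewrite (_ : [set r | _] = ball (ratr (qk.1 ord0 i) : R^o) qk.2.+1%:R^-1).
    exact: measurable_ball.
  by apply/seteqP; split => r; rewrite -ball_normE /= distrC.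
apply/seteqP; split=> [w [bw _] i _|w wb]; first exact: bw.
by split => // i; exact: wb.
Qed.

Lemma measurable_continuous_comp d (T : measurableType d) (Y : T -> 'rV[R]_n)
    (g : 'rV[R]_n -> R) :
  (forall i, measurable_fun setT (fun w => Y w ord0 i : measurableTypeR R)) ->
  continuous g -> measurable_fun setT (fun w => g (Y w) : measurableTypeR R).
Proof.
move=> mY cg.
apply: (measurability (@RGenOInfty.G R)); first exact: RGenOInfty.measurableE.
move=> _ [_ [r ->] <-]; rewrite setTI.
rewrite -[X in measurable X]/(Y @^-1` (g @^-1` `]r, +oo[)).
apply: measurable_preimage_open => //.
by apply: open_comp => //; exact: interval_open.
Qed.

End row_vectors.
Lemma lipschitz_continuous (R : realType) (n : nat) (g : 'rV[R]_n -> R) (K : R) :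
  (forall y z, `|g y - g z| <= K * `|y - z|) -> continuous g.
Proof.
move=> gK y.
have ff : Filter (nbhs y) by exact: nbhs_filter.
apply/(@cvgrPdist_lt R R^o 'rV[R]_n (nbhs y) ff g (g y)) => e e0.
have K0 : 0 < `|K| + 1 by rewrite ltr_wpDl.
apply/nbhs_ballP; exists (e / (`|K| + 1)) => /=; first by rewrite divr_gt0.
move=> z; rewrite -ball_normE /= ltr_pdivlMr// => h.
apply: le_lt_trans (gK y z) _; apply: le_lt_trans h.
by rewrite mulrC ler_wpM2l// (le_trans (ler_norm _))// lerDl.
Qed.

(** * Expansions along the coordinate directions *)

Section cosh_expansion.
Variables (R : realType) (n : nat).
Implicit Types (y : 'rV[R]_n) (s : R).

Definition sinh s : R := (expR s - expR (- s)) / 2.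
Definition cosh1 s : R := (expR s + expR (- s)) / 2 - 1.

Lemma cosh1_ge0 s : 0 <= cosh1 s.
Proof.
rewrite /cosh1; have := expR_ge1Dx s; have := expR_ge1Dx (- s); lra.
Qed.

(** Writing [cosh s - 1 = (e^{s/2} (1 - e^{-s}))^2 / 2] reduces it to
    [1 - e^{-s} <= s] for [s >= 0]. *)
Lemma cosh1_le s : cosh1 s <= s ^+ 2 * expR `|s|.
Proof.
wlog s0 : s / 0 <= s.
  move=> H; have [|s0] := leP 0 s; first exact: H.
  have := H (- s); rewrite normrN sqrrN /cosh1 opprK [expR (- s) + _]addrC; apply; lra.
rewrite ger0_norm//.
have -> : cosh1 s = ((expR (s / 2) * (1 - expR (- s))) ^+ 2) / 2.
  have E1 : expR s = expR (s / 2) ^+ 2 by rewrite -expRM_natl; congr expR; field.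
  have E2 : expR (- s) = (expR (s / 2) ^+ 2)^-1 by rewrite expRN E1.
  rewrite /cosh1 E2 E1; field; exact: lt0r_neq0 (expR_gt0 _).
have h1 := expR_ge1Dx (- s).
have h2 : expR (- s) <= 1 by rewrite -expR0 ler_expR; lra.
rewrite exprMn -expRM_natl (_ : 2%:R * (s / 2) = s); last by field.
rewrite -mulrA [leRHS]mulrC ler_wpM2l ?expR_ge0//.
apply: (@le_trans _ _ (s ^+ 2 / 2)); last first.
  by rewrite ler_pdivrMr// ler_peMr ?sqr_ge0// ler1n.
rewrite ler_pM2r ?invr_gt0// ler_sqr ?nnegrE; lra.
Qed.

(** Dominates the cubic remainder by exponentials in [s / h], whose means do not
    depend on [h] when [s] has standard deviation [h]. *)
Lemma cube_expR_le s (h : R) : 0 < h -> h <= 1 ->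
  `|s| ^+ 3 * expR `|s| <= 27 * h ^+ 3 * (expR (2 / h * s) + expR (- (2 / h) * s)).
Proof.
move=> h0 h1; pose a := `|s| / h.
have a0 : 0 <= a by rewrite divr_ge0// ltW.
have sE : `|s| = a * h by rewrite /a divfK// gt_eqF.
have a3 : a ^+ 3 <= 27 * expR a.
  have -> : expR a = expR (a / 3) ^+ 3 by rewrite -expRM_natl; congr expR; field.
  have := expR_ge1Dx (a / 3) => h3.
  have h4 : a / 3 <= expR (a / 3) by lra.
  have : (a / 3) ^+ 3 <= expR (a / 3) ^+ 3 by rewrite lerXn2r// nnegrE ?expR_ge0// divr_ge0.
  by rewrite expr_div_n; lra.
have e2 : expR a * expR `|s| <= expR (2 / h * s) + expR (- (2 / h) * s).
  apply: (@le_trans _ _ (expR (2 * a))).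
    rewrite -expRD ler_expR sE.
    have : a * h <= a * 1 by rewrite ler_wpM2l.
    lra.
  have [s0|s0] := leP 0 s.
    rewrite (_ : 2 / h * s = 2 * a); last by rewrite /a ger0_norm//; ring.
    by rewrite lerDl expR_ge0.
  rewrite (_ : - (2 / h) * s = 2 * a); last by rewrite /a ltr0_norm//; ring.
  by rewrite lerDr expR_ge0.
rewrite [in `|s| ^+ 3]sE exprMn.
apply: (@le_trans _ _ (27 * expR a * h ^+ 3 * expR `|s|)).
  rewrite ler_wpM2r ?expR_ge0// ler_wpM2r// exprn_ge0// ltW//.
rewrite (_ : _ * expR `|s| = 27 * h ^+ 3 * (expR a * expR `|s|)); last by ring.
by rewrite ler_wpM2l// mulr_ge0// exprn_ge0// ltW.
Qed.

(** A second-order expansion along the coordinate directions. With [sinh s] and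
    [cosh s - 1] in place of [s] and [s^2 / 2], the Gaussian averages of all the
    terms follow from exponential moments alone. *)
Definition coord_expansion (f : 'rV[R]_n -> R) (A H : 'I_n -> 'rV[R]_n -> R)
    (C : R) : Prop :=
  (forall y i s, `|f (y + s *: delta_mx ord0 i) - f y
       - sinh s * A i y - cosh1 s * H i y| <= C * (`|s| ^+ 3 * expR `|s|)) /\
  (forall y i l s, `|H i (y + s *: delta_mx ord0 l) - H i y| <= C * `|s|).

(** Interpolates between [y] and [y + z], moving one coordinate at a time, so that
    a coordinatewise expansion applies to each step. *)
Definition partial_move y (z : 'I_n -> R) (m : nat) : 'rV[R]_n :=
  \row_l (y ord0 l + (if (l < m)%N then z l else 0)).

Lemma partial_moveS y z (i : 'I_n) :
  partial_move y z i.+1 = partial_move y z i + z i *: delta_mx ord0 i.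
Proof.
apply/rowP => l; rewrite !mxE eqxx/= ltnS leq_eqVlt.
have [->|li] := eqVneq l i; first by rewrite eqxx ltnn/= mulr1 addr0.
by rewrite (negbTE (_ : val l != val i))//= mulr0 addr0.
Qed.

Lemma partial_move0 y z : partial_move y z 0 = y.
Proof. by apply/rowP => l; rewrite mxE addr0. Qed.

Lemma partial_move_lipschitz (g : 'rV[R]_n -> R) (C : R) : 0 <= C ->
  (forall y l s, `|g (y + s *: delta_mx ord0 l) - g y| <= C * `|s|) ->
  forall y z m, (m <= n)%N -> `|g (partial_move y z m) - g y| <= C * \sum_(l < n) `|z l|.
Proof.
move=> C0 gC y z m mn.
suff : `|g (partial_move y z m) - g y| <= C * \sum_(l < n | (l < m)%N) `|z l|.
  move=> /le_trans; apply; rewrite ler_wpM2l//.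
  by rewrite [leRHS](bigID (fun l : 'I_n => (l < m)%N))/= lerDl sumr_ge0.
elim: m mn => [|m IH] mn.
  by rewrite partial_move0 subrr normr0 mulr_ge0// sumr_ge0.
pose j := Ordinal mn.
have -> : partial_move y z m.+1 = partial_move y z j + z j *: delta_mx ord0 j.
  exact: (partial_moveS y z j).
rewrite (bigD1 j)//= mulrDr.
rewrite -(subrKA (g (partial_move y z m))).
apply: le_trans (ler_normD _ _) _; apply: lerD; first exact: gC.
apply: le_trans (IH (ltnW mn)) _.
rewrite le_eqVlt; apply/orP; left; apply/eqP; congr (_ * _); apply: eq_bigl => l.
by rewrite [RHS]andbC -val_eqE /= ltnS -ltn_neqAle.
Qed.

Section increment.
Variables (f : 'rV[R]_n -> R) (A H : 'I_n -> 'rV[R]_n -> R) (C : R).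
Hypotheses (C0 : 0 <= C) (fAH : coord_expansion f A H C).

Let E s := `|s| ^+ 3 * expR `|s|.
Let E0 s : 0 <= E s. Proof. by rewrite mulr_ge0// expR_ge0. Qed.

Let cross s t : `|s| * cosh1 t <= E s + E t.
Proof.
apply: (@le_trans _ _ (`|s| * (`|t| ^+ 2 * expR `|t|))).
  by rewrite ler_wpM2l// real_normK ?num_real// cosh1_le.
have [st|ts] := leP `|s| `|t|.
  apply: (@le_trans _ _ (E t)); last by rewrite lerDr.
  rewrite mulrA /E (exprS _ 2) ler_wpM2r ?expR_ge0// ler_wpM2r// sqr_ge0.
apply: (@le_trans _ _ (E s)); last by rewrite lerDl.
rewrite /E (exprS _ 2) -mulrA ler_wpM2l//.
by rewrite ler_pM ?sqr_ge0 ?expR_ge0 ?ler_expR ?(ltW ts)// lerXn2r ?nnegrE// ltW.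
Qed.

(** One coordinate is moved at a time; the drift of [H] along the way costs only
    third-order terms. *)
Lemma increment_ge y z :
  \sum_(i < n) (sinh (z i) * A i (partial_move y z i) + cosh1 (z i) * H i y)
    - C * (1 + 2 * n%:R) * \sum_(i < n) E (z i)
  <= f (partial_move y z n) - f y.
Proof.
have -> : f (partial_move y z n) - f y =
    \sum_(i < n) (f (partial_move y z i.+1) - f (partial_move y z i)).
  by rewrite -[in X in _ - X](partial_move0 y z)
    -(telescope_sumr (fun m => f (partial_move y z m)) (leq0n n)) big_mkord.
have step (i : 'I_n) : sinh (z i) * A i (partial_move y z i) + cosh1 (z i) * H i y
    - C * (E (z i) + \sum_(l < n) (E (z l) + E (z i)))
    <= f (partial_move y z i.+1) - f (partial_move y z i).
  rewrite partial_moveS.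
  set Y := partial_move y z i.
  have h1 := fAH.1 Y i (z i).
  have h2 : cosh1 (z i) * H i y - C * (\sum_(l < n) (E (z l) + E (z i)))
      <= cosh1 (z i) * H i Y.
    rewrite lerBlDl -lerBlDr -mulrBr.
    have := partial_move_lipschitz C0 (fAH.2 ^~ i) y z (ltnW (ltn_ord i)); rewrite -/Y distrC => h.
    apply: (@le_trans _ _ (cosh1 (z i) * (C * \sum_(l < n) `|z l|))).
      by rewrite ler_wpM2l ?cosh1_ge0// (le_trans (ler_norm _)).
    rewrite mulrCA ler_wpM2l// mulr_sumr ler_sum// => l _.
    by rewrite mulrC cross.
  move: h1 h2; rewrite ler_norml -/(E (z i)) mulrDr => /andP[h1 _]; lra.
have := @ler_sum R 'I_n (index_enum _) xpredT _ _ (fun i _ => step i).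
apply: le_trans.
rewrite [leRHS]sumrB lerD2l lerN2 -mulr_sumr -mulrA ler_wpM2l//.
rewrite big_split/= mulrDl mul1r lerD2l.
under eq_bigr do rewrite big_split/= sumr_const card_ord.
rewrite big_split/= sumr_const card_ord -sumrMnl.
rewrite sumrMnl -(mulr_natr (\sum_(i < n) E (z i)) n).
by rewrite le_eqVlt; apply/orP; left; apply/eqP; ring.
Qed.

End increment.
End cosh_expansion.

(** * The stopped Gaussian chain *)

Lemma Rintegral_sum d (T : measurableType d) (R : realType)
    (mu : {measure set T -> \bar R}) (J : Type) (s : seq J) (F : J -> T -> R) :
  (forall j, mu.-integrable setT (EFin \o F j)) ->
  mu.-integrable setT (EFin \o (fun w => \sum_(j <- s) F j w)) /\
  \int[mu]_w (\sum_(j <- s) F j w) = \sum_(j <- s) \int[mu]_w F j w.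
Proof.
move=> iF; elim: s => [|j s [IH1 IH2]].
  split.
    rewrite (_ : _ \o _ = cst 0%E); first exact: integrable0.
    by apply/funext => w /=; rewrite big_nil.
  rewrite big_nil (_ : (fun w => _) = cst 0).
    by rewrite /Rintegral integral0.
  by apply/funext => w /=; rewrite big_nil.
have E : (fun w => \sum_(j0 <- j :: s) F j0 w) = (fun w => F j w + \sum_(j0 <- s) F j0 w).
  by apply/funext => w; rewrite big_cons.
rewrite E big_cons RintegralD// IH2; split => //.
exact: (@integrableD _ _ _ mu _ measurableT _ _ (iF j) IH1).
Qed.

Section gaussian_increment.
Context d (T : measurableType d) (R : realType) (P : probability T R).

Lemma bounded_integrable (f : T -> R) (M : R) :
  measurable_fun setT f -> (forall w, `|f w| <= M) -> P.-integrable setT (EFin \o f).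
Proof.
move=> mf fM.
apply: (@le_integrable _ _ _ P _ measurableT _ (cst M%:E)) => //.
- exact/measurable_EFinP.
- by move=> w _ /=; rewrite lee_fin; apply: le_trans (fM w) _; exact: ler_norm.
- exact: finite_measure_integrable_cst.
Qed.

Lemma bounded_mul_integrable (f g : T -> R) (M : R) :
  measurable_fun setT f -> (forall w, `|f w| <= M) ->
  P.-integrable setT (EFin \o g) -> P.-integrable setT (EFin \o (fun w => f w * g w)).
Proof.
move=> mf fM ig.
apply: (@le_integrable _ _ _ P _ measurableT _ (fun w => (M%:E * `|(g w)%:E|)%E)) => //.
- apply/measurable_EFinP; apply: measurable_funM => //.
  by apply/measurable_EFinP; exact: measurable_int ig.
- move=> w _ /=; rewrite lee_fin !normrM.
  by apply: ler_pM => //; rewrite ?normr_id// (le_trans (fM w))// ler_norm.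
- by apply: integrableZl => //; exact: integrable_abse.
Qed.

Context (J : finType) (xi : J -> T -> R) (sg : R).
Hypothesis mxi : forall a, measurable_fun setT (xi a : T -> measurableTypeR R).
Hypothesis indep_xi : mutually_independent P xi.
Hypothesis sg0 : 0 < sg.
Hypothesis law_xi : forall a (A : set (measurableTypeR R)), measurable A ->
  P (xi a @^-1` A) = normal_prob 0 sg A.

Let mexp (t : R) : measurable_fun setT (fun s : measurableTypeR R => expR (t * s)).
Proof. by apply: measurableT_comp => //; exact: measurable_funM. Qed.

Lemma exp_moment a t :
  (\int[P]_w (expR (t * xi a w))%:E = (expR (t ^+ 2 * sg ^+ 2 / 2))%:E)%E.
Proof.
pose X : T -> measurableTypeR R := xi a.
pose mX := isMeasurableFun.Build _ _ _ _ X (mxi a).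
pose Xm : {mfun T >-> measurableTypeR R} := HB.pack X mX.
rewrite -(normal_mgf t (lt0r_neq0 sg0)).
transitivity (\int[distribution P Xm]_s (expR (t * s))%:E)%E.
  by rewrite ge0_integral_distribution//; apply/measurable_EFinP; exact: mexp.
by apply: eq_measure_integral => //= A mA _; exact: law_xi.
Qed.

Lemma exp_integrable a t : P.-integrable setT (EFin \o (fun w => expR (t * xi a w))).
Proof.
have m1 : measurable_fun setT (fun w => expR (t * xi a w)).
  by apply: measurableT_comp => //; apply: measurable_funM => //; exact: mxi.
apply/integrableP; split; first exact/measurable_EFinP.
under eq_integral do rewrite /= ger0_norm ?expR_ge0//.
by rewrite exp_moment ltry.
Qed.

Lemma Rexp_moment a t : \int[P]_w expR (t * xi a w) = expR (t ^+ 2 * sg ^+ 2 / 2).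
Proof. by rewrite /Rintegral exp_moment. Qed.

Lemma measurable_of_other a (f : g_sigma_algebraType (other_cylinder xi a) -> R) :
  measurable_fun setT f -> measurable_fun [set: T] (f : T -> R).
Proof.
move=> mf _ B mB; rewrite setTI.
have := mf measurableT B mB; rewrite setTI.
suff : <<s other_cylinder xi a >> `<=` @measurable _ T by apply.
apply: smallest_sub => //; first exact: sigma_algebra_measurable.
move=> _ [A [mA _ ->]]; apply: fin_bigcap_measurable => // i _.
by rewrite -[X in measurable X]setTI; exact: mxi.
Qed.

Lemma exp_moment_mul a t (Z : g_sigma_algebraType (other_cylinder xi a) -> R) (M : R) :
  measurable_fun setT Z -> (forall w, `|Z w| <= M) ->
  \int[P]_w (Z w * expR (t * xi a w)) = (\int[P]_w Z w) * expR (t ^+ 2 * sg ^+ 2 / 2).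
Proof.
move=> mZ ZM; rewrite -(Rexp_moment a t).
apply: (@integral_mul_indep _ _ _ P _ xi a mxi indep_xi Z (fun s => expR (t * s)) M) => //.
exact: exp_integrable.
Qed.

(** The first-order term averages out, the second-order one keeps its sign and
    the cubic error is of order [sg ^+ 3]. *)
Lemma integral_increment a (Z W : g_sigma_algebraType (other_cylinder xi a) -> R)
    (M c : R) :
  measurable_fun setT Z -> measurable_fun setT W ->
  (forall w, `|Z w| <= M) -> (forall w, `|W w| <= M) ->
  let L := fun w => Z w * sinh (xi a w) + W w * cosh1 (xi a w) -
    c * (expR (2 / sg * xi a w) + expR (- (2 / sg) * xi a w)) in
  P.-integrable setT (EFin \o L) /\
  \int[P]_w L w = (expR (sg ^+ 2 / 2) - 1) * \int[P]_w W w - c * (2 * expR 2).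
Proof.
move=> mZ mW ZM WM L.
(* [Z sinh s + W (cosh s - 1)] is a combination of [e^s], [e^{-s}] and a constant. *)
pose V1 : g_sigma_algebraType (other_cylinder xi a) -> R := fun w => (Z w + W w) / 2.
pose V2 : g_sigma_algebraType (other_cylinder xi a) -> R := fun w => (W w - Z w) / 2.
have mV1 : measurable_fun setT V1 by apply: measurable_funM => //; exact: measurable_funD.
have mV2 : measurable_fun setT V2 by apply: measurable_funM => //; exact: measurable_funB.
have V1M w : `|V1 w| <= M.
  have := ZM w; have := WM w; rewrite /V1 !ler_norml => /andP[? ?] /andP[? ?].
  by apply/andP; split; lra.
have V2M w : `|V2 w| <= M.
  have := ZM w; have := WM w; rewrite /V2 !ler_norml => /andP[? ?] /andP[? ?].
  by apply/andP; split; lra.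
have mZ' := measurable_of_other mZ; have mW' := measurable_of_other mW.
have mV1' := measurable_of_other mV1; have mV2' := measurable_of_other mV2.
have i1 : P.-integrable setT (EFin \o (fun w => V1 w * expR (1 * xi a w))).
  exact: bounded_mul_integrable mV1' V1M (exp_integrable a 1).
have i2 : P.-integrable setT (EFin \o (fun w => V2 w * expR (- 1 * xi a w))).
  exact: bounded_mul_integrable mV2' V2M (exp_integrable a (- 1)).
have iW : P.-integrable setT (EFin \o (W : T -> R)) by exact: bounded_integrable mW' WM.
have i3 t : P.-integrable setT (EFin \o (fun w => c * expR (t * xi a w))).
  exact: (@integrableZl _ _ _ P _ measurableT c _ (exp_integrable a t)).
pose F (b : 'I_5) : T -> R := match val b with
  | 0 => fun w => V1 w * expR (1 * xi a w)
  | 1 => fun w => V2 w * expR (- 1 * xi a w)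
  | 2 => fun w => - 1 * (W : T -> R) w
  | 3 => fun w => - 1 * (c * expR (2 / sg * xi a w))
  | _ => fun w => - 1 * (c * expR (- (2 / sg) * xi a w)) end.
have LE : L = fun w => \sum_(b < 5) F b w.
  apply/funext => w; rewrite !big_ord_recr big_ord0 /F /= /L /V1 /V2 /sinh /cosh1.
  by rewrite !mul1r mulN1r; field.
have iN (g : T -> R) : P.-integrable setT (EFin \o g) ->
    P.-integrable setT (EFin \o (fun w => - 1 * g w)).
  by move=> ig; exact: (@integrableZl _ _ _ P _ measurableT (- 1) _ ig).
have iF b : P.-integrable setT (EFin \o F b).
  by case: b => -[|[|[|[|[|//]]]]] ? /=; rewrite /F/=; do ?[exact: iN].
have [h1 h2] := Rintegral_sum (index_enum 'I_5) iF.
rewrite LE; split => //; rewrite h2 !big_ord_recr big_ord0 /F /= add0r.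
rewrite !RintegralZl//; do ?[exact: exp_integrable].
rewrite (exp_moment_mul _ mV1 V1M) (exp_moment_mul _ mV2 V2M) !Rexp_moment.
have V12 : \int[P]_w V1 w + \int[P]_w V2 w = \int[P]_w W w.
  rewrite -RintegralD//; [|exact: bounded_integrable mV1' V1M|exact: bounded_integrable mV2' V2M].
  by apply: eq_Rintegral => w _; rewrite /V1 /V2; field.
rewrite -V12 sqrrN expr1n mul1r (sqrrN (2 / sg)).
have -> : (2 / sg) ^+ 2 * sg ^+ 2 / 2 = 2 by field; exact: lt0r_neq0.
ring.
Qed.

End gaussian_increment.

Lemma Rintegral_cst_prob d (T : measurableType d) (R : realType)
  (P : probability T R) (r : R) : \int[P]_(w in setT) cst r w = r.
Proof.
rewrite /Rintegral (_ : (\int[P]_w _)%E = r%:E)//=.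
by rewrite (integral_cst P measurableT) [X in (_ * X)%E](probability_setT P) mule1.
Qed.

(** Discrete optional stopping as a telescoping sum: the product of indicators
    switches the increments off for good after the first failure of [g]. *)
Lemma stopped_sum (R : pzRingType) (a : nat -> R) (g : nat -> bool) (k : nat) :
  exists2 j, (j <= k)%N /\ (forall i, (i < j)%N -> g i) &
    a 0%N + \sum_(m < k) (\prod_(i < m.+1) (g i)%:R) * (a m.+1 - a m) = a j /\
    (g j -> j = k).
Proof.
elim: k => [|k [j [jk gj] [IH1 IH2]]].
  by exists 0%N; [split|rewrite big_ord0 addr0].
rewrite big_ord_recr/= addrA IH1.
have [gjT|gjF] := boolP (g j).
  have jE := IH2 gjT; subst j; exists k.+1; last first.
    split=> //; rewrite big1 ?mul1r ?subrKC// => i _.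
    have := ltn_ord i; rewrite ltnS leq_eqVlt => /predU1P[->|/gj ->//].
    by rewrite gjT.
  split=> // i; rewrite ltnS leq_eqVlt => /predU1P[->//|]; exact: gj.
exists j; first by split => //; exact: leqW.
split; last by move/negP : gjF.
have jk1 : (j < k.+1)%N by rewrite ltnS.
rewrite (_ : \prod_(i < k.+1) _ = 0) ?mul0r ?addr0//.
have := mem_index_enum (Ordinal jk1).
move: (index_enum _) => s; elim: s => // b s IHs; rewrite inE big_cons.
by move=> /predU1P[<-/=|/IHs ->]; rewrite ?mulr0// (negbTE gjF) mul0r.
Qed.

Section stopped_chain.
Context d (T : measurableType d) (R : realType) (P : probability T R).
Variables (n k : nat) (xi : 'I_k * 'I_n -> T -> R) (sg : R).
Hypothesis mxi : forall a, measurable_fun setT (xi a : T -> measurableTypeR R).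
Hypothesis indep_xi : mutually_independent P xi.
Hypotheses (sg0 : 0 < sg) (sg1 : sg <= 1).
Hypothesis law_xi : forall a (A : set (measurableTypeR R)), measurable A ->
  P (xi a @^-1` A) = normal_prob 0 sg A.

Variables (x : 'rV[R]_n) (q : 'rV[R]_n -> R) (theta : R).
Hypothesis cq : continuous q.

Definition chain (j : nat) (w : T) : 'rV[R]_n :=
  \row_l (x ord0 l + \sum_(m < k | (m < j)%N) xi (m, l) w).

Definition alive (j : nat) (w : T) : bool := theta < q (chain j w).

Lemma chain_step (j : 'I_k) w :
  chain j.+1 w = partial_move (chain j w) (fun i => xi (j, i) w) n.
Proof.
apply/rowP => l; rewrite !mxE ltn_ord -addrA; congr (_ + _).
rewrite (bigD1 j)//= addrC; congr (_ + _); apply: eq_bigl => m.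
by rewrite andbC -val_eqE /= ltnS -ltn_neqAle.
Qed.

(** The past of one increment has to be measurable both for the ambient
    sigma-algebra and for the one generated by the other increments; [id'] is the
    identity map from either of them. *)
Section measurability.
Context d' (T' : measurableType d') (j : nat) (i : nat) (jj : 'I_k) (id' : T' -> T).
Hypothesis m_past : forall a : 'I_k * 'I_n, (a.1 < j)%N || ((a.1 == jj) && (a.2 < i)%N) ->
  measurable_fun setT ((xi a \o id') : T' -> measurableTypeR R).

Lemma measurable_chain m (g : 'rV[R]_n -> R) : (m <= j)%N -> continuous g ->
  measurable_fun setT (fun w => g (chain m (id' w)) : measurableTypeR R).
Proof.
move=> mj cg; apply: measurable_continuous_comp => // l.
under eq_fun do rewrite mxE.
apply: measurable_funD => //.
under eq_fun do rewrite big_mkcond.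
apply: measurable_sum => p.
case: (ltnP p m) => pm; last exact: measurable_cst.
by apply: (m_past (a := (p, l))); rewrite /= (leq_trans pm mj).
Qed.

Lemma measurable_alive m : (m <= j)%N ->
  measurable_fun setT (fun w => (alive m (id' w))%:R : measurableTypeR R).
Proof.
move=> mj; rewrite (_ : (fun w => _) = \1_[set w | alive m (id' w)]).
  apply: measurable_indic; rewrite /alive.
  have := measurable_chain mj cq measurableT (measurable_itv `]theta, +oo[).
  by rewrite setTI; congr measurable; apply/seteqP; split=> w; rewrite /= in_itv/= andbT.
apply/funext => w; rewrite indicE; congr ((nat_of_bool _)%:R).
by apply/idP/idP => [?|/set_mem//]; rewrite inE.
Qed.

Lemma measurable_alive_prod :
  measurable_fun setT (fun w => \prod_(m < j.+1) (alive m (id' w))%:R : measurableTypeR R).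
Proof.
apply: measurable_prod => m _; apply: measurable_alive.
by rewrite -ltnS.
Qed.

Lemma measurable_partial (g : 'rV[R]_n -> R) : continuous g ->
  measurable_fun setT (fun w => g (partial_move (chain j (id' w))
     (fun l => xi (jj, l) (id' w)) i) : measurableTypeR R).
Proof.
move=> cg; apply: measurable_continuous_comp => // l.
under eq_fun do rewrite mxE.
apply: measurable_funD.
  by apply: (measurable_chain (g := fun y => y ord0 l)) => //; exact: coord_continuous.
case: ltnP => li; last exact: measurable_cst.
by apply: (m_past (a := (jj, l))); rewrite /= eqxx li orbT.
Qed.

End measurability.

Variables (f : 'rV[R]_n -> R) (A H : 'I_n -> 'rV[R]_n -> R) (C M : R).
Hypotheses (C0 : 0 <= C) (fAH : coord_expansion f A H C).
Hypotheses (cf : continuous f) (cA : forall i, continuous (A i))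
  (cH : forall i, continuous (H i)).
Hypotheses (fM : forall y, `|f y| <= M) (AM : forall i y, `|A i y| <= M)
  (HM : forall i y, `|H i y| <= M).
Hypothesis H_ge0 : forall y, theta < q y -> 0 <= \sum_(i < n) H i y.

Definition life (j : nat) (w : T) : R := \prod_(m < j.+1) (alive m w)%:R.

(** By [stopped_sum], the value of [f] at the first time the chain is not alive;
    written in this form its mean can be computed step by step. *)
Definition stopped_value (w : T) : R :=
  f (chain 0 w) + \sum_(j < k) life j w * (f (chain j.+1 w) - f (chain j w)).

Let life01 j w : 0 <= life j w <= 1.
Proof.
apply/andP; split; first by apply: prodr_ge0 => m _; rewrite ler0n.
by apply: prodr_ile1 => m _; rewrite ler0n lern1 leq_b1.
Qed.

Let life_mulM j w (r : R) : `|r| <= M -> `|life j w * r| <= M.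
Proof.
move=> rM; have /andP[l0 l1] := life01 j w.
rewrite normrM ger0_norm// (le_trans _ rM)// ler_piMl//.
Qed.

Let c := C * (1 + 2 * n%:R) * (27 * sg ^+ 3).

Let c0 : 0 <= c.
Proof. by have s0 := ltW sg0; rewrite !mulr_ge0 ?addr_ge0 ?mulr_ge0 ?exprn_ge0. Qed.

Let Z (j : 'I_k) (i : 'I_n) w :=
  life j w * A i (partial_move (chain j w) (fun l => xi (j, l) w) i).
Let W (j : 'I_k) (i : 'I_n) w := life j w * H i (chain j w).
Let L (j : 'I_k) (i : 'I_n) w :=
  Z j i w * sinh (xi (j, i) w) + W j i w * cosh1 (xi (j, i) w) -
  c * (expR (2 / sg * xi (j, i) w) + expR (- (2 / sg) * xi (j, i) w)).

Let step_ge (j : 'I_k) w :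
  \sum_(i < n) L j i w <= life j w * (f (chain j.+1 w) - f (chain j w)).
Proof.
have /andP[l0 l1] := life01 j w.
pose E (s : R) := `|s| ^+ 3 * expR `|s|.
have E0 (s : R) : 0 <= E s by rewrite mulr_ge0// expR_ge0.
have h := increment_ge C0 fAH (chain j w) (fun l => xi (j, l) w).
rewrite -chain_step in h.
have := ler_wpM2l l0 h; apply: le_trans.
rewrite mulrBr mulr_sumr /L sumrB lerB//.
  rewrite ler_sum// => i _; rewrite /Z /W le_eqVlt; apply/orP; left; apply/eqP.
  ring.
apply: (@le_trans _ _ (C * (1 + 2 * n%:R) * \sum_(i < n) E (xi (j, i) w))).
  rewrite ler_piMl// !mulr_ge0// ?addr_ge0 ?mulr_ge0//.
  by rewrite sumr_ge0.
rewrite mulr_sumr ler_sum// => i _; rewrite /c -[leRHS]mulrA ler_wpM2l//.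
  by rewrite mulr_ge0// addr_ge0// mulr_ge0.
exact: cube_expR_le.
Qed.

Let m_all j jj i (a : 'I_k * 'I_n) : (a.1 < j)%N || ((a.1 == jj :> 'I_k) && (a.2 < i)%N) ->
  measurable_fun setT ((xi a \o id) : T -> measurableTypeR R).
Proof. by move=> _; exact: mxi. Qed.

Let m_other (j : 'I_k) (i : 'I_n) (a : 'I_k * 'I_n) :
  (a.1 < j)%N || ((a.1 == j) && (a.2 < i)%N) ->
  measurable_fun setT ((xi a \o id) :
     g_sigma_algebraType (other_cylinder xi (j, i)) -> measurableTypeR R).
Proof.
move=> h; apply: measurable_other; apply: contraTneq h => ->/=.
by rewrite !ltnn andbF.
Qed.

Let mZ j i : measurable_fun [set: g_sigma_algebraType (other_cylinder xi (j, i))] (Z j i).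
Proof.
apply: measurable_funM; first exact: (measurable_alive_prod (@m_other j i)).
exact: (measurable_partial (@m_other j i)).
Qed.

Let mW j i : measurable_fun [set: g_sigma_algebraType (other_cylinder xi (j, i))] (W j i).
Proof.
apply: measurable_funM; first exact: (measurable_alive_prod (@m_other j i)).
exact: (measurable_chain (@m_other j i)).
Qed.

Let mlife j : (j < k)%N -> measurable_fun [set: T] (life j : T -> measurableTypeR R).
Proof. by move=> jk; exact: (measurable_alive_prod (@m_all j (Ordinal jk) 0)). Qed.

Lemma measurable_chain_comp (g : 'rV[R]_n -> R) j : continuous g ->
  measurable_fun [set: T] (fun w => g (chain j w) : measurableTypeR R).
Proof.
move=> cg; apply: measurable_continuous_comp => // l.
under eq_fun do rewrite mxE.
apply: measurable_funD => //; under eq_fun do rewrite big_mkcond.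
by apply: measurable_sum => p; case: (ltnP p j) => _; [exact: mxi|exact: measurable_cst].
Qed.

Let step_integrable (j : 'I_k) :
  P.-integrable setT (EFin \o (fun w => life j w * (f (chain j.+1 w) - f (chain j w)))).
Proof.
apply: (@bounded_integrable _ _ _ _ _ (M + M)).
  apply: measurable_funM; first exact: mlife.
  by apply: measurable_funB; exact: measurable_chain_comp.
move=> w; have /andP[l0 l1] := life01 j w.
rewrite normrM (ger0_norm l0) (le_trans (ler_piMl _ l1))//.
by rewrite (le_trans (ler_normB _ _))// lerD.
Qed.

Let step_integral_ge (j : 'I_k) :
  - (c * (2 * expR 2) * n%:R) <=
  \int[P]_w (life j w * (f (chain j.+1 w) - f (chain j w))).
Proof.
have inc i : P.-integrable setT (EFin \o L j i) /\
  \int[P]_w L j i w = (expR (sg ^+ 2 / 2) - 1) * \int[P]_w W j i w - c * (2 * expR 2).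
  apply: (integral_increment mxi indep_xi sg0 law_xi c (mZ (j := j) (i := i)) (mW (j := j) (i := i)) (M := M)) => w;
  exact: life_mulM.
have [h1 h2] := Rintegral_sum (index_enum 'I_n) (fun i => (inc i).1).
apply: (@le_trans _ _ (\int[P]_w \sum_(i < n) L j i w)); last first.
  by apply: le_Rintegral => // w _; exact: step_ge.
rewrite h2; under eq_bigr do rewrite (inc _).2.
rewrite sumrB sumr_const card_ord -[X in _ - X]mulr_natr lerDr -mulr_sumr.
have iW i : P.-integrable setT (EFin \o W j i).
  apply: (@bounded_integrable _ _ _ _ _ M); last by move=> w; exact: life_mulM.
  by apply: measurable_funM; [exact: mlife|exact: measurable_chain_comp].
have [_ <-] := Rintegral_sum (index_enum 'I_n) iW.
rewrite mulr_ge0//.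
  by rewrite subr_ge0 -[leLHS]expR0 ler_expR divr_ge0// sqr_ge0.
apply: Rintegral_ge0 => w _; rewrite -mulr_sumr.
rewrite /life big_ord_recr /=.
have [al|] := boolP (alive j w); last by rewrite mulr0 mul0r.
rewrite !mulr_ge0//; last exact: H_ge0.
by apply: prodr_ge0 => m _; rewrite ler0n.
Qed.

Lemma stopped_value_integrable : P.-integrable setT (EFin \o stopped_value).
Proof.
have [h1 h2] := Rintegral_sum (index_enum 'I_k) step_integrable.
have i0 : P.-integrable setT (EFin \o (f \o chain 0)).
  by apply: (@bounded_integrable _ _ _ _ _ M) => [|w]; [exact: measurable_chain_comp|exact: fM].
exact: (@integrableD _ _ _ P _ measurableT _ _ i0 h1).
Qed.

(** While the chain is alive the second-order terms have a nonnegative sum, and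
    they are independent of the increment they multiply; only the cubic error of
    each of the [k] steps is lost. *)
Lemma stopped_value_ge :
  f x - C * (1 + 2 * n%:R) * 54 * expR 2 * n%:R * (k%:R * sg ^+ 3) <=
  \int[P]_w stopped_value w.
Proof.
have [h1 h2] := Rintegral_sum (index_enum 'I_k) step_integrable.
have i0 : P.-integrable setT (EFin \o (f \o chain 0)).
  by apply: (@bounded_integrable _ _ _ _ _ M) => [|w]; [exact: measurable_chain_comp|exact: fM].
rewrite /stopped_value RintegralD// h2.
have -> : \int[P]_w (f \o chain 0) w = f x.
  rewrite (@eq_Rintegral _ _ _ _ _ (cst (f x))).
    exact: Rintegral_cst_prob.
  move=> w _ /=; congr f; apply/rowP => l; rewrite mxE big_pred0 ?addr0//.
rewrite lerD2l.
apply: (@le_trans _ _ (\sum_(j < k) - (c * (2 * expR 2) * n%:R))).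
  rewrite sumr_const card_ord -mulr_natr /c le_eqVlt; apply/orP; left; apply/eqP; ring.
by rewrite ler_sum// => j _; exact: step_integral_ge.
Qed.

End stopped_chain.

(** * From grid walks to continuous paths *)

(** The cluster point is the upper limit of the values: the supremum of the levels
    that they exceed for infinitely many indices. *)
Lemma cluster_infinitely_often (R : realType) (T0 : R) (Q : nat -> R -> Prop) :
  (forall n, exists2 N, (n <= N)%N & exists2 t : R, 0 <= t <= T0 & Q N t) ->
  exists2 t0 : R, 0 <= t0 <= T0 & forall e, 0 < e -> forall n,
    exists2 N, (n <= N)%N & exists2 t : R, 0 <= t <= T0 /\ Q N t & `|t - t0| < e.
Proof.
move=> HQ.
pose S := [set s : R | 0 <= s /\ forall n, exists2 N, (n <= N)%N &
  exists2 t : R, 0 <= t <= T0 /\ Q N t & s <= t].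
have S0 : S 0.
  split=> // n; have [N nN [t t0 Qt]] := HQ n; exists N => //; exists t => //.
  by case/andP: t0.
have Sub : ubound S T0.
  move=> s [_ /(_ 0%N)[N _ [t [/andP[_ tT] _] st]]]; exact: le_trans tT.
have hS : has_sup S by split; [exists 0|exists T0].
have ubS s : S s -> s <= sup S by move=> Ss; apply: ub_le_sup; [exact: hS.2|exact: Ss].
exists (sup S).
  apply/andP; split; first exact: ubS.
  by apply: ge_sup => //; exists 0.
move=> e e0 n.
have [s [s0 Ss] se] := sup_adherent e0 hS.
have nS : ~ S (sup S + e).
  by move=> /ubS; rewrite leNgt ltrDl e0.
have [n0 n0P] : exists n0, forall N, (n0 <= N)%N -> forall t, 0 <= t <= T0 -> Q N t ->
    t < sup S + e.
  apply: contrapT => hn; apply: nS; split.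
    by rewrite addr_ge0 ?(ltW e0)//; exact: ubS.
  move=> m; apply: contrapT => hm; apply: hn; exists m => N mN t tT Qt.
  rewrite ltNge; apply/negP => h; apply: hm; exists N => //; exists t => //.
have [N + [t [tT Qt] st]] := Ss (maxn n n0).
rewrite geq_max => /andP[nN n0N]; exists N => //; exists t => //.
have := n0P _ n0N _ tT Qt; rewrite ltr_norml => h1.
by apply/andP; split; [lra|lra].
Qed.

Section paths.
Variables (R : realType) (n : nat) (b : R -> 'rV[R]_n).
Hypothesis cb : {within `[0, +oo[, continuous b}.

Lemma path_eps (g : 'rV[R]_n -> R) (t e : R) : continuous g -> 0 <= t -> 0 < e ->
  exists2 dl : R, 0 < dl &
    forall s : R, 0 <= s -> `|s - t| < dl -> `|g (b s) - g (b t)| < e.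
Proof.
move=> cg t0 e0.
have hb : b @ nbhs (t : subspace [set` `[0, +oo[]) --> b t := @cb t.
have hgb : (g \o b) @ nbhs (t : subspace [set` `[0, +oo[]) --> (g \o b) t.
  exact: cvg_comp hb (cg (b t)).
have tin : [set` `[0, +oo[] t by rewrite /= in_itv/= t0.
have E : within [set` `[0, +oo[] (nbhs t) = nbhs (t : subspace [set` `[0, +oo[]).
  exact: nbhs_subspace_in.
rewrite -E in hgb.
move: hgb => /cvgrPdist_lt /(_ e e0); rewrite near_withinE => /nbhs_ballP[dl /= dl0 H].
exists dl => // s s0 st; rewrite distrC; apply: H.
  by rewrite -ball_normE/= distrC.
by rewrite /= in_itv/= s0.
Qed.

Variables (q u : 'rV[R]_n -> R) (x : 'rV[R]_n).
Hypotheses (cq : continuous q) (cu : continuous u) (bx : b 0 = x).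

(** The exit time of the path is a cluster point of the exit times of the walks.
    Any earlier time is a limit of grid times at which the walks have not yet
    left, which keeps [theta <= q] there. *)
Lemma grid_limit (T0 theta c : R) (f : 'rV[R]_n -> R) :
  0 < T0 -> continuous f -> theta < q x ->
  let grid N j := j%:R * (T0 / N.+1%:R) in
  (forall n, exists2 N, (n <= N)%N & exists2 j, (j <= N.+1)%N &
     [/\ forall i, (i < j)%N -> theta < q (b (grid N i)),
         q (b (grid N j)) <= theta & c <= f (b (grid N j))]) ->
  exists2 t : R, 0 <= t <= T0 &
    [/\ forall s : R, 0 <= s -> s < t -> theta <= q (b s), q (b t) = theta & c <= f (b t)].
Proof.
move=> T00 cf qx grid H.
pose Q N t := exists2 j, (j <= N.+1)%N & [/\ t = grid N j,
  forall i, (i < j)%N -> theta < q (b (grid N i)),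
  q (b t) <= theta & c <= f (b t)].
have HQ m : exists2 N, (m <= N)%N & exists2 t : R, 0 <= t <= T0 & Q N t.
  have [N mN [j jN [h1 h2 h3]]] := H m; exists N => //; exists (grid N j); last by exists j.
  rewrite /grid mulr_ge0//= ?divr_ge0// ?(ltW T00)//.
  rewrite mulrA ler_pdivrMr ?ltr0n// mulrC ler_wpM2l ?(ltW T00)// ler_nat//.
have [t tT ht] := cluster_infinitely_often HQ.
have t0 : 0 <= t by case/andP: tT.
have qt : q (b t) <= theta.
  rewrite leNgt; apply/negP => lt.
  have e0 : 0 < q (b t) - theta by rewrite subr_gt0.
  have [dl dl0 hdl] := path_eps cq t0 e0.
  have [N _ [s [/andP[s0 _] [j _ [_ _ qs _]]] st]] := ht _ dl0 0%N.
  have := hdl s s0 st; rewrite ltr_norml => /andP[h _]; lra.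
have ft : c <= f (b t).
  rewrite leNgt; apply/negP => lt.
  have e0 : 0 < c - f (b t) by rewrite subr_gt0.
  have [dl dl0 hdl] := path_eps cf t0 e0.
  have [N _ [s [/andP[s0 _] [j _ [_ _ _ fs]]] st]] := ht _ dl0 0%N.
  have := hdl s s0 st; rewrite ltr_norml => /andP[_ h]; lra.
have before (s : R) : 0 <= s -> s < t -> theta <= q (b s).
  move=> s0 st; rewrite leNgt; apply/negP => lt.
  have e0 : 0 < theta - q (b s) by rewrite subr_gt0.
  have [dl dl0 hdl] := path_eps cq s0 e0.
  have dlT : 0 < dl / T0 by rewrite divr_gt0.
  have [m0 m0P] := ltr_add_invr dlT; rewrite add0r in m0P.
  have ts0 : 0 < t - s by rewrite subr_gt0.
  have [N mN [r [/andP[r0 _] [j jN [rE hj _ _]]] rt]] := ht _ ts0 m0.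
  pose h := T0 / N.+1%:R.
  have h0 : 0 < h by rewrite divr_gt0.
  have hdlt : h < dl.
    rewrite /h mulrC -ltr_pdivlMr//; apply: le_lt_trans m0P.
    by rewrite lef_pV2 ?posrE ?ltr0n// ler_nat.
  have sh0 : 0 <= s / h by rewrite divr_ge0// ltW.
  pose i := Num.truncn (s / h).
  have /andP[i1 i2] := truncn_itv sh0; rewrite -/i in i1 i2.
  have gi1 : grid N i <= s by rewrite /grid -/h -ler_pdivlMr.
  have gi2 : s < grid N i + h.
    by move: i2; rewrite ltr_pdivrMr// -natr1 mulrDl mul1r.
  have ij : (i < j)%N.
    rewrite ltnNge; apply/negP => ji.
    have : grid N j <= grid N i by rewrite /grid ler_wpM2r ?ler_nat// ltW.
    by move: rt; rewrite -rE ltr_norml => /andP[h1 _] h2; lra.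
  have g0 : 0 <= grid N i by rewrite mulr_ge0// ltW.
  have gd : `|grid N i - s| < dl.
    move: (grid N i) gi1 gi2 hdlt h0 => z *; rewrite ltr_norml.
    by apply/andP; split; lra.
  have := hdl _ g0 gd; have := hj _ ij; rewrite ltr_norml => h1 /andP[_ h2]; lra.
have tgt0 : 0 < t.
  rewrite lt_neqAle t0 andbT; apply/eqP => tE.
  by move: qt; rewrite -tE bx leNgt qx.
exists t => //; split => //.
apply/eqP; rewrite eq_le qt/= leNgt; apply/negP => lt.
have e0 : 0 < theta - q (b t) by rewrite subr_gt0.
have [dl dl0 hdl] := path_eps cq t0 e0.
(* A time just before [t], and still positive. *)
pose s := Num.max (t / 2) (t - dl / 2).
have s0 : 0 <= s by rewrite /s le_max divr_ge0.
have st : s < t by rewrite /s gt_max; apply/andP; split; lra.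
have sd : t - dl / 2 <= s by rewrite /s le_max lexx orbT.
have sdl : `|s - t| < dl by rewrite ltr_norml; apply/andP; split; lra.
have := hdl s s0 sdl; rewrite ltr_norml => /andP[_ h].
have := before s s0 st; lra.
Qed.

(** Before the limit time some walk at a level [theta k > 0] has not left yet; so
    [0 < q] holds strictly there, which [grid_limit] alone does not give. *)
Lemma level_limit (T0 c : R) (theta : nat -> R) :
  (forall k, 0 < theta k) -> theta @ \oo --> 0 ->
  (forall n, exists2 k, (n <= k)%N & exists2 t : R, 0 <= t <= T0 &
    [/\ forall s : R, 0 <= s -> s < t -> theta k <= q (b s), q (b t) = theta k & c <= u (b t)]) ->
  exists2 t : R, 0 <= t <= T0 &
    [/\ forall s : R, 0 <= s -> s < t -> 0 < q (b s), q (b t) = 0 & c <= u (b t)].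
Proof.
move=> th0 thl H.
have [t tT ht] := cluster_infinitely_often H.
have t0 : 0 <= t by case/andP: tT.
exists t => //; split.
- move=> s s0 st; have ts0 : 0 < t - s by rewrite subr_gt0.
  have [k _ [r [_ [h1 _ _]] rt]] := ht _ ts0 0%N.
  apply: lt_le_trans (th0 k) (h1 s s0 _).
  move: rt; rewrite ltr_norml => /andP[h _]; lra.
- apply/eqP; rewrite -normr_le0 leNgt; apply/negP => lt.
  have e0 : 0 < `|q (b t)| / 2 by rewrite divr_gt0.
  have [dl dl0 hdl] := path_eps cq t0 e0.
  have /cvgrPdist_lt/(_ _ e0)[m _ mP] := thl.
  have [k mk [r [/andP[r0 _] [_ qr _]] rt]] := ht _ dl0 m.
  have := hdl r r0 rt; have := mP k mk; rewrite sub0r normrN qr => h1 h2.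
  have := ler_normD (q (b t) - theta k) (theta k); rewrite subrK.
  rewrite distrC in h2; lra.
- rewrite leNgt; apply/negP => lt.
  have e0 : 0 < c - u (b t) by rewrite subr_gt0.
  have [dl dl0 hdl] := path_eps cu t0 e0.
  have [k _ [r [/andP[r0 _] [_ _ ur]] rt]] := ht _ dl0 0%N.
  have := hdl r r0 rt; rewrite ltr_norml => /andP[_ h]; lra.
Qed.

End paths.

(** * A maximum principle along Brownian paths *)

Section limsup.
Context d (T : measurableType d) (R : realType) (P : probability T R).

Lemma fine_prob_le (A B : set T) : measurable A -> measurable B -> A `<=` B ->
  fine (P A) <= fine (P B).
Proof. by move=> mA mB AB; rewrite fine_le ?fin_num_measure// le_measure// inE. Qed.

Lemma measurable_lim_sup_set (F : (set T)^nat) : (forall k, measurable (F k)) ->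
  measurable (lim_sup_set F).
Proof.
by move=> mF; apply: bigcapT_measurable => k; apply: bigcup_measurable => j _; exact: mF.
Qed.

(** The reverse Fatou inequality for events. *)
Lemma prob_lim_sup (F : (set T)^nat) (e : R) : (forall k, measurable (F k)) -> 0 < e ->
  exists n0, forall k, (n0 <= k)%N -> fine (P (F k)) <= fine (P (lim_sup_set F)) + e.
Proof.
move=> mF e0.
have mU k : measurable (\bigcup_(j >= k) F j) by apply: bigcup_measurable => j _; exact: mF.
have mL := measurable_lim_sup_set mF.
have Foo : (P (\bigcup_(j >= 0) F j) < +oo)%E.
  by apply: le_lt_trans (ltry 1); exact: probability_le1.
have : P (\bigcup_(j in [set j | (k <= j)%N]) F j) @[k --> \oo] -->
    (fine (P (lim_sup_set F)))%:E.
  by rewrite fineK ?fin_num_measure//; exact: lim_sup_set_cvg.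
move=> h; have h2 : fine (P (\bigcup_(j in [set j | (k <= j)%N]) F j)) @[k --> \oo] -->
    fine (P (lim_sup_set F)) by exact: fine_cvg h.
move/cvgrPdist_lt : h2 => /(_ _ e0)[n0 _ H].
exists n0 => k n0k; have := H k n0k => /=; rewrite ltr_norml => /andP[h3 _].
have : fine (P (F k)) <= fine (P (\bigcup_(j >= k) F j)).
  by apply: fine_prob_le => // w Fw; exists k => /=.
lra.
Qed.

End limsup.

Section brownian.
Context d (T : measurableType d) (R : realType) (P : probability T R).
Variables (n : nat) (x : 'rV[R]_n) (B : R -> T -> 'rV[R]_n).
Hypothesis BM : brownian_motion P x B.

Let mB t : 0 <= t -> forall i, measurable_fun setT (fun w => B t w ord0 i : measurableTypeR R).
Proof. by case: BM => _ _ H _ _ t0 i; exact: H. Qed.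

Lemma measurable_brownian t (g : 'rV[R]_n -> R) : 0 <= t -> continuous g ->
  measurable_fun setT (fun w => g (B t w) : measurableTypeR R).
Proof. by move=> t0; apply: measurable_continuous_comp; exact: mB. Qed.

Lemma measurable_brownian_itv t (g : 'rV[R]_n -> R) (I : interval R) : 0 <= t -> continuous g ->
  measurable [set w | g (B t w) \in I].
Proof.
move=> t0 cg; have := measurable_brownian t0 cg measurableT (measurable_itv I).
by rewrite setTI.
Qed.

(** The density of a Gaussian of standard deviation [z] is at most [1 / z]. *)
Lemma brownian_slab z rho (i : 'I_n) : 0 < z -> 0 <= rho ->
  fine (P [set w | B (z ^+ 2) w ord0 i \in `[- rho, rho]]) <= 2 * rho / z.
Proof.
move=> z0 rho0.
have [B0 _ _ law _] := BM.
have z20 : 0 < z ^+ 2 by rewrite exprn_gt0.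
pose I : set (measurableTypeR R) := [set` `[- rho - x ord0 i, rho - x ord0 i]].
have mI : measurable I by exact: measurable_itv.
have := law 0 (z ^+ 2) i (lexx _) z20 I mI.
rewrite subr0 sqrtr_sqr gtr0_norm// => lawI.
have -> : [set w | B (z ^+ 2) w ord0 i \in `[- rho, rho]] =
    (fun w => B (z ^+ 2) w ord0 i - B 0 w ord0 i) @^-1` I.
  apply/seteqP; split=> w; rewrite /I /= !in_itv/= B0 => /andP[h1 h2]; apply/andP; split; lra.
rewrite lawI.
have : (normal_prob 0%R z I <= (2 * rho / z)%:E)%E.
  rewrite /normal_prob.
  apply: (@le_trans _ _ (\int[lebesgue_measure]_(s in I) (cst (z^-1)%:E) s)%E).
    apply: ge0_le_integral => //.
    - by move=> s _; rewrite lee_fin normal_pdf_ge0.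
    - by apply/measurable_EFinP; apply: measurable_funTS; exact: measurable_normal_pdf.
    - move=> s _; rewrite lee_fin (le_trans (normal_pdf_ub _ _ (lt0r_neq0 z0)))//.
      rewrite /normal_peak lef_pV2 ?posrE//; last first.
        by rewrite sqrtr_gt0 mulrn_wgt0// mulr_gt0// pi_gt0.
      rewrite -[leLHS](gtr0_norm z0) -sqrtr_sqr ler_sqrt; last first.
        by rewrite mulrn_wge0// mulr_ge0 ?sqr_ge0// pi_ge0.
      rewrite -mulr_natr -mulrA ler_peMr ?sqr_ge0//.
      have := pi_ge2 R; lra.
  rewrite integral_cst//.
  rewrite [X in (_ * X)%E](lebesgue_measure_itv `[- rho - x ord0 i, rho - x ord0 i]) /= lte_fin.
  case: ifPn => _; last by rewrite mule0 lee_fin divr_ge0 ?mulr_ge0// ltW.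
  by rewrite -EFinD -EFinM lee_fin le_eqVlt; apply/orP; left; apply/eqP; field; exact: lt0r_neq0.
move=> h; rewrite -lee_fin fineK// ge0_fin_numE ?measure_ge0//.
exact: le_lt_trans h (ltry _).
Qed.


Variables (q u : 'rV[R]_n -> R).
Hypotheses (cq : continuous q) (cu : continuous u) (qx : 0 < q x).
Variables (rho S m eta : R).
Hypotheses (q_rho : forall y, 0 < q y -> `|y| <= rho) (S0 : 0 <= S) (m0 : 0 <= m)
  (eta0 : 0 < eta).

(** What the chain estimate asks of a regularization [f] of [u]: [A] and [H] play
    the parts of the gradient and of the pure second derivatives. *)
Definition subharmonic_approx (theta : R) (f : 'rV[R]_n -> R) : Prop :=
  exists A H : 'I_n -> 'rV[R]_n -> R, exists C M : R,
  [/\ 0 <= C, coord_expansion f A H C,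
      [/\ continuous f, forall i, continuous (A i) & forall i, continuous (H i)],
      [/\ forall y, `|f y| <= M, forall i y, `|A i y| <= M & forall i y, `|H i y| <= M] &
      [/\ forall y, theta < q y -> 0 <= \sum_(i < n) H i y,
          forall y, `|y| <= rho -> `|f y - u y| <= eta & forall y, f y <= S]].

Let grid z N (j : nat) : R := j%:R * (z ^+ 2 / N.+1%:R).

(** The only event on which the value of [f] at the exit is bounded by [S]
    instead of [m + 2 eta], apart from late exits. *)
Let high_exit (theta z : R) (f : 'rV[R]_n -> R) (N : nat) : set T :=
  [set w | exists2 j, (j <= N.+1)%N &
     [/\ forall i, (i < j)%N -> theta < q (B (grid z N i) w),
         q (B (grid z N j) w) <= theta & m + 2 * eta <= f (B (grid z N j) w)]].

Let grid_ge0 z N j : 0 < z -> 0 <= grid z N j.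
Proof. by move=> z0; rewrite mulr_ge0// divr_ge0// exprn_ge0// ltW. Qed.

Let grid_lt z N j : 0 < z -> grid z N j < grid z N j.+1.
Proof. by move=> z0; rewrite ltr_pM2r ?ltr_nat// divr_gt0// exprn_gt0. Qed.

Let measurable_high_exit theta z f N : 0 < z -> continuous f ->
  measurable (high_exit theta z f N).
Proof.
move=> z0 cf.
pose F j := (\bigcap_(i in [set i | (i < j)%N]) [set w | q (B (grid z N i) w) \in `]theta, +oo[]) `&`
  [set w | q (B (grid z N j) w) \in `]-oo, theta]] `&`
  [set w | f (B (grid z N j) w) \in `[m + 2 * eta, +oo[].
have -> : high_exit theta z f N = \bigcup_(j in [set j | (j <= N.+1)%N]) F j.
  apply/seteqP; split=> w.
    move=> [j jN [h1 h2 h3]]; exists j => //; split; first split.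
    - by move=> i /= ij; rewrite in_itv/= h1.
    - by rewrite /= in_itv.
    - by rewrite /= in_itv/= h3.
  move=> [j /= jN [[h1 h2] h3]]; exists j => //; split.
  - by move=> i ij; have := h1 i ij; rewrite /= in_itv/= andbT.
  - by move: h2; rewrite /= in_itv.
  - by move: h3; rewrite /= in_itv/= andbT.
apply: bigcup_measurable => j _; apply: measurableI; first apply: measurableI.
- rewrite bigcap_mkcond; apply: bigcapT_measurable => i; case: ifP => // _.
  by apply: measurable_brownian_itv => //; exact: grid_ge0.
- by apply: measurable_brownian_itv => //; exact: grid_ge0.
- by apply: measurable_brownian_itv => //; exact: grid_ge0.
Qed.

Let rho0 : 0 <= rho.
Proof. by apply: le_trans (q_rho qx). Qed.

Let grid_estimate theta z f : 'I_n -> 0 <= theta -> 0 < z -> subharmonic_approx theta f ->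
  exists K, forall N, (z ^+ 2 <= N.+1%:R) ->
  f x <= m + 2 * eta + S * fine (P (high_exit theta z f N)) + S * (2 * rho / z)
    + K * Num.sqrt (z ^+ 2 / N.+1%:R).
Proof.
move=> i0 th0 z0 [A [H [C [M [C0 fAH [cf cA cH] [fM AM HM] [Hge fu fS]]]]]].
exists (C * (1 + 2 * n%:R) * 54 * expR 2 * n%:R * z ^+ 2) => N zN.
have [B0 _ _ law indep] := BM.
pose h := z ^+ 2 / N.+1%:R.
have h0 : 0 < h by rewrite divr_gt0// exprn_gt0.
pose sg := Num.sqrt h.
have sg0 : 0 < sg by rewrite sqrtr_gt0.
have sg1 : sg <= 1.
  by rewrite -[leRHS]sqrtr1 ler_sqrt// ler_pdivrMr ?mul1r.
pose xi (a : 'I_N.+1 * 'I_n) (w : T) :=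
  B (grid z N a.1.+1) w ord0 a.2 - B (grid z N a.1) w ord0 a.2.
have mxi a : measurable_fun setT (xi a : T -> measurableTypeR R).
  by apply: measurable_funB; apply: mB; exact: grid_ge0.
have indep_xi : mutually_independent P xi.
  by apply: (indep N.+1 (grid z N)) => [|j _]; [exact: grid_ge0|exact: grid_lt].
have law_xi a (A' : set (measurableTypeR R)) : measurable A' ->
    P (xi a @^-1` A') = normal_prob 0 sg A'.
  move=> mA'; rewrite [LHS](law _ _ a.2 (grid_ge0 N a.1 z0) (grid_lt N a.1 z0) A' mA').
  congr (normal_prob 0 (Num.sqrt _) A').
  by rewrite /grid -mulrBl -natrB// subSnn mul1r.
have chainE j w : (j <= N.+1)%N -> chain xi x j w = B (grid z N j) w.
  elim: j => [_|j IH jN].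
    have -> : chain xi x 0 w = x by apply/rowP => l; rewrite mxE big_pred0 ?addr0.
    by rewrite /grid mul0r B0.
  have -> := chain_step xi x (Ordinal jN) w.
  have -> : chain xi x (Ordinal jN) w = B (grid z N j) w by exact: IH (ltnW jN).
  by apply/rowP => l; rewrite !mxE ltn_ord /xi/= addrC subrK.
have := stopped_value_ge mxi indep_xi sg0 sg1 law_xi x cq C0 fAH cf cA cH fM AM HM Hge.
have ist : P.-integrable setT (EFin \o stopped_value xi x q theta f).
  exact: (stopped_value_integrable P mxi x theta cq cf fM).
set sv := stopped_value _ _ _ _ _ in ist *.
have mE := measurable_high_exit theta N z0 cf.
pose U := [set w | B (z ^+ 2) w ord0 i0 \in `[- rho, rho]].
have mU : measurable U.
  apply: (measurable_brownian_itv (g := fun y => y ord0 i0)); first exact: sqr_ge0.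
  exact: coord_continuous.
have gridN : grid z N N.+1 = z ^+ 2 by rewrite /grid mulrC divfK.
have svle w : sv w <= m + 2 * eta + S * \1_(high_exit theta z f N) w + S * \1_U w.
  have [j [jN jb] [svE jT]] := stopped_sum (fun j => f (chain xi x j w))
     (fun j => alive xi x q theta j w) N.+1.
  have -> : sv w = f (chain xi x j w) by [].
  rewrite chainE//.
  have i1 (D : set T) : 0 <= S * \1_D w by rewrite mulr_ge0// indicE ler0n.
  have me0 : 0 <= m + 2 * eta by rewrite addr_ge0// mulr_ge0// ltW.
  have [al|nal] := boolP (alive xi x q theta j w).
    have jE := jT al.
    have Uw : U w.
      move: al; rewrite /alive chainE// jE gridN => al.
      rewrite /U /= in_itv/= -ler_norml (le_trans (coord_le_norm _ _))//.
      by apply: q_rho; exact: le_lt_trans al.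
    rewrite (indicE _ U) mem_set// mulr1 (le_trans (fS _))// lerDr addr_ge0//.
  have [fle|fgt] := leP (m + 2 * eta) (f (B (grid z N j) w)); last first.
    by rewrite (le_trans (ltW fgt))// -addrA lerDl addr_ge0.
  have Ew : high_exit theta z f N w.
    exists j => //; split => //.
    - by move=> i ij; have := jb i ij; rewrite /alive chainE// ltnW// (leq_trans ij).
    - by move: nal; rewrite /alive chainE// -leNgt.
  rewrite (indicE _ (high_exit theta z f N)) mem_set// mulr1 (le_trans (fS _))//.
  by rewrite addrAC lerDr addr_ge0.
have iind (D : set T) : measurable D -> P.-integrable setT (EFin \o (fun w => S * \1_D w)).
  move=> mD; apply: (@bounded_integrable _ _ _ P _ S).
    by apply: measurable_funM => //; exact: measurable_indic.
  by move=> w; rewrite ger0_norm ?mulr_ge0// indicE; case: (_ \in _); rewrite ?mulr1 ?mulr0.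
have ic : P.-integrable setT (EFin \o cst (m + 2 * eta)).
  exact: finite_measure_integrable_cst.
have i2 : P.-integrable setT (EFin \o (fun w => cst (m + 2 * eta) w + S * \1_(high_exit theta z f N) w)).
  exact: (@integrableD _ _ _ P _ measurableT _ _ ic (iind _ mE)).
have i3 : P.-integrable setT (EFin \o (fun w => cst (m + 2 * eta) w + S * \1_(high_exit theta z f N) w + S * \1_U w)).
  exact: (@integrableD _ _ _ P _ measurableT _ _ i2 (iind _ mU)).
have Rind (D : set T) : measurable D -> \int[P]_w (S * \1_D w) = S * fine (P D).
  move=> mD; rewrite RintegralZl//; last first.
    by apply: (@bounded_integrable _ _ _ P _ 1) => [|w]; [exact: measurable_indic|
      rewrite ger0_norm// indicE; case: (_ \in _)].
  by rewrite /Rintegral integral_indic// setIT.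
have := le_Rintegral measurableT ist i3 (fun w _ => svle w).
rewrite RintegralD//; last exact: iind.
rewrite RintegralD//; last exact: iind.
rewrite Rintegral_cst_prob !Rind//.
have slab := brownian_slab i0 z0 rho0; rewrite -/U in slab.
have := ler_wpM2l S0 slab => h1 h2 h3.
have hE : N.+1%:R * sg ^+ 3 = z ^+ 2 * sg.
  rewrite exprS [sg * _]mulrC mulrA; congr (_ * _).
  by rewrite /sg sqr_sqrtr ?(ltW h0)// /h mulrC divfK.
move: h3; rewrite hE; set KK := C * (1 + 2 * n%:R) * 54 * expR 2 * n%:R.
rewrite mulrA -/h -/sg; lra.
Qed.


(** The stopped value of the approximation is at most [m + 2 eta] unless the walk
    makes a high exit or stays in the bounded set [q > 0] until a late time; the
    latter is negligible because the Gaussian spreads out. A path whose walks make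
    high exits for infinitely many meshes and levels makes one itself, at a point
    where [q = 0], so the upper limit of these events is contained in [A]. *)
Lemma brownian_max (i0 : 'I_n) (f : nat -> 'rV[R]_n -> R) (A : set T) :
  (forall k, subharmonic_approx k.+1%:R^-1 (f k)) ->
  measurable A ->
  (forall w t, 0 <= t -> (forall s : R, 0 <= s -> s < t -> 0 < q (B s w)) ->
     q (B t w) = 0 -> m + eta <= u (B t w) -> A w) ->
  u x <= m + 3 * eta + S * fine (P A).
Proof.
move=> happ mA HA; rewrite leNgt; apply/negP => lt.
pose e := u x - (m + 3 * eta + S * fine (P A)).
have e0 : 0 < e by rewrite subr_gt0.
have [B0 cB _ _ _] := BM.
(* The horizon [z ^ 2] makes the late exits cost at most a quarter of the gap. *)
pose z := 8 * S * rho / e + 1.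
have z0 : 0 < z by rewrite ltr_pwDr// divr_ge0 ?mulr_ge0// ltW.
have ze : S * (2 * rho / z) <= e / 4.
  rewrite mulrA ler_pdivrMr// /z mulrDr mulr1.
  rewrite (_ : e / 4 * (8 * S * rho / e) = S * (2 * rho)).
    by rewrite lerDl divr_ge0// ltW.
  by field; exact: lt0r_neq0.
have cf k : continuous (f k) by have [? [? [? [? [_ _ [] ]]]]] := happ k.
pose F k := lim_sup_set (high_exit k.+1%:R^-1 z (f k)).
have mE k N := measurable_high_exit k.+1%:R^-1 N z0 (cf k).
have mF k : measurable (F k) by apply: measurable_lim_sup_set => N; exact: mE.
have z20 : 0 < z ^+ 2 by rewrite exprn_gt0.
have [k1 k1P] := ltr_add_invr qx; rewrite add0r in k1P.
have FP k w : k.+1%:R^-1 < q x -> F k w -> exists2 t : R, 0 <= t <= z ^+ 2 &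
    [/\ forall s : R, 0 <= s -> s < t -> k.+1%:R^-1 <= q (B s w),
        q (B t w) = k.+1%:R^-1 & m + eta <= u (B t w)].
  move=> kx Fw.
  have [|t tT [h1 h2 h3]] :=
    @grid_limit R n (B ^~ w) (cB w) q x cq (B0 w) (z ^+ 2) k.+1%:R^-1 (m + 2 * eta) (f k) z20 (cf k) kx.
    move=> N; have [N' /= NN' [j jN [j1 j2 j3]]] := Fw N I.
    by exists N' => //; exists j => //; split.
  exists t => //; split => //.
  have [_ [_ [_ [_ [_ _ _ _ [_ fu _]]]]]] := happ k.
  have : `|f k (B t w) - u (B t w)| <= eta by apply/fu/q_rho; rewrite h2.
  rewrite ler_norml => /andP[_ h4]; lra.
have LA : lim_sup_set F `<=` A.
  move=> w Lw.
  have [|||t tT [h1 h2 h3]] := @level_limit R n (B ^~ w) (cB w) q u cq cu (z ^+ 2) (m + eta) (fun k => k.+1%:R^-1).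
  - by move=> k.
  - exact: cvg_harmonic.
  - move=> N; have [k /= Nk Fk] := Lw (maxn N k1) I.
    move: Nk; rewrite geq_max => /andP[Nk kk1]; exists k => //; apply: FP => //.
    by apply: le_lt_trans k1P; rewrite lef_pV2 ?posrE ?ltr0n// ler_nat.
  by apply: (HA w t) => //; case/andP: tT.
pose e' := e / (4 * (S + 1)).
have e'0 : 0 < e' by rewrite divr_gt0// mulr_gt0// ltr_wpDl.
have [k2 k2P] := prob_lim_sup P mF e'0.
pose k := maxn k1 k2.
have [n0 n0P] := prob_lim_sup P (mE k) e'0.
have th0 : 0 <= k.+1%:R^-1 :> R by [].
have [K KP] := grid_estimate i0 th0 z0 (happ k).
pose r := e / (8 * (`|K| + 1)).
have r0 : 0 < r by rewrite divr_gt0// mulr_gt0// ltr_wpDl.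
pose N := maxn n0 (maxn (Num.truncn (z ^+ 2)) (Num.truncn (z ^+ 2 / r ^+ 2))).
have zN : z ^+ 2 <= N.+1%:R.
  apply: le_trans (ltW (truncnS_gt _)) _; rewrite ler_nat ltnS /N.
  by rewrite !leq_max leqnn orbT.
have rN : z ^+ 2 / r ^+ 2 <= N.+1%:R.
  apply: le_trans (ltW (truncnS_gt _)) _; rewrite ler_nat ltnS /N.
  by rewrite !leq_max leqnn !orbT.
have sN : Num.sqrt (z ^+ 2 / N.+1%:R) <= r.
  rewrite -[leRHS](gtr0_norm r0) -sqrtr_sqr ler_sqrt ?sqr_ge0//.
  by rewrite ler_pdivrMr// mulrC -ler_pdivrMr// exprn_gt0.
have KN : K * Num.sqrt (z ^+ 2 / N.+1%:R) <= e / 8.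
  apply: (@le_trans _ _ ((`|K| + 1) * r)).
    apply: (@le_trans _ _ ((`|K| + 1) * Num.sqrt (z ^+ 2 / N.+1%:R))).
      by rewrite ler_wpM2r ?sqrtr_ge0// (le_trans (ler_norm _))// lerDl.
    by rewrite ler_wpM2l// addr_ge0.
  rewrite /r le_eqVlt; apply/orP; left; apply/eqP; field.
  by rewrite gt_eqF// ltr_wpDl.
have := KP N zN.
have h1 : fine (P (high_exit k.+1%:R^-1 z (f k) N)) <= fine (P A) + 2 * e'.
  have := n0P N (leq_maxl _ _); have := k2P k (leq_maxr _ _); rewrite -/(F k).
  have := fine_prob_le P (measurable_lim_sup_set mF) mA LA; lra.
have h2 := ler_wpM2l S0 h1.
have fx : u x - eta <= f k x.
  have [_ [_ [_ [_ [_ _ _ _ [_ fu _]]]]]] := happ k.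
  have : `|f k x - u x| <= eta by apply/fu/q_rho.
  rewrite ler_norml => /andP[h4 _]; lra.
have h3 : S * (2 * e') <= e / 2.
  have -> : S * (2 * e') = (e / 2) * (S / (S + 1)).
    by rewrite /e'; field; rewrite gt_eqF// ltr_wpDl.
  by rewrite ler_piMr ?divr_ge0 ?(ltW e0)// ler_pdivrMr ?mul1r ?lerDl// ltr_wpDl.
move: h2; rewrite mulrDr => h2 h4; have := e0; rewrite /e in ze h3 KN * => ?; lra.
Qed.

End brownian.

(** * Distance functions and first hitting events *)

Section distance.
Variables (R : realType) (n : nat) (C : set 'rV[R]_n).

Definition set_dist (y : 'rV[R]_n) : R := inf [set `|y - c| | c in C].

Hypotheses (C0 : C !=set0).

Let dist_inf y : has_inf [set `|y - c| | c in C].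
Proof.
split; first by have [c Cc] := C0; exists `|y - c|, c.
by exists 0 => _ [c _ <-].
Qed.

Lemma set_dist_ge0 y : 0 <= set_dist y.
Proof.
by apply: lb_le_inf; [exact: (dist_inf y).1|move=> _ [c _ <-]].
Qed.

Lemma set_dist_le y c : C c -> set_dist y <= `|y - c|.
Proof. by move=> Cc; apply: ge_inf; [exact: (dist_inf y).2|exists c]. Qed.

Lemma set_dist_lip y z : set_dist y <= set_dist z + `|y - z|.
Proof.
rewrite -lerBlDr; apply: lb_le_inf; first exact: (dist_inf z).1.
move=> _ [c Cc <-]; rewrite lerBlDr (le_trans (set_dist_le y Cc))//.
by rewrite [leRHS]addrC; have := ler_normD (y - z) (z - c); rewrite subrKA.
Qed.

Lemma set_dist_continuous : continuous set_dist.
Proof.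
apply: (@lipschitz_continuous _ _ _ 1) => y z; rewrite mul1r.
have := set_dist_lip y z; have := set_dist_lip z y; rewrite (distrC z y) => h1 h2.
by rewrite ler_norml; apply/andP; split; lra.
Qed.

Lemma set_dist_eq0 y : C y -> set_dist y = 0.
Proof.
move=> Cy; apply/eqP; rewrite eq_le set_dist_ge0 andbT.
by rewrite (le_trans (set_dist_le y Cy))// subrr normr0.
Qed.

Lemma closed_set_dist y : closed C -> set_dist y <= 0 -> C y.
Proof.
move=> cC dy; apply: cC => U /nbhs_ballP[e /= e0 eU].
have [_ [c Cc <-]] := inf_adherent e0 (dist_inf y).
rewrite -/(set_dist y) => h; exists c; split => //; apply: eU.
by rewrite -ball_normE /=; lra.
Qed.

End distance.

Lemma closed_boundary (T : topologicalType) (W : set T) : closed (boundary W).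
Proof.
apply: closedI; first exact: closed_closure.
by apply: open_closedC; exact: open_interior.
Qed.

Lemma first_hitting (R : realType) (n : nat) (b : R -> 'rV[R]_n) (C : set 'rV[R]_n) :
  {within `[0, +oo[, continuous b} -> closed C -> (exists2 t, 0 <= t & C (b t)) ->
  exists t : R, [/\ 0 <= t, C (b t) & forall s : R, 0 <= s -> s < t -> ~ C (b s)].
Proof.
move=> cb cC [t1 t10 Ct1].
have C0 : C !=set0 by exists (b t1).
pose S := [set t : R | 0 <= t /\ C (b t)].
have hS : has_inf S by split; [exists t1|exists 0 => t []].
have lbS t : S t -> inf S <= t by move=> St; apply: ge_inf; [exact: hS.2|].
have i0 : 0 <= inf S by apply: lb_le_inf; [exact: hS.1|move=> t []].
exists (inf S); split => //; last first.
  by move=> s s0 sS Cs; have := lbS s (conj s0 Cs); rewrite leNgt sS.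
apply: closed_set_dist => //; rewrite leNgt; apply/negP => lt.
have [dl dl0 hdl] := path_eps cb (set_dist_continuous C0) i0 lt.
have [t [t0 Ct] tS] := inf_adherent dl0 hS.
have tS' : inf S <= t by apply: lbS.
have : `|t - inf S| < dl by rewrite ltr_norml; apply/andP; split; lra.
by move=> /(hdl t t0); rewrite (set_dist_eq0 C0 Ct) sub0r normrN ger0_norm ?(ltW lt)// ltxx.
Qed.

Section hitting_measurable.
Context d (T : measurableType d) (R : realType) (P : probability T R).
Variables (n : nat) (x : 'rV[R]_n) (B : R -> T -> 'rV[R]_n).
Hypothesis BM : brownian_motion P x B.

(** By continuity, meeting a closed set before a rational time is detected on
    the rational times. *)
Lemma measurable_hit (C : set 'rV[R]_n) (q : rat) : closed C ->
  measurable [set w | exists2 t : R, 0 <= t <= ratr q & C (B t w)].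
Proof.
move=> cC; have [_ cB _ _ _] := BM.
have [C0|C0] := pselect (C !=set0); last first.
  rewrite (_ : [set w | _] = set0)//; apply/seteqP; split=> // w [t _ Ct].
  by apply: C0; exists (B t w).
pose F (k : nat) (r : rat) :=
  if (0 <= (ratr r : R)) && (ratr r <= (ratr q : R)) then
  [set w | set_dist C (B (ratr r) w) \in `]-oo, k.+1%:R^-1[] else set0.
rewrite (_ : [set w | _] = \bigcap_k \bigcup_r F k r).
  apply: bigcapT_measurable => k; apply: bigcupT_measurable_rat => r.
  rewrite /F; case: ifP => // /andP[r0 _].
  by apply: (measurable_brownian_itv BM) => //; exact: set_dist_continuous.
apply/seteqP; split=> [w [t /andP[t0 tq] Ct] k _|w Fw].
  have e0 : 0 < k.+1%:R^-1 :> R by [].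
  have [dl dl0 hdl] := path_eps (cB w) (set_dist_continuous C0) t0 e0.
  have [r [r0 rq rt]] : exists r : rat, [/\ 0 <= (ratr r : R), ratr r <= (ratr q : R) &
      `|ratr r - t| < dl].
    move: tq; rewrite le_eqVlt => /predU1P[tE|tq].
      by exists q; rewrite -tE subrr normr0.
    have : t < Num.min (t + dl) (ratr q) by rewrite lt_min tq andbT ltrDl.
    move=> /rat_in_itvoo[r]; rewrite in_itv/= lt_min => /and3P[r1 r2 r3].
    exists r; split; [exact: le_trans (ltW r1)|exact: ltW|].
    by rewrite ltr_norml; apply/andP; split; move: (ratr r : R) r1 r2 r3 => ? *; lra.
  exists r => //; rewrite /F r0 rq /= in_itv/=.
  have := hdl _ r0 rt; rewrite (set_dist_eq0 C0 Ct) subr0.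
  exact: le_lt_trans (ler_norm _).
have H N : exists2 N', (N <= N')%N & exists2 t : R, 0 <= t <= ratr q &
    set_dist C (B t w) < N'.+1%:R^-1.
  have [r _ Fr] := Fw N I; exists N => //; move: Fr; rewrite /F; case: ifP => //= rq.
  by rewrite in_itv/= => h; exists (ratr r).
have [t tq ht] := cluster_infinitely_often H.
have t0 : 0 <= t by case/andP: tq.
exists t => //; apply: closed_set_dist => //; rewrite leNgt; apply/negP => lt.
have e0 : 0 < set_dist C (B t w) / 2 by rewrite divr_gt0.
have [dl dl0 hdl] := path_eps (cB w) (set_dist_continuous C0) t0 e0.
have [m mP] := ltr_add_invr e0; rewrite add0r in mP.
have [N mN [s [/andP[s0 _] sN] st]] := ht _ dl0 m.
have := hdl s s0 st; rewrite ltr_norml => /andP[h _].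
have : N.+1%:R^-1 <= m.+1%:R^-1 :> R by rewrite lef_pV2 ?posrE ?ltr0n// ler_nat.
move: (N.+1%:R^-1 : R) (m.+1%:R^-1 : R) sN mP => a c *; lra.
Qed.

(** The first hitting point of [D] lies in [F] if and only if [D `&` F] is hit and
    at no rational time has [D] been hit but [D `&` F] not. *)
Lemma measurable_first_hit (D F : set 'rV[R]_n) : closed D -> closed F ->
  measurable (first_hit_in B D F).
Proof.
move=> cD cF; have [_ cB _ _ _] := BM.
have cK : closed (D `&` F) by exact: closedI.
pose hit (C : set 'rV[R]_n) (q : rat) := [set w | exists2 t : R, 0 <= t <= ratr q & C (B t w)].
rewrite (_ : first_hit_in B D F = (\bigcup_q hit (D `&` F) q) `&`
   ~` (\bigcup_q (hit D q `\` hit (D `&` F) q))).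
  apply: measurableI.
    by apply: bigcupT_measurable_rat => q; exact: measurable_hit.
  apply: measurableC; apply: bigcupT_measurable_rat => q.
  by apply: measurableD; exact: measurable_hit.
apply/seteqP; split=> [w [t [t0 Dt Dn Ft]]|w [[q _ [t1 /andP[t10 t1q] Kt1]] nh]].
  split.
    have : t < t + 1 by rewrite ltrDl.
    move=> /rat_in_itvoo[q]; rewrite in_itv/= => /andP[tq _].
    by exists q => //; exists t => //; rewrite t0 ltW.
  move=> [q _ [[s /andP[s0 sq] Ds] nK]]; apply: nK; exists t => //.
  rewrite t0/=; apply: le_trans sq; rewrite leNgt; apply/negP => st.
  exact: Dn s0 st Ds.
have [t [t0 Dt tD]] := first_hitting (cB w) cD (ex_intro2 _ _ t1 t10 Kt1.1).
exists t; split=> //.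
have [t2 [t20 [Dt2 Ft2] _]] := first_hitting (cB w) cK (ex_intro2 _ _ t1 t10 Kt1).
apply: contrapT => nF.
have tt2 : t <= t2 by rewrite leNgt; apply/negP => /(tD _ t20).
have [t3 [t30 [Dt3 Ft3] t3K]] := first_hitting (cB w) cK (ex_intro2 _ _ t1 t10 Kt1).
have tt3 : t < t3.
  rewrite lt_neqAle; apply/andP; split; first by apply/eqP => tE; apply: nF; rewrite tE.
  by rewrite leNgt; apply/negP => /(tD _ t30).
have [p] := rat_in_itvoo tt3; rewrite in_itv/= => /andP[tp pt3].
apply: nh; exists p => //; split; first by exists t => //; rewrite t0 ltW.
move=> [s /andP[s0 sp] Ks]; exact: (t3K s s0 (le_lt_trans sp pt3)).
Qed.

End hitting_measurable.

(** * Lebesgue measure of boxes *)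

Section lebesgue_product.
Variable R : realType.

(** By induction on the dimension, using Tonelli's theorem. *)
Lemma ge0_integral_lebesgue_prod (n : nat) (g : 'I_n -> measurableTypeR R -> \bar R) :
  (forall i, measurable_fun setT (g i)) -> (forall i s, 0 <= g i s)%E ->
  (\int[lebesgue_n R n]_t (\prod_(i < n) g i (tnth t i)) =
   \prod_(i < n) \int[lebesgue_measure]_s g i s)%E.
Proof.
elim: n g => [|n IH] g mg g0.
  rewrite /= big_ord0.
  under eq_integral do rewrite big_ord0.
  by rewrite integral_cst//= diracT mul1e.
have mtc : measurable_fun setT (@tcons R n) by exact: measurable_tcons.
pose F (t : n.+1.-tuple (measurableTypeR R)) := (\prod_(i < n.+1) g i (tnth t i))%E.
have mF m (h : 'I_m -> measurableTypeR R -> \bar R) : (forall i, measurable_fun setT (h i)) ->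
    measurable_fun [set: m.-tuple (measurableTypeR R)] (fun t => \prod_(i < m) h i (tnth t i))%E.
  move=> mh; have := @index_enum_uniq ('I_m); move: (index_enum _) => s _.
  elim: s => [|a s IHs].
    by under eq_fun do rewrite big_nil; exact: measurable_cst.
  under eq_fun do rewrite big_cons.
  apply: emeasurable_funM => //.
  by apply: measurableT_comp => //; exact: measurable_tnth.
have prod_ge0 m (h : 'I_m -> \bar R) : (forall i, 0 <= h i)%E -> (0 <= \prod_(i < m) h i)%E.
  by move=> h0; apply: prode_ge0 => i _; exact: h0.
transitivity (\int[(lebesgue_measure \x lebesgue_n R n)%E]_p F (tcons p))%E.
  rewrite -[LHS]/(\int[pushforward (lebesgue_measure \x lebesgue_n R n)%E (@tcons R n)]_t F t)%E.
  rewrite ge0_integral_pushforward//; first exact: mF.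
  by move=> t _; exact: prod_ge0.
rewrite fubini_tonelli1//; first last.
- by move=> p; exact: prod_ge0.
- by apply: measurableT_comp => //; exact: mF.
transitivity (\int[lebesgue_measure]_a (g ord0 a * \prod_(i < n) \int[lebesgue_measure]_s g (lift ord0 i) s))%E.
  apply: eq_integral => a _; rewrite /fubini_F.
  transitivity (\int[lebesgue_n R n]_t (g ord0 a * \prod_(i < n) g (lift ord0 i) (tnth t i)))%E.
    apply: eq_integral => t _; rewrite /F big_ord_recl; congr (_ * _)%E.
    by apply: eq_bigr => i _; rewrite tnthS.
  rewrite ge0_integralZl//; first last.
  - by move=> t _; exact: prod_ge0.
  - exact: (mF n (fun i => g (lift ord0 i))).
  by congr (_ * _)%E; rewrite (IH (fun i => g (lift ord0 i))).
rewrite ge0_integralZr//.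
  by rewrite [in RHS]big_ord_recl.
by apply: prod_ge0 => i; exact: integral_ge0.
Qed.

Definition box (n : nat) (a b : 'I_n -> R) : set (n.-tuple (measurableTypeR R)) :=
  [set t | forall i, a i <= tnth t i <= b i].

Lemma measurable_box n (a b : 'I_n -> R) : measurable (box a b).
Proof.
rewrite (_ : box a b = \bigcap_(i in [set: 'I_n]) (fun t => tnth t i) @^-1` `[a i, b i]).
  apply: fin_bigcap_measurable => // i _.
  by rewrite -[X in measurable X]setTI; apply: measurable_tnth => //; exact: measurable_itv.
by apply/seteqP; split=> [t tb i _|t tb i]; have := tb i; rewrite /= in_itv/=; apply.
Qed.

Lemma lebesgue_box n (a b : 'I_n -> R) : (forall i, a i <= b i) ->
  lebesgue_n R n (box a b) = (\prod_(i < n) (b i - a i))%:E.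
Proof.
move=> ab.
have mI i : measurable (`[a i, b i]%classic : set (measurableTypeR R)) by exact: measurable_itv.
transitivity (\int[lebesgue_n R n]_t (\1_(box a b) t)%:E)%E.
  by rewrite integral_indic ?setIT//; exact: measurable_box.
pose g (i : 'I_n) (s : measurableTypeR R) := (\1_(`[a i, b i]%classic : set (measurableTypeR R)) s : R)%:E.
transitivity (\int[lebesgue_n R n]_t (\prod_(i < n) g i (tnth t i)))%E.
  apply: eq_integral => t _; rewrite /g prodEFin; congr EFin.
  rewrite indicE; have [|tn] := boolP (t \in box a b).
    rewrite inE => tb; rewrite big1// => i _.
    by rewrite indicE mem_set// /= in_itv/= tb.
  have [i] : exists i, ~ (a i <= tnth t i <= b i).
    apply: contrapT => h; move/negP : tn; apply; rewrite inE => i.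
    by apply: contrapT => h'; apply: h; exists i.
  by move=> h; rewrite (bigD1 i)//= indicE memNset ?mul0r//.
rewrite ge0_integral_lebesgue_prod; last 2 first.
- by move=> i; apply/measurable_EFinP; exact: measurable_indic.
- by move=> i s; rewrite lee_fin.
rewrite -prodEFin; apply: eq_bigr => i _.
rewrite integral_indic// setIT.
rewrite [LHS](lebesgue_measure_itv `[a i, b i]) /= lte_fin.
case: ltP => //; move=> h; rewrite (_ : b i = a i) ?subrr//.
by apply/eqP; rewrite eq_le h ab.
Qed.

Lemma measurable_tuple_row (n : nat) (g : 'rV[R]_n -> R) : continuous g ->
  measurable_fun setT (fun t : n.-tuple (measurableTypeR R) => g (tuple_row t) : measurableTypeR R).
Proof.
move=> cg; apply: measurable_continuous_comp => // i.
under eq_fun do rewrite mxE.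
exact: measurable_tnth.
Qed.

(** Boxes have positive measure, so a bound that fails at one point for a
    continuous function fails on a set that is not negligible. *)
Lemma le_sup_norm (n : nat) (u : 'rV[R]_n -> R) (x : 'rV[R]_n) : continuous u ->
  (`|u x|%:E <= sup_norm u)%E.
Proof.
move=> cu; rewrite /sup_norm unlock /Lnorm.
pose bx (e : R) := box (fun i : 'I_n => x ord0 i - e) (fun i => x ord0 i + e).
have big (e : R) : 0 < e -> (0 < lebesgue_n R n (bx e))%E.
  move=> e0; rewrite /bx lebesgue_box; last by move=> i; lra.
  rewrite lte_fin prodr_gt0// => i _; lra.
have -> : (0 < lebesgue_n R n [set: n.-tuple (measurableTypeR R)])%E.
  apply: lt_le_trans (big 1 ltr01) _; rewrite le_measure ?inE//; exact: measurable_box.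
rewrite leNgt; apply/negP => lt.
set M := ess_sup_inf.ess_sup _ _ in lt.
have [r Mr ru] : exists2 r : R, (M <= r%:E)%E & r < `|u x|.
  move: lt; case: M => [r| |] //= lt; first by exists r.
  by exists (`|u x| - 1); [rewrite leNye|rewrite ltrBlDr ltrDl].
have e0 : 0 < `|u x| - r by rewrite subr_gt0.
have /(@cvgrPdist_lt R R^o 'rV[R]_n (nbhs x) _ u (u x)) /(_ _ e0) /nbhs_ballP[e /= e1 eu] := cu x.
have [N [mN N0 sN]] : (lebesgue_n R n).-negligible
    (~` [set t | (abse \o (EFin \o u \o @tuple_row R n)) t <= r%:E])%E.
  have /ess_sup_inf.ess_supP : (ess_sup_inf.ess_sup (lebesgue_n R n) (abse \o (EFin \o u \o @tuple_row R n)) <= r%:E)%E by [].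
  by [].
have e2 : 0 < e / 2 by rewrite divr_gt0.
have := big _ e2.
apply/negP; rewrite -leNgt -N0 le_measure ?inE//; first exact: measurable_box.
move=> t tb; apply: sN => /=; rewrite lee_fin => h.
have : ball x e (tuple_row t).
  rewrite -ball_normE /=; apply: norm_lt_coord => // i; rewrite !mxE.
  by have := tb i; rewrite ltr_norml => /andP[? ?]; apply/andP; split; lra.
move=> /eu /=; have := ler_distD 0 (u x) (u (tuple_row t)).
have := ler_normD (u x - u (tuple_row t)) (u (tuple_row t)); rewrite subrK; lra.
Qed.

End lebesgue_product.

(** * Smooth bumps *)

Section bump.
Variable R : realType.
Implicit Types (f g : R -> R) (p : {poly R}).

Lemma poly_le_expR p : exists2 C : R, 0 <= C &
  forall s : R, 0 <= s -> `|p.[s]| <= C * expR s.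
Proof.
exists (\sum_(i < size p) `|p`_i| * i.+1%:R ^+ i).
  by rewrite sumr_ge0// => i _; rewrite mulr_ge0// exprn_ge0.
move=> s s0; rewrite horner_coef mulr_suml.
apply: le_trans (ler_norm_sum _ _ _) _; apply: ler_sum => i _.
rewrite normrM -mulrA ler_wpM2l// normrX ger0_norm//.
have i0 : 0 < i.+1%:R :> R by rewrite ltr0n.
have h : s / i.+1%:R <= expR (s / i.+1%:R).
  by apply: le_trans (expR_ge1Dx _); rewrite lerDr.
have h2 : (s / i.+1%:R) ^+ i <= expR (s / i.+1%:R) ^+ i.
  by rewrite lerXn2r// nnegrE ?expR_ge0// divr_ge0.
have -> : s ^+ i = i.+1%:R ^+ i * (s / i.+1%:R) ^+ i.
  by rewrite -exprMn mulrC divfK ?gt_eqF.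
rewrite ler_wpM2l ?exprn_ge0// (le_trans h2)// -expRM_natl ler_expR.
rewrite mulrCA ler_piMr// ler_pdivrMr// mul1r ler_nat//.
Qed.

Lemma is_derive_flat f (x C : R) :
  (forall h, `|f (h + x) - f x| <= C * h ^+ 2) -> is_derive x 1 f 0.
Proof.
move=> fC.
have lim0 : (fun h : R => h^-1 *: ((f \o shift x) (h *: 1) - f x)) @ 0^' --> (0 : R).
  apply/(@cvgrPdist_lt R R^o) => e e0.
  have K0 : 0 < `|C| + 1 by rewrite ltr_wpDl.
  rewrite near_withinE; apply/nbhs_ballP; exists (e / (`|C| + 1)) => /=; first by rewrite divr_gt0.
  move=> h; rewrite -ball_normE /= sub0r normrN ltr_pdivlMr// => he h0.
  rewrite sub0r normrN normrM normfV ltr_pdivrMl ?normr_gt0//.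
  rewrite [h *: 1]mulr1; apply: le_lt_trans (fC h) _.
  apply: (@le_lt_trans _ _ (`|h| * (`|h| * (`|C| + 1)))); last first.
    by rewrite ltr_pM2l// normr_gt0.
  rewrite mulrA -expr2 real_normK ?num_real// mulrC ler_wpM2l ?sqr_ge0//.
  by rewrite (le_trans (ler_norm _))// lerDl.
apply: DeriveDef; first by apply/cvg_ex; exists 0.
exact: cvg_lim lim0.
Qed.

(** The functions [p(1/x) e^{-1/x}], extended by zero: a family closed under
    differentiation whose members are flat at the origin. *)
Definition flat_exp p (x : R) : R := if 0 < x then p.[x^-1] * expR (- x^-1) else 0.

Lemma is_derive_flat_exp p (x : R) :
  is_derive x 1 (flat_exp p) (flat_exp ('X^2 * (p - p^`())) x).
Proof.
have [x0|x0|->] := ltgtP x 0.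
- rewrite {2}/flat_exp ltNge (ltW x0)/=.
  have d0 : is_derive x (1 : R) (cst 0 : R -> R) (0 : R) by exact: is_derive_cst.
  apply: near_eq_is_derive d0.
  near=> y; rewrite /flat_exp/= ltNge (_ : y <= 0)//.
  by apply: ltW; near: y; exact: lt_nbhsl.
- rewrite {2}/flat_exp x0.
  have dinv : is_derive x 1 (fun y : R => y^-1) (- x ^- 2 *: 1).
    by apply: (is_deriveV (f := id)) => //; rewrite gt_eqF.
  have d1 : is_derive x 1 (fun y : R => p.[y^-1]) (p^`().[x^-1] * (- x ^- 2 *: 1)).
    exact: (@is_derive1_comp _ (horner p) (fun y => y^-1)).
  have dN : is_derive x 1 (fun y : R => - y^-1) (- (- x ^- 2 *: 1)).
    exact: is_deriveN.
  have d2 : is_derive x 1 (fun y : R => expR (- y^-1)) (expR (- x^-1) * (- (- x ^- 2 *: 1))).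
    exact: (@is_derive1_comp _ expR (fun y => - y^-1)).
  have d3 := is_deriveM d1 d2.
  have := near_eq_is_derive _ d3; move=> /(_ (flat_exp p)) H.
  apply: is_derive_eq; first apply: H.
    near=> y; rewrite /flat_exp (_ : 0 < y)//.
    by near: y; exact: lt_nbhsr.
  rewrite hornerM hornerXn hornerD hornerN /GRing.scale/=.
  move: (p.[x^-1]) (p^`().[x^-1]) (expR (- x^-1)) => a b c.
  by field; exact: lt0r_neq0.
rewrite {2}/flat_exp ltxx.
have [C C0 pC] := poly_le_expR ('X^2 * p).
apply: (@is_derive_flat _ _ C) => h; rewrite addr0 {2}/flat_exp ltxx subr0 /flat_exp.
case: ifP => h0; last by rewrite normr0 mulr_ge0// sqr_ge0.
have hi : 0 <= h^-1 by rewrite invr_ge0 ltW.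
have := pC _ hi; rewrite !hornerE /= normrM => hp.
rewrite normrM (ger0_norm (expR_ge0 _)) expRN ler_pdivrMr ?expR_gt0//.
move: hp; rewrite ger0_norm ?exprn_ge0// exprVn ler_pdivrMl ?exprn_gt0//.
by move=> /le_trans; apply; rewrite le_eqVlt; apply/orP; left; apply/eqP; ring.
Unshelve. all: by end_near. Qed.

(** The class C^k, by recursion on the derivative: being stable under sums and
    products is then an easy induction. *)
Fixpoint Ck k f : Prop :=
  if k is k'.+1 then (forall x, derivable f x 1) /\ Ck k' (derive1 f) else continuous f.

Lemma derivable_continuous f : (forall x, derivable f x 1) -> continuous f.
Proof. by move=> df x; apply: differentiable_continuous; apply/derivable1_diffP. Qed.

Lemma CkS k f : Ck k.+1 f -> Ck k f.
Proof.
elim: k f => [|k IH] f [df Cf]; first exact: derivable_continuous.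
by split => //; exact: IH.
Qed.

Lemma Ck_add k f g : Ck k f -> Ck k g -> Ck k (f + g).
Proof.
elim: k f g => [|k IH] f g; first by move=> cf cg x; apply: cvgD; [exact: cf|exact: cg].
move=> [df Cf] [dg Cg]; split; first by move=> x; exact: derivableD.
rewrite (_ : (derive1 (f + g)) = (derive1 f) + (derive1 g)); first exact: IH.
by apply/funext => x; rewrite derive1E (deriveD (df x) (dg x)) -!derive1E.
Qed.

Lemma Ck_mul k f g : Ck k f -> Ck k g -> Ck k (f * g).
Proof.
elim: k f g => [|k IH] f g; first by move=> cf cg x; apply: cvgM; [exact: cf|exact: cg].
move=> Sf Sg; have [df Cf] := Sf; have [dg Cg] := Sg.
split; first by move=> x; exact: derivableM.
rewrite (_ : (derive1 (f * g)) = f * (derive1 g) + g * (derive1 f)).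
  by apply: Ck_add; apply: IH => //; exact: CkS.
by apply/funext => x; rewrite derive1E (deriveM (df x) (dg x)) -!derive1E.
Qed.

Lemma Ck_cst k (c : R) : Ck k (cst c).
Proof.
elim: k c => [|k IH] c; first exact: cst_continuous.
split; first by move=> x; exact: derivable_cst.
rewrite (_ : (derive1 (cst c)) = cst 0)//; apply/funext => x; exact: derive1_cst.
Qed.

Lemma is_derive_affine f (a c x : R) : derivable f (a + c * x) 1 ->
  is_derive x 1 (fun s => f (a + c * s)) (c * (derive1 f) (a + c * x)).
Proof.
move=> df.
have da : is_derive x 1 (fun s : R => a + c * s) c.
  have E : 0 + c *: (1 : R) = c by rewrite add0r /GRing.scale/= mulr1.
  exact: (is_derive_eq (is_deriveD (is_derive_cst a x 1) (is_deriveZ c (is_derive_id x (1 : R)))) E).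
have dff : is_derive (a + c * x) 1 f ((derive1 f) (a + c * x)) by apply: DeriveDef; rewrite ?derive1E.
have H := @is_derive1_comp _ f (fun s => a + c * s) x _ _ dff da.
by rewrite mulrC in H.
Qed.

Lemma Ck_affine k f (a c : R) : Ck k f -> Ck k (fun s => f (a + c * s)).
Proof.
elim: k f => [|k IH] f.
  move=> cf x; apply: (continuous_comp (f := fun s => a + c * s)); last exact: cf.
  by apply: cvgD; [exact: cvg_cst|apply: cvgM; [exact: cvg_cst|exact: cvg_id]].
move=> [df Cf]; split; first by move=> x; have [] := is_derive_affine (df (a + c * x)).
rewrite (_ : derive1 _ = cst c * (fun s => (derive1 f) (a + c * s))).
  by apply: Ck_mul; [exact: Ck_cst|exact: IH].
by apply/funext => x; rewrite derive1E; have [_ ->] := is_derive_affine (df (a + c * x)).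
Qed.

Lemma Ck_flat_exp k p : Ck k (flat_exp p).
Proof.
have d q : (derive1 (flat_exp q)) = flat_exp ('X^2 * (q - q^`())).
  by apply/funext => x; rewrite derive1E; have [] := is_derive_flat_exp q x.
have dd q x : derivable (flat_exp q) x 1 by have [] := is_derive_flat_exp q x.
elim: k p => [|k IH] p; first exact: derivable_continuous.
by split=> //; rewrite d.
Qed.

Definition raw_bump (s : R) : R := flat_exp 1 (1 + s) * flat_exp 1 (1 + - 1 * s).

Lemma Ck_raw_bump k : Ck k raw_bump.
Proof.
apply: (@Ck_mul k (fun s => flat_exp 1 (1 + s)) (fun s => flat_exp 1 (1 + - 1 * s))).
  have := @Ck_affine k _ 1 1 (Ck_flat_exp k 1).
  by congr Ck; apply/funext => s; rewrite mul1r.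
exact: Ck_affine (Ck_flat_exp k 1).
Qed.

Let flat_exp1 (s : R) : 0 <= flat_exp 1 s <= 1.
Proof.
rewrite /flat_exp; case: ifP => [s0|_]; last by rewrite lexx ler01.
rewrite hornerC mul1r expR_ge0/= -[leRHS]expR0 ler_expR oppr_le0 invr_ge0 ltW//.
Qed.

Lemma raw_bump_ge0 s : 0 <= raw_bump s.
Proof. by rewrite mulr_ge0//; have /andP[] := flat_exp1 (1 + s); have /andP[] := flat_exp1 (1 + - 1 * s). Qed.

Lemma raw_bump_le1 s : raw_bump s <= 1.
Proof.
have /andP[a0 a1] := flat_exp1 (1 + s); have /andP[b0 b1] := flat_exp1 (1 + - 1 * s).
by rewrite mulr_ile1.
Qed.

Lemma raw_bump_eq0 s : 1 <= `|s| -> raw_bump s = 0.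
Proof.
rewrite /raw_bump /flat_exp; have [s0|s0] := leP 0 s.
  rewrite ger0_norm// => s1; case: ifP => _; last by rewrite mul0r.
  by rewrite (_ : 0 < 1 + - 1 * s = false) ?mulr0//; apply/negbTE; rewrite -leNgt; lra.
rewrite ltr0_norm// => s1.
by rewrite (_ : 0 < 1 + s = false) ?mul0r//; apply/negbTE; rewrite -leNgt; lra.
Qed.

Lemma raw_bump_lb s : `|s| <= 2^-1 -> expR (- 4) <= raw_bump s.
Proof.
move=> s2; have lb (v : R) : 2^-1 <= v -> expR (- 2) <= flat_exp 1 v.
  move=> v2; have v0 : 0 < v by apply: lt_le_trans v2.
  rewrite /flat_exp v0 hornerC mul1r ler_expR lerN2.
  by rewrite -[leRHS]invrK lef_pV2 ?posrE.
rewrite (_ : - 4 = - 2 + - 2 :> R); last by ring.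
move: s2; rewrite ler_norml => /andP[? ?].
by rewrite expRD ler_pM ?expR_ge0//; apply: lb; lra.
Qed.

End bump.

Section normalized_bump.
Variable R : realType.
Implicit Types (f g : R -> R).
Local Notation mu := (@lebesgue_measure R).

Lemma integral_translation g (y : R) : continuous g -> (forall s, 0 <= g s) ->
  (\int[mu]_s (g (s - y))%:E = \int[mu]_s (g s)%:E)%E.
Proof.
move=> cg g0.
pose F (s : R) := s - y.
have dF (s : R) : is_derive s 1 F 1.
  have E : (1 : R) - 0 = 1 by rewrite subr0.
  exact: (is_derive_eq (is_deriveB (is_derive_id s (1 : R)) (is_derive_cst y s 1)) E).
have F1 : derive1 F = cst 1.
  by apply/funext => s; rewrite derive1E; case: (dF s).
rewrite (@increasing_ge0_integration_by_substitutionT R F g)//.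
- by apply: eq_integral => s _; rewrite F1 /= !fctE mulr1.
- by move=> a b ab; rewrite /F ltrD2r.
- by rewrite F1; exact: cst_continuous.
- by rewrite F1; exact: is_cvg_cst.
- by rewrite F1; exact: is_cvg_cst.
- exact: cvg_addrr_Ny.
- exact: cvg_addrr.
Qed.

Lemma Ck_continuous k f : Ck k f -> continuous f.
Proof. by elim: k => // k IH /CkS. Qed.

(** A rescaled [raw_bump] divided by its mass, which is positive because
    [raw_bump] is bounded below near the origin. *)
Lemma bump_exists (dl : R) : 0 < dl -> exists b : R -> R,
  [/\ forall k, Ck k b, forall s, 0 <= b s, forall s, dl <= `|s| -> b s = 0 &
      forall y, (\int[mu]_s (b (s - y))%:E = 1)%E].
Proof.
move=> dl0.
pose h (s : R) := raw_bump (0 + dl^-1 * s).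
have Ch k : Ck k h by exact: Ck_affine (Ck_raw_bump R k).
have ch : continuous h := Ck_continuous (Ch 0%N).
have mh : measurable_fun [set: measurableTypeR R] h by exact: continuous_measurable_fun.
have h0 s : 0 <= h s by exact: raw_bump_ge0.
have hdl s : dl <= `|s| -> h s = 0.
  move=> ds; apply: raw_bump_eq0; rewrite add0r normrM normfV (gtr0_norm dl0).
  by rewrite mulrC ler_pdivlMr// mul1r.
have mI (a : R) : measurable (`[- a, a]%classic : set (measurableTypeR R)) by exact: measurable_itv.
have up : (\int[mu]_s (h s)%:E <= (2 * dl)%:E)%E.
  apply: (@le_trans _ _ (\int[mu]_s (\1_(`[- dl, dl]%classic : set (measurableTypeR R)) s)%:E)%E).
    apply: ge0_le_integral => //.
    - by move=> s _; rewrite lee_fin.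
    - exact/measurable_EFinP.
    - by apply/measurable_EFinP; exact: measurable_indic.
    - move=> s _; rewrite lee_fin indicE.
      have [_|sn] := boolP (s \in _); first exact: raw_bump_le1.
      rewrite hdl// leNgt; apply: contra sn => sd.
      by rewrite inE /= in_itv/= -ler_norml ltW.
  rewrite integral_indic// setIT [X in (X <= _)%E](lebesgue_measure_itv `[- dl, dl]) /= lte_fin.
  rewrite (_ : - dl < dl); last by lra.
  by rewrite -EFinD lee_fin; lra.
have lo : ((expR (- 4) * dl)%:E <= \int[mu]_s (h s)%:E)%E.
  apply: (@le_trans _ _ (\int[mu]_s ((expR (- 4))%:E * (\1_(`[- (dl / 2), dl / 2]%classic : set (measurableTypeR R)) s)%:E))%E).
    rewrite ge0_integralZl//; last by apply/measurable_EFinP; exact: measurable_indic.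
    rewrite integral_indic// setIT [X in (_ * X)%E](lebesgue_measure_itv `[- (dl / 2), dl / 2]) /= lte_fin.
    rewrite (_ : - (dl / 2) < dl / 2); last by lra.
    by rewrite -EFinD -EFinM lee_fin ler_wpM2l ?expR_ge0//; lra.
  apply: ge0_le_integral => //.
  - by apply: emeasurable_funM => //; apply/measurable_EFinP; exact: measurable_indic.
  - exact/measurable_EFinP.
  - move=> s _; rewrite -EFinM lee_fin indicE.
    have [|_] := boolP (s \in _); last by rewrite mulr0.
    rewrite inE /= in_itv/= -ler_norml => sd; rewrite mulr1.
    apply: raw_bump_lb; rewrite add0r normrM normfV (gtr0_norm dl0).
    by rewrite mulrC ler_pdivrMr// mulrC; lra.
pose J := fine (\int[mu]_s (h s)%:E)%E.
have Ifin : (\int[mu]_s (h s)%:E)%E = J%:E.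
  rewrite fineK// ge0_fin_numE; first exact: le_lt_trans up (ltry _).
  by apply: integral_ge0 => s _; rewrite lee_fin.
have J0 : 0 < J.
  by move: lo; rewrite Ifin lee_fin; apply: lt_le_trans; rewrite mulr_gt0// expR_gt0.
pose b (s : R) := J^-1 * h s.
have Cb k : Ck k b by apply: (@Ck_mul _ k (cst J^-1) h); [exact: Ck_cst|exact: Ch].
have b0 s : 0 <= b s by rewrite mulr_ge0// invr_ge0 ltW.
exists b; split => //; first by move=> s ds; rewrite /b hdl// mulr0.
move=> y; rewrite (integral_translation y (Ck_continuous (Cb 0%N)) b0).
under eq_integral do rewrite /b EFinM.
rewrite ge0_integralZl//.
- by rewrite Ifin -EFinM mulVf// gt_eqF.
- exact/measurable_EFinP.
- by move=> s _; rewrite lee_fin.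
- by rewrite lee_fin invr_ge0 ltW.
Qed.

Lemma bounded_compact_support g (dl : R) : continuous g ->
  (forall s, dl < `|s| -> g s = 0) -> exists M : R, forall s, `|g s| <= M.
Proof.
move=> cg g0.
have [d0|d0] := leP 0 dl; last first.
  exists 0 => s; rewrite g0 ?normr0//; exact: lt_le_trans d0 _.
have le : - dl <= dl by lra.
have cN : {within `[- dl, dl], continuous (fun s => `|g s|)}.
  apply: continuous_subspaceT => s.
  by apply: continuous_comp; [exact: cg|exact: norm_continuous].
have [c _ cP] := EVT_max le cN.
exists `|g c| => s; have [sd|sd] := leP `|s| dl.
  by apply: cP; rewrite in_itv/= -ler_norml.
by rewrite g0// normr0.
Qed.

Lemma derive1_support g (dl : R) : (forall s, dl < `|s| -> g s = 0) ->
  forall s, dl < `|s| -> derive1 g s = 0.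
Proof.
move=> g0 s ds; rewrite derive1E.
have d0 : is_derive s (1 : R) (cst 0 : R -> R) (0 : R) by exact: is_derive_cst.
suff [_ ->] : is_derive s (1 : R) g 0 by [].
apply: near_eq_is_derive d0.
have e0 : 0 < `|s| - dl by rewrite subr_gt0.
apply/nbhs_ballP; exists (`|s| - dl) => //= r; rewrite -ball_normE /= => sr.
rewrite g0//; have := ler_normD (s - r) r; rewrite subrK; lra.
Qed.

Lemma bump_bounded (b : R -> R) (dl : R) : (forall k, Ck k b) ->
  (forall s, dl <= `|s| -> b s = 0) -> exists2 M : R, 1 <= M &
  [/\ forall s, `|b s| <= M, forall s, `|derive1 b s| <= M,
      forall s, `|derive1 (derive1 b) s| <= M &
      forall s, `|derive1 (derive1 (derive1 b)) s| <= M].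
Proof.
move=> Cb b0.
have [_ [_ [_ c3]]] := Cb 3%N; have [_ [_ c2]] := Cb 2%N; have [_ c1] := Cb 1%N.
have c0 := Cb 0%N.
have s0 s : dl < `|s| -> b s = 0 by move=> /ltW; exact: b0.
have s1 := derive1_support s0; have s2 := derive1_support s1; have s3 := derive1_support s2.
have [M0 h0] := bounded_compact_support c0 s0.
have [M1 h1] := bounded_compact_support c1 s1.
have [M2 h2] := bounded_compact_support c2 s2.
have [M3 h3] := bounded_compact_support c3 s3.
have p0 := le_trans (normr_ge0 _) (h0 0); have p1 := le_trans (normr_ge0 _) (h1 0).
have p2 := le_trans (normr_ge0 _) (h2 0); have p3 := le_trans (normr_ge0 _) (h3 0).
exists (1 + M0 + M1 + M2 + M3); first by lra.
split=> s; [apply: le_trans (h0 s) _|apply: le_trans (h1 s) _|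
  apply: le_trans (h2 s) _|apply: le_trans (h3 s) _]; lra.
Qed.

(** The mean value theorem gains one power of [`|s|]; applied three times to a
    function with two vanishing derivatives at 0 it gives a cubic bound. *)
Lemma MVT_bound g g1 (K : R) (k : nat) : 0 <= K -> (forall s : R, is_derive s 1 g (g1 s)) ->
  g 0 = 0 -> (forall s, `|g1 s| <= K * (`|s| ^+ k * expR `|s|)) ->
  forall s, `|g s| <= K * (`|s| ^+ k.+1 * expR `|s|).
Proof.
move=> K0 dg g0 hg1 s.
have cg : continuous g by apply: derivable_continuous => r; case: (dg r).
have [c cs gE] : exists2 c, `|c| <= `|s| & g s = g1 c * s.
  have [s0|s0] := leP 0 s.
    have [|c cI E] := MVT_segment s0 (fun r _ => dg r).
      exact: continuous_subspaceT.
    exists c; last by rewrite -[LHS]subr0 -{1}g0 E subr0.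
    by move: cI; rewrite in_itv/= => /andP[c0 cs]; rewrite !ger0_norm.
  have [|c cI E] := MVT_segment (ltW s0) (fun r _ => dg r).
    exact: continuous_subspaceT.
  exists c; first by move: cI; rewrite in_itv/= => /andP[c0 cs]; rewrite !ler0_norm ?lerN2// ltW.
  by move: E; rewrite g0 sub0r sub0r mulrN => /eqP; rewrite eqr_opp => /eqP.
rewrite gE normrM exprS -mulrA [leRHS]mulrCA [leRHS]mulrC ler_wpM2r//.
apply: le_trans (hg1 c) _; rewrite ler_wpM2l// ler_pM ?exprn_ge0 ?expR_ge0 ?ler_expR//.
by rewrite lerXn2r// nnegrE.
Qed.

Lemma cosh_le (s : R) : `|(expR s + expR (- s)) / 2| <= expR `|s|.
Proof.
have [h1 h2] : expR s <= expR `|s| /\ expR (- s) <= expR `|s|.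
  by rewrite !ler_expR ler_norm -normrN ler_norm.
have := expR_gt0 s; have := expR_gt0 (- s) => *.
by rewrite ger0_norm; lra.
Qed.

Lemma sinh_le (s : R) : `|sinh s| <= expR `|s|.
Proof.
have [h1 h2] : expR s <= expR `|s| /\ expR (- s) <= expR `|s|.
  by rewrite !ler_expR ler_norm -normrN ler_norm.
have := expR_gt0 s; have := expR_gt0 (- s) => *.
by rewrite /sinh ler_norml; apply/andP; split; lra.
Qed.

Lemma is_derive_expN (s : R) : is_derive s 1 (fun s : R => expR (- s)) (- expR (- s)).
Proof.
have dN : is_derive s 1 (fun y : R => - y) (- 1) by exact: is_deriveNid.
have := @is_derive1_comp _ expR (fun y => - y) s _ _ (is_derive_expR (- s)) dN.
by rewrite mulrN1.
Qed.

Lemma is_derive_cosh (s : R) :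
  is_derive s 1 (fun s : R => (expR s + expR (- s)) / 2) (sinh s).
Proof.
have D := is_deriveZ (2^-1 : R) (is_deriveD (is_derive_expR s) (is_derive_expN s)).
have E : 2^-1 *: (expR s - expR (- s)) = sinh s by rewrite /sinh mulrC.
have := is_derive_eq D E.
by congr is_derive; apply/funext => r; rewrite /= mulrC.
Qed.

Lemma is_derive_sinh (s : R) : is_derive s 1 (@sinh R) ((expR s + expR (- s)) / 2).
Proof.
have D := is_deriveZ (2^-1 : R) (is_deriveB (is_derive_expR s) (is_derive_expN s)).
have E : 2^-1 *: (expR s - (- expR (- s))) = (expR s + expR (- s)) / 2 by rewrite opprK mulrC.
have := is_derive_eq D E.
by congr is_derive; apply/funext => r; rewrite /sinh mulrC.
Qed.

Lemma is_derive_cosh1 (s : R) : is_derive s 1 (@cosh1 R) (sinh s).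
Proof.
have D := is_deriveB (is_derive_cosh s) (is_derive_cst (1 : R) s 1).
exact: (is_derive_eq D (subr0 _)).
Qed.

Section expansion.
Variables (b : R -> R) (M : R).
Hypotheses (Cb : forall k, Ck k b) (M1 : 1 <= M).
Hypotheses (b1M : forall s, `|derive1 b s| <= M)
 (b2M : forall s, `|derive1 (derive1 b) s| <= M)
 (b3M : forall s, `|derive1 (derive1 (derive1 b)) s| <= M).

Lemma lipschitz_derive g : (forall x, derivable g x 1) -> (forall s, `|derive1 g s| <= M) ->
  forall a s : R, `|g (a - s) - g a| <= M * `|s|.
Proof.
move=> dg gM a s.
have cg : continuous g by exact: derivable_continuous.
have dg' (x : R) : is_derive x 1 g (derive1 g x) by apply: DeriveDef => //; rewrite derive1E.
have [s0|s0] := leP 0 s.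
  have h : a - s <= a by lra.
  have [|c _ E] := MVT_segment h (fun r _ => dg' r).
    exact: continuous_subspaceT.
  rewrite distrC E normrM ler_pM// (_ : a - (a - s) = s)//; lra.
have h : a <= a - s by lra.
have [|c _ E] := MVT_segment h (fun r _ => dg' r).
  exact: continuous_subspaceT.
by rewrite E normrM ler_pM// (_ : a - s - a = - s) ?normrN//; lra.
Qed.

Let dcomp g (a s : R) : (forall x, derivable g x 1) ->
  is_derive s 1 (fun s => g (a - s)) (- derive1 g (a - s)).
Proof.
move=> dg; have := @is_derive_affine R g a (- 1) s.
rewrite mulN1r => /(_ (dg _)).
rewrite mulN1r; congr is_derive; apply/funext => r; by rewrite mulN1r.
Qed.

(** The left-hand side, as a function of [s], vanishes at 0 with its first two
    derivatives, and its third derivative is at most [3 M e^{`|s|}]. *)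
Lemma bump_expansion (a s : R) :
  `|b (a - s) - b a + sinh s * derive1 b a - cosh1 s * derive1 (derive1 b) a|
  <= 3 * M * (`|s| ^+ 3 * expR `|s|).
Proof.
have [d0 [d1 [d2 _]]] := Cb 3%N.
pose B1 : R -> R := derive1 b; pose B2 : R -> R := derive1 B1.
pose B3 : R -> R := derive1 B2.
pose ch (s : R) : R := (expR s + expR (- s)) / 2.
pose G0 (s : R) : R := b (a - s) - b a + (B1 a * sinh s) - (B2 a * cosh1 s).
pose G1 (s : R) : R := - B1 (a - s) + B1 a * ch s - B2 a * sinh s.
pose G2 (s : R) : R := B2 (a - s) + B1 a * sinh s - B2 a * ch s.
pose G3 (s : R) : R := - B3 (a - s) + B1 a * ch s - B2 a * sinh s.
have dB (g : R -> R) (l c s0 : R) : is_derive s0 1 g l ->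
    is_derive s0 1 (fun r => c * g r) (c * l).
  by move=> dg; exact: is_deriveZ.
have D2 (s0 : R) : is_derive s0 1 G2 (G3 s0).
  exact: (is_deriveB (is_deriveD (dcomp a s0 d2) (dB _ _ _ _ (is_derive_sinh s0))) (dB _ _ _ _ (is_derive_cosh s0))).
have D1 (s0 : R) : is_derive s0 1 G1 (G2 s0).
  have D := is_deriveB (is_deriveD (is_deriveN (dcomp a s0 d1)) (dB _ _ (B1 a) _ (is_derive_cosh s0))) (dB _ _ (B2 a) _ (is_derive_sinh s0)).
  have E : - (- B2 (a - s0)) + B1 a * sinh s0 - B2 a * ch s0 = G2 s0 by rewrite opprK.
  exact: (is_derive_eq D E).
have D0 (s0 : R) : is_derive s0 1 G0 (G1 s0).
  have D := is_deriveB (is_deriveD (is_deriveB (dcomp a s0 d0) (is_derive_cst (b a) s0 1)) (dB _ _ (B1 a) _ (is_derive_sinh s0))) (dB _ _ (B2 a) _ (is_derive_cosh1 s0)).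
  have E : - B1 (a - s0) - 0 + B1 a * ch s0 - B2 a * sinh s0 = G1 s0 by rewrite subr0.
  exact: (is_derive_eq D E).
have sh0 : sinh (0 : R) = 0 by rewrite /sinh oppr0 subrr mul0r.
have ch0 : ch 0 = 1 by rewrite /ch oppr0 expR0; field.
have c10 : cosh1 (0 : R) = 0 by rewrite /cosh1 -/(ch 0) ch0 subrr.
have M0 : 0 <= 3 * M by rewrite mulr_ge0// (le_trans ler01 M1).
have h3 (s0 : R) : `|G3 s0| <= 3 * M * (`|s0| ^+ 0 * expR `|s0|).
  rewrite expr0 mul1r /G3 (le_trans (ler_normB _ _))// (le_trans (lerD (ler_normD _ _) (lexx _)))//.
  have k1 : `|- B3 (a - s0)| <= M * expR `|s0|.
    rewrite normrN (le_trans (b3M _))// ler_peMr ?(le_trans ler01 M1)//.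
    by rewrite -[leLHS]expR0 ler_expR.
  have k2 : `|B1 a * ch s0| <= M * expR `|s0| by rewrite normrM ler_pM// cosh_le.
  have k3 : `|B2 a * sinh s0| <= M * expR `|s0| by rewrite normrM ler_pM// sinh_le.
  lra.
have h2 := MVT_bound M0 D2 _ h3.
have h1 := MVT_bound M0 D1 _ (h2 _).
have h0 := MVT_bound M0 D0 _ (h1 _ _).
have -> : b (a - s) - b a + sinh s * derive1 b a - cosh1 s * derive1 (derive1 b) a = G0 s.
  by rewrite /G0 -/B1 -/B2 (mulrC (sinh s)) (mulrC (cosh1 s)).
apply: h0; rewrite ?/G0 ?/G1 ?/G2 ?subr0 ?sh0 ?ch0 ?c10; ring.
Qed.

End expansion.
End normalized_bump.

(** * Product test functions *)

Section compact_box.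
Variables (R : realType) (n : nat) (rho : R).

Lemma compact_cube : compact [set y : 'rV[R]_n | `|y| <= rho].
Proof.
have [r0|r0] := leP 0 rho; last first.
  rewrite (_ : [set y | _] = set0); first exact: compact0.
  by apply/seteqP; split => // y /=; rewrite leNgt (lt_le_trans r0).
rewrite (_ : [set y | _] = [set y : 'rV[R]_n | forall i, (`[- rho, rho]%classic : set R) (y ord0 i)]).
  by apply: (@rV_compact R n (fun=> `[- rho, rho]%classic)) => i; exact: segment_compact.
apply/seteqP; split=> y /= h; last first.
  by apply: norm_le_coord => // i; have := h i; rewrite in_itv/= ler_norml.
by move=> i; rewrite in_itv/= -ler_norml (le_trans (coord_le_norm y i)).
Qed.

Lemma continuous_cube_bounded (g : 'rV[R]_n -> R) : continuous g ->
  exists2 M : R, 0 <= M & forall y, `|y| <= rho -> `|g y| <= M.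
Proof.
move=> cg; have [[y0 hy0]|ne] := pselect ([set y : 'rV[R]_n | `|y| <= rho] !=set0); last first.
  by exists 0 => // y hy; exfalso; apply: ne; exists y.
have [|c _ cP] := @EVT_max_rV R n (fun y => `|g y|) _ (ex_intro _ y0 hy0) compact_cube.
  apply: continuous_subspaceT => y.
  by apply: continuous_comp; [exact: cg|exact: norm_continuous].
by exists `|g c| => // y hy; apply: cP; rewrite inE.
Qed.

Lemma cube_unif_continuous (g : 'rV[R]_n -> R) (e : R) : continuous g -> 0 < e ->
  exists2 dl : R, 0 < dl & forall y z, `|y| <= rho -> `|z| <= rho -> `|y - z| < dl ->
    `|g y - g z| < e.
Proof.
move=> cg e0; apply: contrapT => hn.
have yP (k : nat) : exists yz : 'rV[R]_n * 'rV[R]_n,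
    [/\ `|yz.1| <= rho, `|yz.2| <= rho, `|yz.1 - yz.2| < k.+1%:R^-1 & e <= `|g yz.1 - g yz.2|].
  apply: contrapT => h; apply: hn; exists k.+1%:R^-1 => // y z hy hz yz.
  rewrite ltNge; apply/negP => ge; apply: h; exists (y, z); split=> //.
pose s k := projT1 (cid (yP k)).
have sP k : [/\ `|(s k).1| <= rho, `|(s k).2| <= rho,
    `|(s k).1 - (s k).2| < k.+1%:R^-1 & e <= `|g (s k).1 - g (s k).2|].
  exact: projT2 (cid (yP k)).
pose F : set_system 'rV[R]_n := (fun k => (s k).1) @ \oo.
have [|p [_ pc]] := @compact_cube F.
  by exists 0%N => // k _ /=; case: (sP k).
have e20 : 0 < e / 2 by rewrite divr_gt0.
have /(@cvgrPdist_lt R R^o 'rV[R]_n (nbhs p) _ g (g p)) /(_ _ e20) /nbhs_ballP[r /= r0 rP] := cg p.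
have r20 : 0 < r / 2 by rewrite divr_gt0.
have [m mP] := ltr_add_invr r20; rewrite add0r in mP.
have F1 : F [set (s k).1 | k in [set k | (m <= k)%N]].
  by exists m => // k mk; exists k.
have [_ [[k /= mk <-]]] := pc _ (ball p (r / 2)) F1 (nbhsx_ballx p _ r20).
rewrite -ball_normE /= => pk.
have [_ _ h1 h2] := sP k.
have km : k.+1%:R^-1 <= m.+1%:R^-1 :> R by rewrite lef_pV2 ?posrE ?ltr0n// ler_nat.
have h3 : `|p - (s k).2| < r.
  have := ler_normD (p - (s k).1) ((s k).1 - (s k).2); rewrite subrKA => h.
  move: (k.+1%:R^-1 : R) (m.+1%:R^-1 : R) mP km h1 => a c *; lra.
have h4 : `|g p - g (s k).1| < e / 2.
  by apply: rP; rewrite -ball_normE /=; lra.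
have h5 : `|g p - g (s k).2| < e / 2 by apply: rP; rewrite -ball_normE /=.
have := ler_normD (g (s k).1 - g p) (g p - g (s k).2); rewrite subrKA.
rewrite distrC in h4; lra.
Qed.

End compact_box.

Section coord_lipschitz.
Variables (R : realType) (n : nat) (g : 'rV[R]_n -> R) (C : R).
Hypotheses (C0 : 0 <= C)
  (gC : forall y l s, `|g (y + s *: delta_mx ord0 l) - g y| <= C * `|s|).

Lemma coord_lipschitz_continuous : continuous g.
Proof.
apply: (@lipschitz_continuous _ _ _ (C * n%:R)) => y z.
have E : partial_move z (fun i => (y - z) ord0 i) n = y.
  by apply/rowP => i; rewrite mxE ltn_ord !mxE subrKC.
have := partial_move_lipschitz C0 gC z (fun i => (y - z) ord0 i) (leqnn n).
rewrite E => /le_trans; apply; rewrite -mulrA ler_wpM2l//.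
rewrite mulrC mulr_natr -[X in _ *+ X](card_ord n) -sumr_const ler_sum// => i _.
exact: coord_le_norm.
Qed.

End coord_lipschitz.

Section product_functions.
Variables (R : realType) (n : nat).
Implicit Types (be : 'I_n -> R -> R) (x y t : 'rV[R]_n).

Definition prod_fun be y t : R := \prod_(l < n) be l (t ord0 l - y ord0 l).

(** Differentiating a product function replaces one of its factors, so the
    derivatives of all orders stay in the family. *)
Definition update be (i : 'I_n) (g : R -> R) : 'I_n -> R -> R :=
  fun l => if l == i then g else be l.

Lemma prod_fun_update be i g y t :
  prod_fun (update be i g) y t =
  g (t ord0 i - y ord0 i) * \prod_(l < n | l != i) be l (t ord0 l - y ord0 l).
Proof.
rewrite /prod_fun (bigD1 i)//= /update eqxx; congr (_ * _).
by apply: eq_bigr => l /negbTE ->.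
Qed.

Lemma prod_fun_split be i y t :
  prod_fun be y t =
  be i (t ord0 i - y ord0 i) * \prod_(l < n | l != i) be l (t ord0 l - y ord0 l).
Proof. by rewrite /prod_fun (bigD1 i). Qed.

Lemma prod_fun_shift be i y t (s : R) :
  prod_fun be (y + s *: delta_mx ord0 i) t =
  be i (t ord0 i - y ord0 i - s) * \prod_(l < n | l != i) be l (t ord0 l - y ord0 l).
Proof.
rewrite (prod_fun_split _ i); congr (_ * _).
  by rewrite !mxE !eqxx mulr1 opprD addrA.
by apply: eq_bigr => l li; rewrite !mxE eqxx (negbTE li) mulr0 addr0.
Qed.

Lemma prod_fun_continuous be y : (forall l, continuous (be l)) -> continuous (prod_fun be y).
Proof.
move=> cb; rewrite /prod_fun.
have : forall s : seq 'I_n, continuous (fun t : 'rV[R]_n => \prod_(l <- s) be l (t ord0 l - y ord0 l)).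
  elim=> [|a s IH] t.
    under eq_fun do rewrite big_nil; exact: cst_continuous.
  under eq_fun do rewrite big_cons.
  have c1 : continuous (fun t : 'rV[R]_n => be a (t ord0 a - y ord0 a)).
    move=> t'; apply: (@continuous_comp _ _ _ (fun t : 'rV[R]_n => t ord0 a - y ord0 a) (be a)).
      by apply: continuousB; [exact: coord_continuous|exact: cst_continuous].
    exact: cb.
  exact: (@continuousM R 'rV[R]_n _ _ t (c1 t) (IH t)).
exact.
Qed.

Lemma pderiv_prod_fun be y i : (forall r : R, derivable (be i) r 1) ->
  (forall t, derivable (prod_fun be y) t (delta_mx ord0 i)) /\
  pderiv i (prod_fun be y) = prod_fun (update be i (derive1 (be i))) y.
Proof.
move=> dbe.
have line t (h : R) : prod_fun be y (h *: delta_mx ord0 i + t) =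
    be i (h + (t ord0 i - y ord0 i)) * \prod_(l < n | l != i) be l (t ord0 l - y ord0 l).
  rewrite (prod_fun_split _ i); congr (_ * _).
    by rewrite !mxE !eqxx mulr1 addrA.
  by apply: eq_bigr => l li; rewrite !mxE eqxx (negbTE li) mulr0 add0r.
have lim t : (fun h : R => h^-1 *: ((prod_fun be y \o shift t) (h *: delta_mx ord0 i) - prod_fun be y t)) @ 0^'
    --> prod_fun (update be i (derive1 (be i))) y t.
  set c := \prod_(l < n | l != i) be l (t ord0 l - y ord0 l).
  set a := t ord0 i - y ord0 i.
  have -> : (fun h : R => h^-1 *: ((prod_fun be y \o shift t) (h *: delta_mx ord0 i) - prod_fun be y t)) =
      (fun h : R => (h^-1 *: ((be i \o shift a) (h *: 1) - be i a)) * c).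
    apply/funext => h /=; rewrite line (prod_fun_split be i y t) -/c -/a.
    by rewrite [h *: 1]mulr1 -mulrBl /GRing.scale/= mulrA.
  rewrite prod_fun_update -/c -/a.
  apply: cvgM; last exact: cvg_cst.
  have := dbe a; rewrite derive1E; exact.
split; first by move=> t; apply/cvg_ex; exists (prod_fun (update be i (derive1 (be i))) y t).
by apply/funext => t; rewrite /pderiv /derive; apply: cvg_lim.
Qed.

Lemma smooth_prod_fun be y : (forall l k, Ck k (be l)) -> smooth (prod_fun be y).
Proof.
move=> Cbe s.
have [be' Cbe' ->] : exists2 be', (forall l k, Ck k (be' l)) &
    foldr (@pderiv R n) (prod_fun be y) s = prod_fun be' y.
  elim: s => [|i s [be' Cbe' IH]]; first by exists be.
  exists (update be' i (derive1 (be' i))).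
    move=> l k; rewrite /update; case: eqP => // _.
    by have [_] := Cbe' i k.+1.
  rewrite /= IH; apply: (pderiv_prod_fun y _).2.
  by move=> r; exact: (Cbe' i 1%N).1.
split; first by apply: prod_fun_continuous => l; exact: (Ck_continuous (Cbe' l 0%N)).
by move=> x i; apply: (pderiv_prod_fun y _).1 => r; exact: (Cbe' i 1%N).1.
Qed.

Lemma test_prod_fun be y (dl : R) : (forall l k, Ck k (be l)) ->
  (forall l s, dl <= `|s| -> be l s = 0) -> test_function (prod_fun be y).
Proof.
move=> Cbe be0; split; first exact: smooth_prod_fun.
exists [set t : 'rV[R]_n | forall i, (`[y ord0 i - dl, y ord0 i + dl]%classic : set R) (t ord0 i)].
  by apply: (@rV_compact R n (fun i => `[y ord0 i - dl, y ord0 i + dl]%classic)) => i; exact: segment_compact.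
move=> t /= nt.
have [i hi] : exists i, ~ (t ord0 i \in `[y ord0 i - dl, y ord0 i + dl]).
  apply: contrapT => h; apply: nt => i; apply: contrapT => h'; apply: h; exists i => //.
rewrite (prod_fun_split _ i) be0 ?mul0r// leNgt; apply/negP; rewrite ltr_norml => /andP[h1 h2].
by apply: hi; rewrite in_itv/=; apply/andP; split; lra.
Qed.

Lemma laplacian_prod_fun be y : (forall l k, Ck k (be l)) ->
  laplacian (prod_fun be y) =
  (fun t => \sum_(i < n) prod_fun (update be i (derive1 (derive1 (be i)))) y t).
Proof.
move=> Cbe; apply/funext => t; apply: eq_bigr => i _.
have d0 (r : R) : derivable (be i) r 1 by have [] := Cbe i 1%N.
have d1 (r : R) : derivable (derive1 (be i)) r 1 by have [_ []] := Cbe i 2%N.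
rewrite (pderiv_prod_fun y d0).2.
have d1' (r : R) : derivable (update be i (derive1 (be i)) i) r 1 by rewrite /update eqxx.
rewrite (pderiv_prod_fun y d1').2 !prod_fun_update /update eqxx; congr (_ * _).
by apply: eq_bigr => l /negbTE ->.
Qed.

Lemma prod_fun_bounded be y t (M : R) : 1 <= M -> (forall l s, `|be l s| <= M) ->
  `|prod_fun be y t| <= M ^+ n.
Proof.
move=> M1 beM; rewrite /prod_fun normr_prod -[n in leRHS]card_ord -prodr_const.
by apply: ler_prod => l _; rewrite normr_ge0 beM.
Qed.

Lemma prod_others_bounded be y t i (M : R) : 1 <= M -> (forall l s, `|be l s| <= M) ->
  `|\prod_(l < n | l != i) be l (t ord0 l - y ord0 l)| <= M ^+ n.
Proof.
move=> M1 beM.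
have := @prod_fun_bounded (update be i (cst 1)) y t M M1.
rewrite prod_fun_update mul1r; apply => l s; rewrite /update; case: eqP => // _.
by rewrite normr1.
Qed.

End product_functions.

(** * Mollification of weak solutions *)

(** [fine] sends both infinities to 0, so the sign comes out even if the integral
    diverges. *)
Lemma Rintegral_oppr d (T : measurableType d) (R : realType)
    (mu : {measure set T -> \bar R}) (f : T -> R) :
  \int[mu]_t (- f t) = - \int[mu]_t f t.
Proof.
rewrite /Rintegral (integralE _ _ (fun t => (f t)%:E)) (integralE _ _ (fun t => (- f t)%:E)).
have -> : (fun t => (- f t)%:E) = (\- (fun t => (f t)%:E))%E by apply/funext => t; rewrite EFinN.
rewrite funeposN funenegN.
set a := (\int[mu]_(x in _) (_^\+)%E x)%E; set b := (\int[mu]_(x in _) (_^\-)%E x)%E.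
have a0 : (0 <= a)%E by apply: integral_ge0 => t _; exact: funepos_ge0.
have b0 : (0 <= b)%E by apply: integral_ge0 => t _; exact: funeneg_ge0.
move: a b a0 b0 => [a| |] [b| |] //= _ _; rewrite ?oppr0//.
by rewrite opprB.
Qed.

Section mollifier.
Variables (R : realType) (n : nat) (rr : R) (u : 'rV[R]_n -> R).
Hypotheses (rr0 : 0 <= rr) (cu : continuous u).
Local Notation mu := (lebesgue_n R n).
Let K : set (n.-tuple (measurableTypeR R)) := box (fun=> - rr) (fun=> rr).

Let KE t : K t <-> `|tuple_row t| <= rr.
Proof.
split=> [Kt|h i].
  by apply: norm_le_coord => // i; rewrite mxE ler_norml; exact: Kt.
by have := le_trans (coord_le_norm (tuple_row t) i) h; rewrite mxE ler_norml.
Qed.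

Let mK : measurable K. Proof. exact: measurable_box. Qed.

Let muK : (mu K < +oo)%E.
Proof. by rewrite [X in (X < _)%E]lebesgue_box ?ltry// => i; move: rr0; lra. Qed.

(** The test functions centred in the region all vanish outside one cube.
    Over that cube every continuous integrand is integrable. *)
Definition cube_integral (g : 'rV[R]_n -> R) : R := \int[mu]_(t in K) g (tuple_row t).

Lemma cube_integrable (g : 'rV[R]_n -> R) : continuous g ->
  mu.-integrable K (EFin \o (fun t => g (tuple_row t))).
Proof.
move=> cg; have [M M0 gM] := continuous_cube_bounded rr cg.
apply: (@le_integrable _ _ _ mu K mK _ (EFin \o cst M)).
- by apply/measurable_EFinP; apply: measurable_funTS; exact: measurable_tuple_row.
- by move=> t /KE Kt /=; rewrite lee_fin (ger0_norm M0) gM.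
- by apply/integrableP; split; [exact/measurable_EFinP|];
    rewrite /= integral_cst// lte_mul_pinfty// ?lee_fin// .
Qed.

Lemma cube_integral_le (g h : 'rV[R]_n -> R) : continuous g -> continuous h ->
  (forall t, `|t| <= rr -> g t <= h t) -> cube_integral g <= cube_integral h.
Proof.
move=> cg ch gh; apply: le_Rintegral => //; [exact: cube_integrable|exact: cube_integrable|].
by move=> t /KE; exact: gh.
Qed.

Lemma cube_integral_cst (c : R) : cube_integral (cst c) = c * fine (mu K).
Proof. exact: Rintegral_cst. Qed.

Lemma cube_integral_norm_le (g : 'rV[R]_n -> R) (c : R) : continuous g ->
  (forall t, `|t| <= rr -> `|g t| <= c) -> `|cube_integral g| <= c * fine (mu K).
Proof.
move=> cg gc; rewrite ler_norml; apply/andP; split.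
  rewrite -mulNr -cube_integral_cst; apply: cube_integral_le => //; first exact: cst_continuous.
  by move=> t /gc; rewrite ler_norml => /andP[].
rewrite -cube_integral_cst; apply: cube_integral_le => //; first exact: cst_continuous.
by move=> t /gc; rewrite ler_norml => /andP[].
Qed.

Lemma cube_integralD (g h : 'rV[R]_n -> R) : continuous g -> continuous h ->
  cube_integral (fun t => g t + h t) = cube_integral g + cube_integral h.
Proof.
by move=> cg ch; rewrite /cube_integral RintegralD//; exact: cube_integrable.
Qed.

Lemma cube_integralZ (c : R) (g : 'rV[R]_n -> R) : continuous g ->
  cube_integral (fun t => c * g t) = c * cube_integral g.
Proof.
by move=> cg; rewrite /cube_integral RintegralZl//; exact: cube_integrable.
Qed.

Lemma cube_integralB (g h : 'rV[R]_n -> R) : continuous g -> continuous h ->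
  cube_integral (fun t => g t - h t) = cube_integral g - cube_integral h.
Proof.
by move=> cg ch; rewrite /cube_integral RintegralB//; exact: cube_integrable.
Qed.

Lemma cube_integral_sum (I : Type) (s : seq I) (g : I -> 'rV[R]_n -> R) :
  (forall i, continuous (g i)) ->
  continuous (fun t => \sum_(i <- s) g i t) /\
  cube_integral (fun t => \sum_(i <- s) g i t) = \sum_(i <- s) cube_integral (g i).
Proof.
move=> cg; elim: s => [|a s [cs IH]].
  under eq_fun do rewrite big_nil.
  by split; [exact: cst_continuous|rewrite big_nil cube_integral_cst mul0r].
under eq_fun do rewrite big_cons.
split; last by rewrite cube_integralD// IH big_cons.
by move=> t; apply: (@continuousD R R^o 'rV[R]_n _ _ t (cg a t) (cs t)).
Qed.

Lemma cube_integralT (g : 'rV[R]_n -> R) : (forall t, rr < `|t| -> g t = 0) ->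
  \int[mu]_t g (tuple_row t) = cube_integral g.
Proof.
move=> g0; rewrite /cube_integral [RHS]Rintegral_mkcond; congr Rintegral; apply/funext => t.
rewrite patchE; case: ifPn => // tK; apply: g0.
by rewrite ltNge; apply: contra tK => h; rewrite inE; exact/KE.
Qed.


Local Notation C0 be := (forall l : 'I_n, continuous (be l : R -> R)).

Let c_u_mul (g : 'rV[R]_n -> R) : continuous g -> continuous (fun t => u t * g t).
Proof. by move=> cg t; have := @continuousM R 'rV[R]_n u g t (@cu t) (cg t); apply. Qed.

(** A convolution with a product of kernels when [u] is cut off outside the cube;
    taking other factors in the product gives its derivatives up to sign. *)
Definition conv (be : 'I_n -> R -> R) (y : 'rV[R]_n) : R :=
  cube_integral (fun t => u t * prod_fun be y t).

Variables (Smax : R).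
Hypothesis uS : forall t, `|t| <= rr -> `|u t| <= Smax.

Let Smax0 : 0 <= Smax.
Proof. by apply: le_trans (uS (_ : `|0| <= rr)); rewrite ?normr0. Qed.

Let cube_integral_u_le (g : 'rV[R]_n -> R) (c : R) : continuous g ->
  (forall t, `|g t| <= c) -> `|cube_integral (fun t => u t * g t)| <= Smax * c * fine (mu K).
Proof.
move=> cg gc; apply: cube_integral_norm_le; first exact: c_u_mul.
by move=> t tr; rewrite normrM ler_pM// uS.
Qed.

Lemma conv_bounded be (M : R) : C0 be -> 1 <= M -> (forall l s, `|be l s| <= M) ->
  forall y, `|conv be y| <= Smax * M ^+ n * fine (mu K).
Proof.
move=> cb M1 bM y; apply: cube_integral_u_le; first exact: prod_fun_continuous.
by move=> t; exact: prod_fun_bounded.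
Qed.

Lemma conv_lipschitz be (M : R) : C0 be -> 1 <= M -> (forall l s, `|be l s| <= M) ->
  (forall l (a s : R), `|be l (a - s) - be l a| <= M * `|s|) ->
  forall y l s, `|conv be (y + s *: delta_mx ord0 l) - conv be y| <=
    Smax * (M * M ^+ n) * fine (mu K) * `|s|.
Proof.
move=> cb M1 bM bL y l s.
have cp z : continuous (prod_fun be z) by exact: prod_fun_continuous.
rewrite -cube_integralB; [|exact: c_u_mul|exact: c_u_mul].
under eq_fun do rewrite -mulrBr.
rewrite (_ : _ * `|s| = Smax * (M * M ^+ n * `|s|) * fine (mu K)); last by ring.
apply: cube_integral_u_le => [t|t].
  by have := @continuousB R R^o 'rV[R]_n _ _ t (cp (y + s *: delta_mx ord0 l) t) (cp y t); apply.
rewrite prod_fun_shift (prod_fun_split _ l) -mulrBl normrM.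
rewrite (_ : _ * `|s| = M * `|s| * M ^+ n); last by ring.
by apply: ler_pM => //; exact: prod_others_bounded.
Qed.

Lemma conv_continuous be (M : R) : C0 be -> 1 <= M -> (forall l s, `|be l s| <= M) ->
  (forall l (a s : R), `|be l (a - s) - be l a| <= M * `|s|) -> continuous (conv be).
Proof.
move=> cb M1 bM bL; have M0 : 0 <= M := le_trans ler01 M1.
apply: (@coord_lipschitz_continuous _ _ _ (Smax * (M * M ^+ n) * fine (mu K))).
  by rewrite !mulr_ge0 ?exprn_ge0 ?fine_ge0.
by move=> y l s; exact: conv_lipschitz.
Qed.

End mollifier.

Lemma prod_fun_eq0 (R : realType) (n : nat) (be : 'I_n -> R -> R) (y t : 'rV[R]_n) (dl : R) :
  0 < dl -> (forall l s, dl <= `|s| -> be l s = 0) -> dl <= `|t - y| -> prod_fun be y t = 0.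
Proof.
move=> dl0 be0 h; have [i hi] : exists i, dl <= `|(t - y) ord0 i|.
  apply: contrapT => hn; move: h; rewrite leNgt => /negP; apply.
  by apply: norm_lt_coord => // i; rewrite ltNge; apply/negP => hi; apply: hn; exists i.
by rewrite (prod_fun_split _ i) be0 ?mul0r//; move: hi; rewrite !mxE.
Qed.

Section unit_mass.
Variables (R : realType) (n : nat) (b : R -> R).
Hypotheses (cb : continuous b) (b0 : forall s, 0 <= b s)
  (b1 : forall y, (\int[lebesgue_measure]_s (b (s - y))%:E = 1)%E).
Let be : 'I_n -> R -> R := fun=> b.

Lemma prod_fun_ge0 y t : 0 <= prod_fun be y t.
Proof. by apply: prodr_ge0 => l _; exact: b0. Qed.

Let cphi y : continuous (prod_fun be y).
Proof. by apply: prod_fun_continuous. Qed.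

Lemma prod_fun_mass y :
  (\int[lebesgue_n R n]_t (prod_fun be y (tuple_row t))%:E = 1)%E.
Proof.
transitivity (\int[lebesgue_n R n]_t
    (\prod_(i < n) (fun i s => (b (s - y ord0 i))%:E) i (tnth t i)))%E.
  by apply: eq_integral => t _; rewrite prodEFin; congr EFin;
    apply: eq_bigr => i _; rewrite mxE.
rewrite (ge0_integral_lebesgue_prod (g := fun i s => (b (s - y ord0 i))%:E)).
- by rewrite big1// => i _; exact: b1.
- move=> i; apply/measurable_EFinP; apply: continuous_measurable_fun => s.
  apply: (@continuous_comp _ _ _ (fun s : R => s - y ord0 i) b); last exact: cb.
  by apply: continuousB; [exact: cvg_id|exact: cst_continuous].
- by move=> i s; rewrite lee_fin.
Qed.

Lemma cube_mass_le rr y : cube_integral rr (prod_fun be y) <= 1.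
Proof.
rewrite /cube_integral /Rintegral -lee_fin.
set X := (X in fine X); have h : (X <= 1)%E.
  rewrite -(prod_fun_mass y); apply: ge0_subset_integral => //.
  - exact: measurable_box.
  - by apply/measurable_EFinP; exact: measurable_tuple_row.
  - by move=> t _; rewrite lee_fin prod_fun_ge0.
rewrite fineK//; rewrite ge0_fin_numE; first exact: le_lt_trans h (ltry _).
by apply: integral_ge0 => t _; rewrite lee_fin prod_fun_ge0.
Qed.

End unit_mass.

Section subharmonic_mollification.
Variables (R : realType) (n : nat) (V u q : 'rV[R]_n -> R) (lambda rho Smax : R).
Hypotheses (cV : continuous V) (cu : continuous u) (cq : continuous q).
Hypothesis weak : forall phi, test_function phi ->
  \int[lebesgue_n R n]_t
    (let x := tuple_row t in u x * (- 2^-1 * laplacian phi x + V x * phi x)) =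
  lambda * \int[lebesgue_n R n]_t (u (tuple_row t) * phi (tuple_row t)).
Hypotheses (rho0 : 0 <= rho) (q_rho : forall y, 0 < q y -> `|y| <= rho)
  (qV : forall y, 0 < q y -> lambda < V y /\ 0 <= u y)
  (uS : forall t, `|t| <= rho + 1 -> `|u t| <= Smax).
Local Notation rr := (rho + 1).
Let rr0 : 0 <= rr. Proof. by rewrite addr_ge0. Qed.

Let mul_cont (g h : 'rV[R]_n -> R) : continuous g -> continuous h ->
  continuous (fun t => g t * h t).
Proof. by move=> cg ch t; have := @continuousM R 'rV[R]_n g h t (cg t) (ch t); apply. Qed.

(** The approximation is [u] convolved with a product bump [phi] so narrow that the
    support of [phi] centred at a point of [theta < q] stays in [0 < q]. Testing
    the weak equation against [phi] turns the sum of the second-order coefficients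
    into twice the integral of [(V - lambda) u phi], which is nonnegative there. *)
Lemma subharmonic_approx_exists (theta eta : R) : 0 < theta -> 0 < eta ->
  exists f, subharmonic_approx q u rho Smax eta theta f.
Proof.
move=> th0 et0.
have [dq dq0 dqP] := cube_unif_continuous rr cq th0.
have [du du0 duP] := cube_unif_continuous rr cu et0.
(* The bump has radius [dl / 2] so that its derivatives vanish at distance [dl] too. *)
pose dl := Num.min 1 (Num.min dq du).
have dl0 : 0 < dl by rewrite !lt_min ltr01 dq0.
have [dl1 dldq dldu] : [/\ dl <= 1, dl <= dq & dl <= du].
  by split; rewrite !ge_min lexx ?orbT.
have dl20 : 0 < dl / 2 by rewrite divr_gt0.
have [b [Cb b0 bsupp b1]] := bump_exists dl20.
have [M M1 [bM b1M b2M b3M]] := bump_bounded Cb bsupp.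
have M0 : 0 <= M := le_trans ler01 M1.
pose b' : R -> R := derive1 b; pose b'' : R -> R := derive1 b'.
have cb : continuous b := Cb 0%N.
have [d0 [d1 [d2 _]]] := Cb 3%N.
have cb' : continuous b' by exact: (Cb 1%N).2.
have cb'' : continuous b'' by exact: (Cb 2%N).2.2.
pose be : 'I_n -> R -> R := fun=> b.
pose be1 i := update be i b'; pose be2 i := update be i b''.
have Cbe (l : 'I_n) k : Ck k (be l) by exact: Cb.
have upd (Q : (R -> R) -> Prop) i g : Q b -> Q g -> forall l, Q (update be i g l).
  by move=> Qb Qg l; rewrite /update; case: eqP.
have b'M : forall s, `|b' s| <= M by exact: b1M.
have b''M : forall s, `|b'' s| <= M by exact: b2M.
pose bdd (g : R -> R) := forall s, `|g s| <= M.
pose lip (g : R -> R) := forall a s : R, `|g (a - s) - g a| <= M * `|s|.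
pose cnt (g : R -> R) := continuous g.
have Lb : lip b := lipschitz_derive d0 b1M.
have Lb' : lip b' := lipschitz_derive d1 b2M.
have Lb'' : lip b'' := lipschitz_derive d2 b3M.
have c1 i : forall l, continuous (be1 i l : R -> R) := upd cnt i b' cb cb'.
have c2 i : forall l, continuous (be2 i l : R -> R) := upd cnt i b'' cb cb''.
have M1' i : forall l s, `|be1 i l s| <= M := upd bdd i b' bM b'M.
have M2' i : forall l s, `|be2 i l s| <= M := upd bdd i b'' bM b''M.
have L1 i : forall l (a s : R), `|be1 i l (a - s) - be1 i l a| <= M * `|s| := upd lip i b' Lb Lb'.
have L2 i : forall l (a s : R), `|be2 i l (a - s) - be2 i l a| <= M * `|s| := upd lip i b'' Lb Lb''.
have s0 s : dl / 2 < `|s| -> b s = 0 by move=> /ltW; exact: bsupp.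
have s1 := derive1_support s0; have s2 := derive1_support s1.
have dls (s : R) : dl <= `|s| -> dl / 2 < `|s| by lra.
have Z0 (l : 'I_n) s : dl <= `|s| -> be l s = 0 by move=> /dls; exact: s0.
have Z2 i l s : dl <= `|s| -> be2 i l s = 0.
  by move=> /dls h; rewrite /be2 /update; case: eqP => _; [exact: s2|exact: s0].
have Smax0 : 0 <= Smax by apply: le_trans (uS (_ : `|0| <= rr)); rewrite ?normr0.
pose L := fine (lebesgue_n R n (box (fun=> - rr) (fun=> rr))).
have L0 : 0 <= L by rewrite fine_ge0.
have cphi be' y : (forall l, continuous (be' l : R -> R)) -> continuous (prod_fun be' y).
  by move=> c; exact: prod_fun_continuous.
have cphi0 y : continuous (prod_fun be y) by exact: cphi.
have cphi1 i y : continuous (prod_fun (be1 i) y) by exact: cphi.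
have cphi2 i y : continuous (prod_fun (be2 i) y) by exact: cphi.
pose C := Smax * (3 * M * M ^+ n) * L.
have C0 : 0 <= C by rewrite !mulr_ge0 ?exprn_ge0.
have near0 be' (y t : 'rV[R]_n) : (forall l s, dl <= `|s| -> be' l s = 0) -> `|y| <= rho -> rr < `|t| ->
    prod_fun be' y t = 0.
  move=> Z yrho tr; apply: (prod_fun_eq0 dl0 Z).
  have := ler_normD (t - y) y; rewrite subrK => h; move: dl1 yrho tr h.
  by move: (`|t| : R) (`|y| : R) (`|t - y| : R) => *; lra.
have comb_cont (g h : 'rV[R]_n -> R) a : continuous g -> continuous h ->
    continuous (fun t => g t + a * h t).
  move=> cg ch t; have ca := mul_cont (@cst_continuous _ _ a) ch.
  by have := @continuousD R R^o 'rV[R]_n g (fun t => a * h t) t (cg t) (ca t); apply.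
pose I (g : 'rV[R]_n -> R) := cube_integral rr (fun t => u t * g t).
have ucont (g : 'rV[R]_n -> R) : continuous g -> continuous (fun t => u t * g t).
  by move=> cg; exact: mul_cont.
have IL (g h : 'rV[R]_n -> R) a : continuous g -> continuous h ->
    I (fun t => g t + a * h t) = I g + a * I h.
  move=> cg ch; rewrite /I -cube_integralZ//; last exact: ucont.
  rewrite -cube_integralD//; first last.
  - by apply: mul_cont; [exact: cst_continuous|exact: ucont].
  - exact: ucont.
  by congr cube_integral; apply/funext => t; rewrite mulrDr mulrCA.
have I4 (p1 p2 p3 p4 : 'rV[R]_n -> R) a c : continuous p1 -> continuous p2 -> continuous p3 -> continuous p4 ->
    let g := fun t => p1 t + -1 * p2 t + a * p3 t + - c * p4 t in
    continuous g /\ I g = I p1 + -1 * I p2 + a * I p3 + - c * I p4.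
  move=> k1 k2 k3 k4 g.
  have l1 : continuous (fun t => p1 t + -1 * p2 t) by exact: comb_cont.
  have l2 : continuous (fun t => p1 t + -1 * p2 t + a * p3 t) by exact: comb_cont.
  split; first exact: comb_cont.
  by rewrite (IL _ _ _ l2 k4) (IL _ _ _ l1 k3) (IL _ _ _ k1 k2).
have mass y : `|y| <= rho -> cube_integral rr (prod_fun be y) = 1.
  move=> yrho; rewrite -cube_integralT//; last by move=> t; exact: near0.
  by rewrite /Rintegral (prod_fun_mass cb b0 b1).
have convE be' y : conv rr u be' y = I (prod_fun be' y) by [].
exists (conv rr u be), (fun i y => - conv rr u (be1 i) y), (fun i => conv rr u (be2 i)), C, (Smax * M ^+ n * L).
split=> //.
- split=> [y i s|y i l s]; last first.
    apply: le_trans (conv_lipschitz rr0 cu uS (c2 i) M1 (M2' i) (L2 i) y l s) _.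
    rewrite ler_wpM2r// ler_wpM2r// ler_wpM2l// ler_wpM2r ?exprn_ge0//; move: M0; lra.
  have c1y := cphi1 i y; have c2y := cphi2 i y.
  set y' := y + s *: delta_mx ord0 i.
  (* The error of the expansion is one integral, against a combination [G] of product
     functions to which [bump_expansion] applies. *)
  pose G t := prod_fun be y' t + -1 * prod_fun be y t + sinh s * prod_fun (be1 i) y t +
    - cosh1 s * prod_fun (be2 i) y t.
  have cy' := cphi0 y'; have cy := cphi0 y.
  have [cG IG] := I4 _ _ _ _ (sinh s) (cosh1 s) cy' cy c1y c2y.
  have -> : conv rr u be y' - conv rr u be y - sinh s * - conv rr u (be1 i) y
      - cosh1 s * conv rr u (be2 i) y = I G.
    by rewrite IG; rewrite mulN1r mulrN opprK mulNr.
  rewrite (_ : C * _ = Smax * (3 * M * (`|s| ^+ 3 * expR `|s|) * M ^+ n) * L); last by rewrite /C; ring.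
  apply: cube_integral_norm_le => // [|t tr]; first exact: ucont.
  rewrite normrM; apply: ler_pM => //; first exact: uS.
  have -> : G t = (b (t ord0 i - y ord0 i - s) - b (t ord0 i - y ord0 i) + sinh s * b' (t ord0 i - y ord0 i)
      - cosh1 s * b'' (t ord0 i - y ord0 i)) * \prod_(l < n | l != i) be l (t ord0 l - y ord0 l).
    rewrite /G; set X := \prod_(l < n | _) _; set r := t ord0 i - y ord0 i.
    have -> : prod_fun be y' t = b (r - s) * X by exact: prod_fun_shift.
    have -> : prod_fun be y t = b r * X by exact: prod_fun_split.
    have -> : prod_fun (be1 i) y t = b' r * X by exact: prod_fun_update.
    have -> : prod_fun (be2 i) y t = b'' r * X by exact: prod_fun_update.
    by ring.
  rewrite normrM; apply: ler_pM => //.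
    exact: bump_expansion.
  by apply: prod_others_bounded.
- split=> [|i|i].
  + exact: (@conv_continuous _ _ _ _ rr0 cu Smax uS _ M).
  + move=> y; have := @conv_continuous _ _ _ _ rr0 cu Smax uS (be1 i) M (c1 i) M1 (M1' i) (L1 i).
    by move=> /(_ y); exact: continuousN.
  + exact: (@conv_continuous _ _ _ _ rr0 cu Smax uS _ M).
- split=> [y|i y|i y].
  + exact: (conv_bounded rr0 cu uS).
  + rewrite normrN; exact: (conv_bounded rr0 cu uS).
  + exact: (conv_bounded rr0 cu uS).
split.
- move=> y qy; have yrho : `|y| <= rho by apply: q_rho; exact: lt_trans qy.
  set phi := prod_fun be y.
  have lapE : laplacian phi = (fun t => \sum_(i < n) prod_fun (be2 i) y t).
    exact: laplacian_prod_fun.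
  have [clap Ilap] := cube_integral_sum rr0 (index_enum 'I_n) (fun i => ucont _ (cphi2 i y)).
  have HE : \sum_(i < n) conv rr u (be2 i) y = I (laplacian phi).
    by rewrite -Ilap lapE; congr cube_integral; apply/funext => t; rewrite mulr_sumr.
  have clap' : continuous (laplacian phi).
    have [clap' _] := cube_integral_sum rr0 (index_enum 'I_n) (fun i => cphi2 i y).
    by rewrite lapE.
  (* Both sides of the weak equation are integrals over the cube, as [phi] and its
     Laplacian vanish outside. *)
  have := weak (test_prod_fun y Cbe Z0); rewrite -/phi.
  have lap0 t : rr < `|t| -> laplacian phi t = 0.
    by move=> tr; rewrite lapE big1// => i _; apply: near0 => //; exact: Z2.
  have phi0 t : rr < `|t| -> phi t = 0 by move=> tr; exact: near0.
  rewrite (cube_integralT rr0 (g := fun x => u x * (- 2^-1 * laplacian phi x + V x * phi x))); last first.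
    by move=> t tr; rewrite lap0// phi0// !mulr0 addr0 mulr0.
  rewrite (cube_integralT rr0 (g := fun x => u x * phi x)); last first.
    by move=> t tr; rewrite phi0// mulr0.
  have cVphi : continuous (fun t => V t * phi t) by apply: mul_cont; [exact: cV|exact: cphi0].
  have E1 : cube_integral rr (fun x => u x * (- 2^-1 * laplacian phi x + V x * phi x)) =
      I (fun t => V t * phi t) + - 2^-1 * I (laplacian phi).
    by rewrite -IL//; congr cube_integral; apply/funext => t; rewrite addrC.
  rewrite E1 -/(I phi) HE => W.
  have -> : I (laplacian phi) = 2 * I (fun t => V t * phi t + - lambda * phi t).
    rewrite (IL _ _ _ cVphi (cphi0 y)) mulNr -/phi -W.
    by move: (I (fun t => V t * phi t)) (I (laplacian phi)) => a1 a2; lra.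
  rewrite mulr_ge0//.
  apply: (@le_trans _ _ (cube_integral rr (cst 0 : 'rV[R]_n -> R))).
    by rewrite cube_integral_cst mul0r.
  apply: cube_integral_le => //; first exact: cst_continuous.
    by apply: ucont; apply: comb_cont; [exact: cVphi|exact: cphi0].
  move=> t tr /=; rewrite -mulrDl.
  have [ty|ty] := ltP `|t - y| dl; last by rewrite /phi (prod_fun_eq0 dl0 Z0 ty) !mulr0.
  have qt : 0 < q t.
    have : `|q y - q t| < theta.
      apply: dqP => //; first by rewrite (le_trans yrho)// lerDl.
      by rewrite distrC (lt_le_trans ty).
    by rewrite ltr_norml => /andP[_]; lra.
  have [Vt ut] := qV qt.
  rewrite mulr_ge0// mulr_ge0// ?subr_ge0 ?(ltW Vt)//.
  exact: prod_fun_ge0.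
- move=> y yrho; rewrite convE; have m1 := mass y yrho.
  have yrr : `|y| <= rr by rewrite (le_trans yrho)// lerDl.
  have ufy t : `|t| <= rr -> `|u t * prod_fun be y t - u y * prod_fun be y t| <= eta * prod_fun be y t.
    move=> tr; rewrite -mulrBl normrM (ger0_norm (prod_fun_ge0 b0 y t)).
    have [ty|ty] := ltP `|t - y| dl; last by rewrite (prod_fun_eq0 dl0 Z0 ty) !mulr0.
    rewrite ler_wpM2r ?prod_fun_ge0// ltW// duP// (lt_le_trans ty)//.
  have cm (a : R) : continuous (fun t => a * prod_fun be y t).
    by apply: mul_cont => //; exact: cst_continuous.
  have cI (a : R) : cube_integral rr (fun t => a * prod_fun be y t) = a.
    by rewrite cube_integralZ// m1 mulr1.
  have cd : continuous (fun t => u t * prod_fun be y t) by exact: ucont.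
  have cadd (a c : R) : continuous (fun t => (a + c) * prod_fun be y t) by exact: cm.
  have lo : u y - eta <= I (prod_fun be y).
    rewrite -(cI (u y - eta)); apply: cube_integral_le => // t /ufy.
    by rewrite ler_norml => /andP[h _]; move: h; rewrite mulrBl; lra.
  have hi : I (prod_fun be y) <= eta + u y.
    rewrite -(cI (eta + u y)); apply: cube_integral_le => // t /ufy.
    by rewrite ler_norml => /andP[_ h]; move: h; rewrite mulrDl; lra.
  by rewrite ler_norml; apply/andP; split; lra.
- move=> y; rewrite convE.
  apply: (@le_trans _ _ (cube_integral rr (fun t => Smax * prod_fun be y t))).
    apply: cube_integral_le => //.
    - exact: ucont.
    - by apply: mul_cont => //; exact: cst_continuous.
    - move=> t tr; rewrite ler_wpM2r ?prod_fun_ge0// (le_trans (ler_norm _))// uS//.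
  rewrite cube_integralZ// -[leRHS]mulr1 ler_wpM2l//.
  exact: (cube_mass_le cb b0 b1).
Qed.

End subharmonic_mollification.

(** * Boundedness of Agmon sublevel sets *)

Section soft_log.
Variable R : realType.

(** Tends to infinity with slope at most one, yet is flat up to [r0]: its variation
    along a path is at most the length spent beyond [r0]. *)
Definition soft_log (r0 s : R) : R := ln (1 + Num.max (s - r0) 0 ^+ 2).

Lemma is_derive_max0_sqr (s : R) :
  is_derive s 1 (fun y : R => Num.max y 0 ^+ 2) (2 * Num.max s 0).
Proof.
have [s0|s0|->] := ltgtP s 0.
- rewrite mulr0.
  have d0 : is_derive s (1 : R) (cst 0 : R -> R) (0 : R) by exact: is_derive_cst.
  apply: near_eq_is_derive d0.
  near=> y; rewrite /= max_r ?expr0n//.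
  by apply: ltW; near: y; exact: lt_nbhsl.
- have d2 : is_derive s (1 : R) (fun y : R => y ^+ 2) (2 * s).
    have D := is_deriveX 2 (is_derive_id s (1 : R)).
    apply: (is_derive_eq D).
    by rewrite /= expr1 [LHS]mulr1.
  apply: near_eq_is_derive d2.
  near=> y; rewrite /= max_l//.
  by apply: ltW; near: y; exact: lt_nbhsr.
- rewrite mulr0; apply: (@is_derive_flat _ _ _ 1) => h.
  rewrite addr0 maxxx expr0n subr0 mul1r normrX real_normK ?num_real//.
  by case: (leP h 0) => // _; rewrite expr0n sqr_ge0.
Unshelve. all: by end_near.
Qed.

Definition soft_slope (r0 s : R) : R :=
  (1 + Num.max (s - r0) 0 ^+ 2)^-1 * (2 * Num.max (s - r0) 0).

Lemma soft_log_pos (r0 s : R) : 0 < 1 + Num.max (s - r0) 0 ^+ 2.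
Proof. by rewrite ltr_pwDl// sqr_ge0. Qed.

Lemma is_derive_soft_log (r0 s : R) : is_derive s 1 (soft_log r0) (soft_slope r0 s).
Proof.
have dB : is_derive s 1 (fun y : R => y - r0) 1.
  have E : (1 : R) - 0 = 1 by rewrite subr0.
  exact: (is_derive_eq (is_deriveB (is_derive_id s (1 : R)) (is_derive_cst r0 s 1)) E).
have d1 := @is_derive1_comp _ _ (fun y : R => y - r0) s _ _ (is_derive_max0_sqr (s - r0)) dB.
have d2 := is_deriveD (is_derive_cst (1 : R) s 1) d1.
have d3 := @is_derive1_comp _ _ (cst 1 + (fun y : R => Num.max y 0 ^+ 2) \o (fun y : R => y - r0)) s _ _ (is_derive1_ln (soft_log_pos r0 s)) d2.
apply: (is_derive_eq d3).
by rewrite add0r mulr1.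
Qed.

Lemma soft_slope_itv (r0 s : R) : 0 <= soft_slope r0 s <= 1.
Proof.
have m0 : 0 <= Num.max (s - r0) 0 by rewrite le_max lexx orbT.
rewrite /soft_slope; have := soft_log_pos r0 s; move: (Num.max (s - r0) 0) m0 => m m0 p.
rewrite mulr_ge0 ?invr_ge0 ?(ltW p)// ?mulr_ge0//=.
rewrite mulrC ler_pdivrMr// mul1r -subr_ge0.
by rewrite (_ : _ - _ = (1 - m) ^+ 2) ?sqr_ge0//; ring.
Qed.

Lemma soft_slope_eq0 (r0 s : R) : s <= r0 -> soft_slope r0 s = 0.
Proof. by move=> sr; rewrite /soft_slope max_r ?mulr0// subr_le0. Qed.

Lemma soft_log_eq0 (r0 s : R) : s <= r0 -> soft_log r0 s = 0.
Proof. by move=> sr; rewrite /soft_log max_r ?subr_le0// expr0n addr0 ln1. Qed.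

Lemma soft_log_le (r0 s a : R) : soft_log r0 s <= a -> s <= r0 + 1 + expR a.
Proof.
move=> h.
have : 1 + Num.max (s - r0) 0 ^+ 2 <= expR a.
  by rewrite -[leLHS]lnK ?ler_expR// posrE soft_log_pos.
have : s - r0 <= Num.max (s - r0) 0 by rewrite le_max lexx.
have := expR_gt0 a; nra.
Qed.

Lemma continuous_soft_slope (r0 : R) : continuous (soft_slope r0).
Proof.
move=> s.
have cm : {for s, continuous (fun s : R => Num.max (s - r0) 0 : R)}.
  apply: (@continuous_max R R (fun s => s - r0) (cst 0)); last exact: cst_continuous.
  by apply: continuousB; [exact: cvg_id|exact: cst_continuous].
have cX : {for s, continuous (fun s : R => 1 + Num.max (s - r0) 0 ^+ 2)}.
  have cXX : {for s, continuous (fun s : R => Num.max (s - r0) 0 * Num.max (s - r0) 0)}.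
    exact: continuousM.
  by apply: continuousD => //; exact: cst_continuous.
have cV := @continuousV R R _ s (lt0r_neq0 (soft_log_pos r0 s)) cX.
have c2 : {for s, continuous (fun s : R => 2 * Num.max (s - r0) 0)}.
  by apply: (@continuousM R R (cst 2) _ s) => //; exact: cst_continuous.
exact: (@continuousM R R _ _ s cV c2).
Qed.

End soft_log.

(** Additive quantities along a path need to be compared on C1 pieces only. *)
Lemma piecewise_C1_ind (R : realType) (n : nat) (gamma : R -> 'rV[R]_n) (Q : R -> R -> Prop) :
  piecewise_C1 gamma ->
  (forall a b g, a < b -> C1_curve g -> {in `[a, b], gamma =1 g} -> Q a b) ->
  (forall a b c, a < b -> b < c -> Q a b -> Q b c -> Q a c) -> Q 0 1.
Proof.
move=> [s [ps ls gs]] Qpiece Qcat.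
have s0 : s != [::].
  by apply/eqP => s0; move: ls; rewrite s0 /= => /eqP; rewrite eq_sym oner_eq0.
have H : forall (s : seq R) (a : R), s != [::] -> path <%R a s ->
    (forall i, (i < size s)%N -> exists2 g, C1_curve g &
       {in `[nth 0 (a :: s) i, nth 0 (a :: s) i.+1], gamma =1 g}) ->
    a < last a s /\ Q a (last a s).
  elim=> // b s1 IH a _ /= /andP[ab pbs] hp.
  have Qab : Q a b by have [g cg gE] := hp 0%N isT; exact: Qpiece cg gE.
  have [E|s1n] := eqVneq s1 [::]; first by rewrite E /=.
  have [bl Qb] := IH b s1n pbs (fun i => hp i.+1).
  by split; [exact: lt_trans bl|exact: Qcat Qb].
have [_] := H s 0 s0 ps gs.
by rewrite (_ : last 0 s = 1).
Qed.

Section curve_length.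
Variables (R : realType) (n : nat) (w : 'rV[R]_n -> R).
Hypotheses (cw : continuous w) (w0 : forall y, 0 <= w y).
Local Notation mu := (@lebesgue_measure R).

Lemma coord_le_enorm (v : 'rV[R]_n) i : `|v ord0 i| <= enorm v.
Proof.
rewrite /enorm -sqrtr_sqr ler_sqrt; last by rewrite sumr_ge0// => j _; exact: sqr_ge0.
by rewrite (bigD1 i)//= lerDl sumr_ge0// => j _; exact: sqr_ge0.
Qed.

Lemma enorm_ge0 (v : 'rV[R]_n) : 0 <= enorm v. Proof. exact: sqrtr_ge0. Qed.

Lemma continuous_enorm : continuous (@enorm R n).
Proof.
move=> v; apply: (@continuous_comp _ _ _ (fun v : 'rV[R]_n => \sum_(i < n) v ord0 i ^+ 2) (@Num.sqrt R)); last first.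
  exact: sqrt_continuous.
have H : forall s : seq 'I_n, continuous (fun v : 'rV[R]_n => \sum_(i <- s) v ord0 i ^+ 2).
  elim=> [|a s IH] v'.
    by under eq_fun do rewrite big_nil; exact: cst_continuous.
  under eq_fun do rewrite big_cons.
  have c1 : {for v', continuous (fun v : 'rV[R]_n => v ord0 a)} by exact: coord_continuous.
  have c2 : {for v', continuous (fun v : 'rV[R]_n => v ord0 a ^+ 2)}.
    by have := @continuousM R 'rV[R]_n _ _ v' c1 c1; apply.
  by have := @continuousD R R^o 'rV[R]_n _ _ v' c2 (IH v'); apply.
exact: H.
Qed.

Definition speed (gamma : R -> 'rV[R]_n) (t : R) : R := w (gamma t) * enorm (derive1 gamma t).

Lemma speed_ge0 gamma t : 0 <= speed gamma t.
Proof. by rewrite mulr_ge0 ?enorm_ge0. Qed.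

Lemma C1_continuous (g : R -> 'rV[R]_n) : C1_curve g -> continuous g.
Proof.
by move=> [dg _] t; apply: differentiable_continuous; exact/derivable1_diffP.
Qed.

Lemma continuous_speed g : C1_curve g -> continuous (speed g).
Proof.
move=> Cg t; have [_ cd] := Cg.
have c1 : {for t, continuous (w \o g)}.
  by apply: continuous_comp; [exact: C1_continuous|exact: cw].
have c2 : {for t, continuous (@enorm R n \o derive1 g)}.
  by apply: continuous_comp; [exact: cd|exact: continuous_enorm].
exact: (@continuousM R R _ _ t c1 c2).
Qed.

Lemma derive1_near (gamma g : R -> 'rV[R]_n) (a b t : R) : C1_curve g ->
  {in `[a, b], gamma =1 g} -> a < t < b -> derive1 gamma t = derive1 g t.
Proof.
move=> [dg _] E /andP[ta tb].
have D : is_derive t (1 : R) g (derive1 g t).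
  by apply: DeriveDef; [exact: dg|rewrite derive1E].
suff [_ D'] : is_derive t (1 : R) gamma (derive1 g t) by rewrite derive1E.
apply: near_eq_is_derive D.
near=> r; symmetry; apply: E; rewrite in_itv/=; apply/andP; split; apply: ltW; near: r.
- exact: lt_nbhsr.
- exact: lt_nbhsl.
Unshelve. all: by end_near.
Qed.

Lemma speed_eq (gamma g : R -> 'rV[R]_n) (a b t : R) : C1_curve g ->
  {in `[a, b], gamma =1 g} -> a < t < b -> speed gamma t = speed g t.
Proof.
move=> Cg E ab; rewrite /speed (derive1_near Cg E ab) E//.
by case/andP: ab => ? ?; rewrite in_itv/= !ltW.
Qed.

Lemma measurable_speed_piece (gamma g : R -> 'rV[R]_n) (a b : R) : C1_curve g ->
  {in `[a, b], gamma =1 g} -> measurable_fun (`[a, b]%classic : set (measurableTypeR R)) (speed gamma).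
Proof.
move=> Cg E; apply: (@measurable_fun_itv_cc _ _ _ false true).
apply: (@eq_measurable_fun _ _ _ _ _ (speed g)).
  by move=> t; rewrite inE/= in_itv/= => /andP[h1 h2]; rewrite (speed_eq Cg E)// h1 h2.
by apply: measurable_funTS; apply: continuous_measurable_fun; exact: continuous_speed.
Qed.

Lemma integral_speed_piece (gamma g : R -> 'rV[R]_n) (a b : R) : a < b -> C1_curve g ->
  {in `[a, b], gamma =1 g} ->
  (\int[mu]_(t in `[a, b]) (speed gamma t)%:E = \int[mu]_(t in `[a, b]) (speed g t)%:E)%E.
Proof.
move=> ab Cg E.
have mc (h : R -> 'rV[R]_n) : measurable_fun (`[a, b]%classic : set (measurableTypeR R)) (speed h) ->
    (\int[mu]_(t in `[a, b]) (speed h t)%:E = \int[mu]_(t in `]a, b[) (speed h t)%:E)%E.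
  move=> mh.
  have m1 : measurable_fun (`]a, b[%classic : set (measurableTypeR R)) (EFin \o speed h).
    apply/measurable_EFinP; apply: measurable_funS mh => //.
    by move=> t /=; rewrite !in_itv/= => /andP[h1 h2]; rewrite !ltW.
  rewrite -integral_itv_obnd_cbnd; last by apply/emeasurable_fun_itv_bndo_bndcP.
  by rewrite -integral_itv_bndo_bndc.
transitivity (\int[mu]_(t in `]a, b[) (speed gamma t)%:E)%E.
  exact: mc gamma (measurable_speed_piece Cg E).
rewrite (mc g (measurable_speed_piece Cg (fun=> fun=> erefl))).
apply: eq_integral => t; rewrite inE/= in_itv/= => /andP[h1 h2].
by rewrite (speed_eq Cg E)// h1 h2.
Qed.

Variables (i : 'I_n) (sg r0 : R).
Hypotheses (sg1 : `|sg| = 1) (w1 : forall y : 'rV[R]_n, r0 < sg * y ord0 i -> 1 <= w y).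

Let psi (h : R -> 'rV[R]_n) (t : R) : R := soft_log r0 (sg * h t ord0 i).

Let psi' (h : R -> 'rV[R]_n) (t : R) : R :=
  soft_slope r0 (sg * h t ord0 i) * (sg * derive1 h t ord0 i).

Let is_derive_psi g t : C1_curve g -> is_derive t (1 : R) (psi g) (psi' g t).
Proof.
move=> [dg _].
have di : derivable (fun s => g s ord0 i) t 1 by have /derivable_mxP := dg t; apply.
have D : is_derive t (1 : R) (fun s => g s ord0 i) (derive1 g t ord0 i).
  by apply: DeriveDef => //; rewrite derive1E derive_mx// mxE.
have D2 := is_deriveZ sg D.
exact: (@is_derive1_comp _ (soft_log r0) (fun s => sg * g s ord0 i) t _ _ (is_derive_soft_log _ _) D2).
Qed.

Let psi'_le g t : `|psi' g t| <= speed g t.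
Proof.
have /andP[s0 s1] := soft_slope_itv r0 (sg * g t ord0 i).
rewrite normrM (ger0_norm s0) normrM sg1 mul1r.
have [h|h] := leP (sg * g t ord0 i) r0; first by rewrite soft_slope_eq0// mul0r speed_ge0.
apply: ler_pM => //; last exact: coord_le_enorm.
by apply: le_trans s1 _; exact: w1.
Qed.

Let continuous_psi' g : C1_curve g -> continuous (psi' g).
Proof.
move=> Cg t; have [_ cd] := Cg.
have c1 : {for t, continuous (fun s => sg * g s ord0 i)}.
  have c0 : {for t, continuous (fun s => g s ord0 i)}.
    by apply: (@continuous_comp _ _ _ g (fun v : 'rV[R]_n => v ord0 i)); [exact: C1_continuous|exact: coord_continuous].
  by apply: (@continuousM R R (cst sg) _ t) => //; exact: cst_continuous.
have c2 : {for t, continuous (fun s => sg * derive1 g s ord0 i)}.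
  have c0 : {for t, continuous (fun s => derive1 g s ord0 i)}.
    by apply: (@continuous_comp _ _ _ (derive1 g) (fun v : 'rV[R]_n => v ord0 i)); [exact: cd|exact: coord_continuous].
  by apply: (@continuousM R R (cst sg) _ t) => //; exact: cst_continuous.
have c3 : {for t, continuous (soft_slope r0 \o (fun s => sg * g s ord0 i))}.
  by apply: continuous_comp => //; exact: continuous_soft_slope.
exact: (@continuousM R R _ _ t c3 c2).
Qed.

Let psi_piece g a b : a < b -> C1_curve g ->
  ((psi g a - psi g b)%:E <= \int[mu]_(t in `[a, b]) (speed g t)%:E)%E.
Proof.
move=> ab Cg.
pose F t := - psi g t; pose f t := - psi' g t.
have dF t : is_derive t (1 : R) F (f t) by exact: (is_deriveN (is_derive_psi t Cg)).
have cF : continuous F by apply: derivable_continuous => t; case: (dF t).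
have cf : continuous f.
  by move=> t; have := @continuousN R R^o R _ t (continuous_psi' Cg (x := t)); apply.
have cc (h : R -> R) : continuous h ->
    mu.-integrable (`[a, b]%classic : set (measurableTypeR R)) (EFin \o h).
  move=> ch; apply: continuous_compact_integrable; first exact: segment_compact.
  exact: continuous_subspaceT.
have FTC : (\int[mu]_(t in `[a, b]) (f t)%:E = (F b)%:E - (F a)%:E)%E.
  apply: continuous_FTC2 => //.
  - exact: continuous_subspaceT.
  - split; first by move=> t _; case: (dF t).
    + by apply: cvg_at_right_filter; exact: cF.
    + by apply: cvg_at_left_filter; exact: cF.
  - by move=> t _; rewrite derive1E; case: (dF t).
rewrite (_ : psi g a - psi g b = F b - F a); last by rewrite /F opprK addrC.
rewrite EFinB -FTC; apply: le_integral => //; [exact: cc|exact: cc (continuous_speed Cg)|].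
move=> t _; rewrite lee_fin /f; have := psi'_le g t; rewrite ler_norml => /andP[h _].
by rewrite lerNl.
Qed.

(** On a C1 piece this is the fundamental theorem of calculus, since the slope of
    [soft_log] is at most one and vanishes where [w] might be less than one; both
    sides add up over consecutive pieces. *)
Lemma soft_log_le_length gamma : piecewise_C1 gamma ->
  ((psi gamma 0 - psi gamma 1)%:E <= \int[mu]_(t in `[0%R, 1%R]) (speed gamma t)%:E)%E.
Proof.
move=> pg.
pose Q (a b : R) := measurable_fun (`[a, b]%classic : set (measurableTypeR R)) (speed gamma) /\
  ((psi gamma a - psi gamma b)%:E <= \int[mu]_(t in `[a, b]) (speed gamma t)%:E)%E.
suff [] : Q 0 1 by [].
apply: (piecewise_C1_ind pg).
  move=> a b g ab Cg E; split; first exact: measurable_speed_piece E.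
  rewrite (integral_speed_piece ab Cg E) /psi !E ?in_itv/= ?lexx ?(ltW ab)//.
  exact: psi_piece.
move=> a b c ab bc [m1 h1] [m2 h2].
have UE : `[a, c]%classic = `[a, b[%classic `|` `[b, c]%classic :> set R.
  by apply: itv_bndbnd_setU; rewrite bnd_simp ltW.
have UE' : `[a, c]%classic = `[a, b]%classic `|` `[b, c]%classic :> set R.
  apply/seteqP; split=> t /=; rewrite !in_itv/=.
    by move=> /andP[h3 h4]; case: (leP t b) => tb; [left; rewrite h3|right; rewrite h4 ltW].
  by move=> [|] /andP[h3 h4]; apply/andP; split => //; [apply: le_trans h4 (ltW bc)|apply: le_trans (ltW ab) h3].
have m3 : measurable_fun (`[a, c]%classic : set (measurableTypeR R)) (speed gamma).
  by rewrite UE'; apply/measurable_funU => //.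
split => //.
rewrite UE ge0_integral_setU//; first last.
- apply/disj_setPS => t /= [] /=; rewrite !in_itv/= => /andP[_ h3] /andP[h4 _].
  by move: (lt_le_trans h3 h4); rewrite ltxx.
- by move=> t _; rewrite lee_fin speed_ge0.
- by apply/measurable_EFinP; rewrite -UE.
rewrite integral_itv_bndo_bndc; last first.
  by apply/emeasurable_fun_itv_bndo_bndcP; apply/measurable_EFinP.
apply: le_trans (leeD h1 h2).
by rewrite -EFinD lee_fin addrA subrK.
Qed.

End curve_length.

Section agmon_bounded.
Variables (R : realType) (n : nat) (V : 'rV[R]_n -> R) (lambda : R).
Hypothesis cV : continuous V.
Hypothesis coercive : forall M : R, exists r : R, forall x, r < enorm x -> M < V x.

Let w (y : 'rV[R]_n) : R := Num.max (Num.sqrt 2 * Num.sqrt (V y - lambda)) 0.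

Let w0 y : 0 <= w y. Proof. by rewrite le_max lexx orbT. Qed.

Let cw : continuous w.
Proof.
move=> y; apply: (@continuous_max R _ (fun y => Num.sqrt 2 * Num.sqrt (V y - lambda)) (cst 0)); last exact: cst_continuous.
have c1 : {for y, continuous (fun y => Num.sqrt (V y - lambda))}.
  apply: (@continuous_comp _ _ _ (fun y => V y - lambda) (@Num.sqrt R)); last exact: sqrt_continuous.
  by have := @continuousB R R^o 'rV[R]_n _ _ y (@cV y) (@cst_continuous _ _ lambda y); apply.
by have := @continuousM R 'rV[R]_n (cst (Num.sqrt 2)) _ y (@cst_continuous _ _ _ y) c1; apply.
Qed.

(** The weight exceeds 1 near infinity, so a path ending in the allowed region
    cannot start far away without being long: [soft_log] of each signed coordinate
    of its starting point is at most its length. *)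
Lemma agmon_sublevel_bounded (alpha : R) : exists2 rho : R, 0 <= rho &
  forall y, (agmon_allowed V lambda y <= alpha%:E)%E -> `|y| <= rho.
Proof.
have [r rP] := coercive (lambda + 1).
have B0 : 0 <= `|r| + 1 + expR alpha by rewrite !addr_ge0// expR_ge0.
exists (`|r| + 1 + expR alpha) => // y hy.
have w1 (i : 'I_n) (sg : R) : `|sg| = 1 -> forall z : 'rV[R]_n, r < sg * z ord0 i -> 1 <= w z.
  move=> sg1 z hz.
  have : r < enorm z.
    apply: lt_le_trans hz _; apply: le_trans (ler_norm _) _.
    by rewrite normrM sg1 mul1r coord_le_enorm.
  move/rP => Vz; rewrite /w le_max; apply/orP; left.
  rewrite -{1}[1]mulr1; apply: ler_pM => //.
    by rewrite -{1}sqrtr1 ler_sqrt// ler1n.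
  by rewrite -{1}sqrtr1 ler_sqrt; lra.
have key (i : 'I_n) (sg : R) : `|sg| = 1 -> sg * y ord0 i <= `|r| + 1 + expR alpha.
  move=> sg1.
  have : soft_log r (sg * y ord0 i) <= alpha.
    rewrite -lee_fin; apply: le_trans hy.
    apply: le_ereal_inf_tmp => _ [a /= aE <-]; apply: le_ereal_inf_tmp => _ [gamma [pg g0 g1] <-].
    have := soft_log_le_length cw w0 sg1 (w1 i sg sg1) pg.
    rewrite g0 g1 (@soft_log_eq0 _ _ (sg * a ord0 i)) ?subr0// leNgt.
    apply/negP => ha; have : r < enorm a.
      apply: lt_le_trans ha _; apply: le_trans (ler_norm _) _.
      by rewrite normrM sg1 mul1r coord_le_enorm.
    by move/rP; move: aE; rewrite /allowed /=; lra.
  move/soft_log_le => h; apply: le_trans h _.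
  by rewrite !lerD2r ler_norm.
apply: norm_le_coord => // i; rewrite ler_norml; apply/andP; split.
  by rewrite lerNl -mulN1r; apply: key; rewrite normrN normr1.
by rewrite -[leLHS]mul1r; apply: key; rewrite normr1.
Qed.

End agmon_bounded.

(** * The bound for eigenfunctions *)

Lemma nbhs_gt (R : realType) (n : nat) (g : 'rV[R]_n -> R) (a : R) (y : 'rV[R]_n) :
  continuous g -> a < g y -> nbhs y [set z | a < g z].
Proof.
move=> cg ay; have oa : nbhs (g y) [set r | a < r] by apply: open_nbhs_nbhs; split => //; exact: open_gt.
exact: (cg y _ oa).
Qed.

Lemma path_limit_closed (R : realType) (n : nat) (b : R -> 'rV[R]_n) (D : set 'rV[R]_n) (t : R) :
  {within `[0, +oo[, continuous b} -> closed D -> 0 < t ->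
  (forall s, 0 <= s -> s < t -> D (b s)) -> D (b t).
Proof.
move=> cb cD t0 hD.
have D0 : D !=set0 by exists (b 0); exact: hD.
apply: (closed_set_dist D0 cD); rewrite leNgt; apply/negP => lt.
have cd : continuous (set_dist D) by exact: set_dist_continuous.
have [dl dl0 hdl] := path_eps cb cd (ltW t0) lt.
pose s := Num.max 0 (t - dl / 2).
have s0 : 0 <= s by rewrite le_max lexx.
have st : s < t by rewrite gt_max t0/=; lra.
have sdl : `|s - t| < dl.
  have : t - dl / 2 <= s by rewrite le_max lexx orbT.
  by rewrite ltr_norml; move: st => *; apply/andP; split; lra.
have := hdl s s0 sdl.
by rewrite (set_dist_eq0 D0 (hD s s0 st)) sub0r normrN ger0_norm ?ltxx// ltW.
Qed.

Section eigenfunction_bound.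
Variables (R : realType) (n : nat) (V u : 'rV[R]_n -> R) (lambda alpha eps c : R).
Hypotheses (cV : continuous V) (cu : continuous u).
Hypothesis decay : forall y, ~ allowed V lambda y ->
  (`|u y|%:E <= c%:E * expeR (- ((1 - eps)%:E * agmon_allowed V lambda y)))%E.
Hypothesis c0 : 0 <= c.

Local Notation M := (c * expR (- ((1 - eps) * alpha))).

Lemma agmon_allowed_ge0 y : (0 <= agmon_allowed V lambda y)%E.
Proof.
apply: le_ereal_inf_tmp => _ [a _ <-]; apply: le_ereal_inf_tmp => _ [gamma _ <-].
apply: integral_ge0 => t _; rewrite lee_fin mulr_ge0 ?enorm_ge0// le_max lexx orbT.
Qed.

(** On the outer boundary the decay estimate passes to the limit along points of
    [Omega] if [eps > 1], and along points outside [Omega] otherwise: in each case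
    the side on which the exponential is at most its value at [alpha]. *)
Lemma boundary_decay y : boundary (Omega V lambda alpha) y -> lambda < V y -> `|u y| <= M.
Proof.
move=> [yc yi] Vy; rewrite leNgt; apply/negP => Mu.
have nb : nbhs y [set z | lambda < V z /\ M < `|u z|].
  have cn : continuous (fun z => `|u z|).
    by move=> z; apply: continuous_comp; [exact: cu|exact: norm_continuous].
  exact: filterI (nbhs_gt cV Vy) (nbhs_gt cn Mu).
suff [z [Vz Mz] hz] : exists2 z, lambda < V z /\ M < `|u z| &
    (((1 - eps) * alpha)%:E <= (1 - eps)%:E * agmon_allowed V lambda z)%E.
  have nz : ~ allowed V lambda z by rewrite /allowed /=; lra.
  have : (`|u z|%:E <= M%:E)%E.
    apply: le_trans (decay nz) _; rewrite EFinM.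
    by rewrite lee_wpmul2l ?lee_fin// (_ : (expR _)%:E = expeR (- ((1 - eps) * alpha)%:E)%E)// lee_expeR leeN2.
  by rewrite lee_fin; move: Mz; lra.
have [e1|e1] := leP 0 (1 - eps).
  have [z [[Vz Mz] nO]] : exists z, (lambda < V z /\ M < `|u z|) /\ ~ Omega V lambda alpha z.
    apply: contrapT => h; apply: yi; apply: filterS nb => z hz.
    by apply: contrapT => nO; apply: h; exists z.
  exists z => //; rewrite EFinM lee_wpmul2l ?lee_fin//.
  rewrite leNgt; apply/negP => lt; apply: nO; split; last exact: ltW.
  by rewrite /allowed /=; lra.
have [z [[_ za] hz]] := yc _ nb.
exists z => //.
have := agmon_allowed_ge0 z; move: za; case: (agmon_allowed V lambda z) => [a| |]//.
rewrite lee_fin => za _; rewrite -EFinM lee_fin; nra.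
Qed.

End eigenfunction_bound.

Section one_sided.
Variables (R : realType) (n : nat) (V u : 'rV[R]_n -> R) (lambda alpha eps c : R).
Hypotheses (cV : continuous V) (cu : continuous u).
Hypothesis coercive : forall M : R, exists r : R, forall x, r < enorm x -> M < V x.
Hypothesis weak : forall phi, test_function phi ->
  \int[lebesgue_n R n]_t
    (let x := tuple_row t in u x * (- 2^-1 * laplacian phi x + V x * phi x)) =
  lambda * \int[lebesgue_n R n]_t (u (tuple_row t) * phi (tuple_row t)).
Hypothesis decay : forall y, ~ allowed V lambda y ->
  (`|u y|%:E <= c%:E * expeR (- ((1 - eps)%:E * agmon_allowed V lambda y)))%E.
Hypothesis c0 : 0 < c.
Variables (x : 'rV[R]_n) (d : measure_display) (T : measurableType d) (P : probability T R)
  (B : R -> T -> 'rV[R]_n).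
Hypothesis BM : brownian_motion P x B.
Hypotheses (ux : 0 < u x) (Ox : (Omega V lambda alpha)° x) (E0 : allowed V lambda !=set0).

Local Notation M := (c * expR (- ((1 - eps) * alpha))).
Local Notation W := (Omega V lambda alpha).
Local Notation hitE := (first_hit_in B (boundary W) (boundary (allowed V lambda))).
Let C : set 'rV[R]_n := ~` W°.

Let M0 : 0 < M. Proof. by rewrite mulr_gt0 ?expR_gt0. Qed.

Let W_forbidden y : W y -> lambda < V y.
Proof. by move=> [+ _]; rewrite /allowed /= => /negP; rewrite -ltNge. Qed.

Let C0 : C !=set0.
Proof.
have [a aE] := E0; exists a => /interior_subset /W_forbidden.
by move: aE; rewrite /allowed /= => h1 h2; move: (le_lt_trans h1 h2); rewrite ltxx.
Qed.

Let cC : closed C.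
Proof. by apply: open_closedC; exact: open_interior. Qed.

Let dist_gt0 y : 0 < set_dist C y -> W° y.
Proof.
move=> h; apply: contrapT => h'; move: h.
by rewrite (set_dist_eq0 C0 (y := y))// ltxx.
Qed.

Let dist_gt0_x : 0 < set_dist C x.
Proof.
rewrite ltNge; apply/negP => h; exact: (closed_set_dist C0 cC h).
Qed.

Let measurable_hitE : measurable hitE.
Proof. by apply: (measurable_first_hit BM); exact: closed_boundary. Qed.

(** The region in which the path runs is described by one continuous function,
    whose zero at the exit time tells which of the three constraints fails. *)
Let gauge (eta : R) (y : 'rV[R]_n) : R :=
  Num.min (Num.min (V y - lambda) (set_dist C y)) (u y - eta).

Let gauge_gt0 eta y : 0 < gauge eta y -> [/\ lambda < V y, W° y & eta < u y].
Proof.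
rewrite !lt_min !subr_gt0 => /andP[/andP[h1 h2] h3]; split => //.
exact: dist_gt0.
Qed.

Let continuous_gauge eta : continuous (gauge eta).
Proof.
have csub (g : 'rV[R]_n -> R) (a : R) : continuous g -> continuous (fun y => g y - a).
  by move=> cg y; have := @continuousB R R^o 'rV[R]_n _ _ y (cg y) (@cst_continuous _ _ a y); apply.
move=> y; apply: (@continuous_min R _ (fun y => Num.min (V y - lambda) (set_dist C y)) (fun y => u y - eta)).
  apply: (@continuous_min R _ (fun y => V y - lambda) (set_dist C)); first exact: csub.
  exact: set_dist_continuous.
exact: csub.
Qed.

(** A path that leaves the region at a point where [u > M] does so by entering
    the allowed region: on the rest of the boundary of [Omega] the decay estimate
    forces [u <= M]. *)
Let exit_allowed (eta : R) w (t : R) : 0 < eta -> 0 <= t ->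
  (forall s : R, 0 <= s -> s < t -> 0 < gauge eta (B s w)) ->
  gauge eta (B t w) = 0 -> M + eta <= u (B t w) -> 0 < gauge eta x -> hitE w.
Proof.
move=> eta0 t0 before at0 high gx.
have [B0 cB _ _ _] := BM.
have tp : 0 < t.
  rewrite lt_neqAle t0 andbT; apply/eqP => te.
  by move: gx at0; rewrite -te B0 => h1 h2; move: h1; rewrite h2 ltxx.
have inW s : 0 <= s -> s < t -> W° (B s w) by move=> s0 st; have [] := gauge_gt0 (before s s0 st).
have clW : closure W (B t w).
  apply: (@path_limit_closed R n (B ^~ w) (closure W) t (cB w)) => //; first exact: closed_closure.
  move=> s s0 st.
  by apply: subset_closure; apply: interior_subset; exact: inW.
have Vt : V (B t w) <= lambda.
  rewrite leNgt; apply/negP => Vt.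
  have : ~ W° (B t w).
    suff : C (B t w) by [].
    apply: (closed_set_dist C0 cC); rewrite leNgt; apply/negP => h.
    have : 0 < gauge eta (B t w).
      rewrite /gauge !lt_min subr_gt0 Vt h /=; move: M0 high; lra.
    by rewrite at0 ltxx.
  move=> nW; have := boundary_decay cV cu decay (ltW c0) (conj clW nW) Vt.
  rewrite ler_norml => /andP[_]; move: eta0 high; lra.
have nW : ~ W° (B t w) by move=> /interior_subset /W_forbidden; rewrite ltNge Vt.
exists t; split => //.
  by move=> s s0 st [_]; apply; exact: inW.
split; first exact: subset_closure.
move=> iE; have [z [Wz Ez]] := clW _ iE.
by have := W_forbidden Wz; rewrite ltNge; move: Ez; rewrite /allowed /= => ->.
Qed.

Let dimension_gt0 : (0 < n)%N.
Proof.
rewrite lt0n; apply/eqP => n0; have [a aE] := E0.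
have xa : x = a by apply/rowP => i; have := ltn_ord i; rewrite {2}n0.
have := W_forbidden (interior_subset Ox); rewrite xa ltNge.
by move: aE; rewrite /allowed /= => ->.
Qed.

(** Only the values of [u] on a bounded cube enter the maximum principle; this is
    what covers the case of an unbounded [u] and a negligible hitting event. *)
Lemma one_sided_bound_cube : exists2 rho : R, 0 <= rho &
  forall Smax : R, (forall t, `|t| <= rho + 1 -> `|u t| <= Smax) ->
  u x <= M + Smax * fine (P hitE).
Proof.
have [rho rho0 rhoP] := agmon_sublevel_bounded lambda cV coercive alpha.
exists rho => // Smax uS.
have Smax0 : 0 <= Smax.
  by apply: le_trans (normr_ge0 (u 0)) _; apply: uS; rewrite normr0 addr_ge0.
rewrite leNgt; apply/negP => lt.
pose gap := u x - (M + Smax * fine (P hitE)).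
have gap0 : 0 < gap by rewrite subr_gt0.
pose eta := Num.min (u x / 2) (gap / 4).
have eta0 : 0 < eta by rewrite lt_min !divr_gt0.
have etau : eta < u x.
  have : eta <= u x / 2 by rewrite ge_min lexx.
  by move: ux; lra.
have etag : eta <= gap / 4 by rewrite ge_min lexx orbT.
have gx : 0 < gauge eta x.
  rewrite /gauge !lt_min dist_gt0_x !subr_gt0 etau !andbT.
  by apply: W_forbidden; exact: interior_subset.
have g_rho y : 0 < gauge eta y -> `|y| <= rho.
  by move=> /gauge_gt0[_ /interior_subset[_ /rhoP]].
have gV y : 0 < gauge eta y -> lambda < V y /\ 0 <= u y.
  by move=> /gauge_gt0[h1 _ h2]; split => //; exact: ltW (lt_trans eta0 h2).
have app (k : nat) : exists f, subharmonic_approx (gauge eta) u rho Smax eta k.+1%:R^-1 f.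
  by apply: (subharmonic_approx_exists cV cu (@continuous_gauge eta) weak).
pose f k := projT1 (cid (app k)).
have fP k : subharmonic_approx (gauge eta) u rho Smax eta k.+1%:R^-1 (f k).
  exact: projT2 (cid (app k)).
have := brownian_max BM (@continuous_gauge eta) cu gx g_rho Smax0 (ltW M0) eta0 (Ordinal dimension_gt0) fP
  measurable_hitE (fun w t t0 h1 h2 h3 => exit_allowed eta0 t0 h1 h2 h3 gx).
by move: etag gap0; rewrite /gap; lra.
Qed.

End one_sided.

Section positive_value.
Variables (R : realType) (n : nat) (V u : 'rV[R]_n -> R) (lambda alpha eps c : R).
Hypotheses (cV : continuous V) (cu : continuous u).
Hypothesis coercive : forall M : R, exists r : R, forall x, r < enorm x -> M < V x.
Hypothesis weak : forall phi, test_function phi ->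
  \int[lebesgue_n R n]_t
    (let x := tuple_row t in u x * (- 2^-1 * laplacian phi x + V x * phi x)) =
  lambda * \int[lebesgue_n R n]_t (u (tuple_row t) * phi (tuple_row t)).
Hypothesis decay : forall y, ~ allowed V lambda y ->
  (`|u y|%:E <= c%:E * expeR (- ((1 - eps)%:E * agmon_allowed V lambda y)))%E.
Variables (x : 'rV[R]_n) (d : measure_display) (T : measurableType d) (P : probability T R)
  (B : R -> T -> 'rV[R]_n).
Hypothesis BM : brownian_motion P x B.
Hypotheses (ux : 0 < u x) (xE : ~ allowed V lambda x)
  (xa : (agmon_allowed V lambda x < alpha%:E)%E).
Local Notation M := (c * expR (- ((1 - eps) * alpha))).
Local Notation W := (Omega V lambda alpha).
Local Notation hitE := (first_hit_in B (boundary W) (boundary (allowed V lambda))).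

(** If [S] is infinite, the right-hand side is infinite unless the hitting event is
    negligible, and then a local bound of [u] can replace [S]. If [x] itself is on
    the boundary of [Omega], the decay estimate holds at [x]. *)
Lemma positive_value_bound (S : \bar R) : (forall y, `|u y|%:E <= S)%E ->
  ((u x)%:E <= M%:E + P hitE * S)%E.
Proof.
move=> uS.
have c0 : 0 < c.
  have := decay xE; rewrite (gtr0_norm ux); have := agmon_allowed_ge0 V lambda x; move: xa.
  case: (agmon_allowed V lambda x) => [a| |]//= _ _.
  rewrite -EFinM lee_fin => h.
  by have := lt_le_trans ux h; rewrite pmulr_lgt0 ?expR_gt0.
have E0 : allowed V lambda !=set0.
  apply: contrapT => /set0P/negP/negPn/eqP E0; move: xa.
  by rewrite /agmon_allowed E0 image_set0 ereal_inf0.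
have S0 : (0 <= S)%E by apply: le_trans (uS x).
have PS0 : (0 <= P hitE * S)%E by rewrite mule_ge0.
have xV : lambda < V x by rewrite ltNge; apply/negP.
have xW : W x by split => //; exact: ltW.
have [xi|xi] := pselect (W° x); last first.
  have h := boundary_decay cV cu decay (ltW c0) (conj (subset_closure xW) xi) xV.
  by rewrite (le_trans _ (leeDl _ PS0))// lee_fin (le_trans (ler_norm _)).
have [rho rho0 bound] := one_sided_bound_cube cV cu coercive weak decay c0 BM ux xi E0.
have Pfin : P hitE \is a fin_num by exact: fin_num_measure (measurable_first_hit BM (@closed_boundary _ _) (@closed_boundary _ _)).
rewrite -(fineK Pfin).
have [S' uS'] := continuous_cube_bounded (rho + 1) cu.
case: S uS S0 PS0 => [s| |]// uS _ _.
  by rewrite -EFinM -EFinD lee_fin [_ * s]mulrC => _; apply: bound => t _; have := uS t; rewrite lee_fin.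
move=> uS''; have := bound _ uS''.
have : 0 <= fine (P hitE) by rewrite fine_ge0.
rewrite le_eqVlt => /predU1P[<-|p0 _]; first by rewrite mulr0 addr0 mul0e adde0 lee_fin.
by rewrite gt0_muley ?lte_fin// addey// leey.
Qed.

End positive_value.

Theorem theorem1 (R : realType) (n : nat) (V : 'rV[R]_n -> R)
    (V_ge0 : forall x, 0 <= V x)
    (V_cont : continuous V)
    (V_coercive : forall M : R, exists r : R,
       forall x, r < enorm x -> M < V x)
    (lambda : R) (u : 'rV[R]_n -> R)
    (u_eig : eigenfunction V lambda u)
    (eps c : R) (eps_gt0 : 0 < eps)
    (u_decay : forall y, ~ allowed V lambda y ->
       (`|u y|%:E <=
         c%:E * expeR (- ((1 - eps)%:E * agmon_allowed V lambda y)))%E)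
    (x : 'rV[R]_n) (x_forbidden : ~ allowed V lambda x)
    (alpha : R) (alpha_gt : (agmon_allowed V lambda x < alpha%:E)%E)
    (d : measure_display) (T : measurableType d) (P : probability T R)
    (B : R -> T -> 'rV[R]_n) (B_brownian : brownian_motion P x B) :
  (`|u x|%:E <= (c * expR (- ((1 - eps) * alpha)))%:E
    + harmonic_measure P B (Omega V lambda alpha)
        (boundary (allowed V lambda)) * sup_norm u)%E.
Proof.
have [cu _ _ weak] := u_eig.
have uS y : (`|u y|%:E <= sup_norm u)%E by exact: le_sup_norm.
have [ux|ux|ux] := ltgtP (u x) 0.
- rewrite (ltr0_norm ux).
  have cNu : continuous (fun y => - u y).
    by move=> y; have := @continuousN R R^o 'rV[R]_n _ y (cu y); apply.
  apply: (positive_value_bound V_cont cNu V_coercive _ _ B_brownian) => //.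
  + move=> phi tphi.
    have neg (F : 'rV[R]_n -> R) : \int[lebesgue_n R n]_t (- u (tuple_row t) * F (tuple_row t)) =
        - \int[lebesgue_n R n]_t (u (tuple_row t) * F (tuple_row t)).
      by rewrite -Rintegral_oppr; congr Rintegral; apply/funext => t; rewrite mulNr.
    rewrite (neg phi) mulrN -(weak phi tphi).
    exact: (neg (fun x => - 2^-1 * laplacian phi x + V x * phi x)).
  + by move=> y yE; rewrite normrN; exact: u_decay.
  + by rewrite oppr_gt0.
  + by move=> y; rewrite normrN.
- rewrite (gtr0_norm ux).
  exact: (positive_value_bound V_cont cu V_coercive weak u_decay B_brownian ux x_forbidden alpha_gt uS).
- rewrite ux normr0.
  have S0 : (0 <= sup_norm u)%E by apply: le_trans (uS x).
  rewrite adde_ge0 ?mule_ge0// lee_fin mulr_ge0 ?expR_ge0//.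
  have := u_decay x x_forbidden; rewrite ux normr0; have := agmon_allowed_ge0 V lambda x; move: alpha_gt.
  case: (agmon_allowed V lambda x) => [a| |]//= _ _.
  by rewrite -EFinM lee_fin pmulr_lge0 ?expR_gt0.
Qed.
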